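(* Let $\mathfrak g=\mathfrak{so}(3)$ over $\mathbb C$, let $\mathfrak G=C_{CE}(\mathfrak g,\mathcal S\mathfrak g)[1]$ with differential $\delta=\delta_{\mathfrak g}$ and Schouten bracket $[\cdot,\cdot]_s$, let $\mathfrak H$ be its cohomology, and let $\mathfrak G_{\mathrm{red}}\subset\mathfrak G$ and $i:\mathfrak H\to\mathfrak G_{\mathrm{red}}$ be as defined in the context. 1. The Chevalley-Eilenberg complex $(\mathfrak G,\delta,[\cdot,\cdot]_s)$ of $\mathfrak{so}(3)$ is NOT ($L_\infty$-)formal. 2. There is an $L_\infty$-structure $d$ on $\mathcal S(\mathfrak H[1])$ whose only nonvanishing Taylor coefficient is $d_3$ (which can be given by the shifted characteristic $3$-cocycle $z_3$, i.e. $d_3=z_3[1]$) for its only nonvanishing component (up to permutations). 3. There is an $L_\infty$-quasi-isomorphism $e^{*\varphi}$ from $\big(\mathcal S(\mathfrak H[1]),\overline{d_3}\big)$ to $\big(\mathcal S(\mathfrak G_{\mathrm{red}}[1]),\overline{\delta[1]}+\overline{D_2}\big)$, where $D_2=[\cdot,\cdot]_s[1]$ denotes the shifted Schouten bracket. The only nonvanishing Taylor coefficients of $e^{*\varphi}$ are $\varphi_1=i[1]$ and $\varphi_2$, which can explicitly be given.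
   Context: **The Lie algebra.** $\mathfrak{so}(3)$ has basis $e_1,e_2,e_3$ with $[e_1,e_2]=e_3$, $[e_2,e_3]=e_1$, $[e_3,e_1]=e_2$, and Killing form $\kappa(e_i,e_j)=-2\delta_{ij}$. **Chevalley-Eilenberg complex.** $C_{CE}(\mathfrak g,\mathcal S\mathfrak g)=\mathcal S\mathfrak g\otimes\Lambda\mathfrak g^*$, graded by form degree, $\mathcal S\mathfrak g$ carrying the adjoint action; $\wedge$ is the graded commutative multiplication. With dual basis $\epsilon^i$, interior products $\iota_{e_i}$ on $\Lambda\mathfrak g^*$ and the derivations $\partial^i$ of $\mathcal S\mathfrak g$ determined by $\epsilon^i$, the Schouten bracket is $[F,G]_s=\sum_i\iota_{e_i}(F)\wedge\partial^iG-(-1)^{(|F|-1)(|G|-1)}\sum_i\iota_{e_i}(G)\wedge\partial^iF$ ($|\cdot|$ the form degree). $\pi=\frac12\sum c^i_{jk}e_i\otimes(\epsilon^j\wedge\epsilon^k)$ with $c^i_{jk}=\epsilon^i([e_j,e_k])$, and $\delta_{\mathfrak g}=[\pi,\cdot]_s$. In $\mathfrak G=C_{CE}(\mathfrak g,\mathcal S\mathfrak g)[1]$ a $k$-form has degree $k-1$; $(\mathfrak G,\delta_{\mathfrak g},[\cdot,\cdot]_s)$ is a differential graded Lie algebra. **Special elements.** $q\in\mathcal S^2\mathfrak g$ is the inverse of $\kappa$ (i.e. $q=\sum q^{ij}e_ie_j$, $(q^{ij})$ the inverse matrix of $(\kappa(e_i,e_j))$), $\mathbb C[q]\subset\mathcal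 S\mathfrak g$ the subalgebra of polynomials in $q$; $E=\sum_ie_i\otimes\epsilon^i$ (Euler field); $\Omega\in\Lambda^3\mathfrak g^*$, $\Omega(\xi,\xi',\xi'')=\kappa(\xi,[\xi',\xi''])$ (Cartan $3$-cocycle). $\mathfrak G_{\mathrm{red}}=\mathbb C[q]\mathbf 1\oplus\mathbb C[q]E\oplus\mathbb C[q]\pi\oplus\mathbb C[q]\Omega$, a differential graded Lie subalgebra of $\mathfrak G$. The cohomology $\mathfrak H$ of $(\mathfrak G,\delta)$ is $H_{CE}(\mathfrak g,\mathcal S\mathfrak g)[1]\cong\mathbb C[q]\mathbf 1\oplus\mathbb C[q]\Omega$; $i:\mathfrak H\to\mathfrak G_{\mathrm{red}}$ is the natural injection given by this identification. **$L_\infty$ notions.** $V[1]^i=V^{i+1}$. $\mathcal SV$ is the graded symmetric algebra of a graded vector space $V$ with shuffle comultiplication, the cofree graded cocommutative connected coalgebra on $V$. Every linear $d:\mathcal SV\to V$ extends to a unique graded coderivation $\overline d$ of $\mathcal SV$ with $\mathrm{pr}_V\circ\overline d=d$, and every degree-$0$ linear map $\varphi:\mathcal SU\to V$ with $\varphi(\mathbf 1)=0$ determines a unique morphism of graded connected coalgebras $e^{*\varphi}:\mathcal SU\to\mathcal SV$ with $\mathrm{pr}_V\circ e^{*\varphi}=\varphi$. The restrictions $d_n,\varphi_n$ of $d,\varphi$ to $\mathcal S^n$ are the Taylor coefficients of $\overline d$ and $e^{*\varphi}$; the components of a Taylor coefficient are its restrictions to products of homogeneous summands. An $L_\infty$-structure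 on $W$ is a graded coderivation $\mathcal D=\overline d$ of $\mathcal S(W[1])$ of degree $1$ with $\mathcal D^2=0$, $\mathcal D(\mathbf 1)=0$ (also referred to by $d$); an $L_\infty$-morphism is a morphism of graded connected coalgebras intertwining the differentials; it is an $L_\infty$-quasi-isomorphism if its first component $\varphi_1$ induces an isomorphism in cohomology with respect to the first Taylor coefficients of the differentials. For $\phi:V^{\otimes k}\to W$, $\phi[1]=s^{-1}\circ\phi\circ s^{\otimes k}$ with $s:V[1]\to V$ the degree-one identity (Koszul rule). A differential graded Lie algebra $(\mathfrak G,b,[\cdot,\cdot])$ corresponds to the $L_\infty$-structure $\overline{b[1]+[\cdot,\cdot][1]}$; it is formal if there is an $L_\infty$-quasi-isomorphism to it from its cohomology $\mathfrak H$ with $L_\infty$-structure $\overline{[\cdot,\cdot]_H[1]}$, $[\cdot,\cdot]_H$ the induced bracket. **Characteristic $3$-cocycle.** For a differential graded Lie algebra $(\mathfrak G,b,[\cdot,\cdot])$ with cocycles $Z\mathfrak G$ and projection $\mathrm p:Z\mathfrak G\to\mathfrak H$, choose a degree-$0$ linear map $\phi_1:\mathfrak H\to Z\mathfrak G$ with $\mathrm p\circ\phi_1=\mathrm{id}$ and a degree $-1$ graded antisymmetric bilinear map $\phi_2:\Lambda^2\mathfrak H\to\mathfrak G$ with $b(\phi_2(y,y'))+[\phi_1(y),\phi_1(y')]-\phi_1([y,y']_H)=0$. Put $$\begin{aligned}w_3(y_1,y_2,y_3)=&(-1)^{|y_1|}[\phi_1(y_1),\phi_2(y_2,y_3)]-(-1)^{|y_2|+|y_1||y_2|}[\phi_1(y_2),\phi_2(y_1,y_3)]\\&+(-1)^{|y_3|+|y_3|(|y_1|+|y_2|)}[\phi_1(y_3),\phi_2(y_1,y_2)]-\phi_2([y_1,y_2]_H,y_3)\\&+(-1)^{|y_2||y_3|}\phi_2([y_1,y_3]_H,y_2)-(-1)^{(|y_2|+|y_3|)|y_1|}\phi_2([y_2,y_3]_H,y_1).\end{aligned}$$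 It takes values in cocycles; $z_3=\mathrm p\circ w_3:\Lambda^3\mathfrak H\to\mathfrak H$ is the (representing) characteristic $3$-cocycle. Here it is taken for $(\mathfrak G,\delta_{\mathfrak g},[\cdot,\cdot]_s)$ with some such choice of $\phi_1,\phi_2$.
   Formalization: d_3 has two nonvanishing component types up to permutation, not one: d_3(q·q·Ω)=-8q and d_3(q·qΩ·Ω)=8qΩ are both nonzero; interior products contract the last argument, and φ[1] has sign (-1)^{Σ(k-i)|s x_i|} with degrees taken in V, so that d_3=z_3[1] is consistent. *)

(* Defs.v *)
From HB Require Import structures.
From mathcomp Require Import all_boot all_order all_algebra.
From mathcomp Require Import ring.
From mathcomp Require Import boolp reals complex.
From mathcomp Require Import finmap monalg.
From mathcomp Require ssrcomplements mpoly.

Set Implicit Arguments.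
Unset Strict Implicit.
Unset Printing Implicit Defensive.

Import GRing.Theory.
Local Open Scope ring_scope.

Section Span.
Variables (K : fieldType) (V : lmodType K) (P : V -> Prop).

Inductive in_span : V -> Prop :=
| span0 : in_span 0
| spanDZ a x y : P x -> in_span y -> in_span (a *: x + y).

Lemma span_gen x : P x -> in_span x.
Proof. by move=> Px; have := spanDZ 1 Px span0; rewrite scale1r addr0. Qed.

Lemma spanD x y : in_span x -> in_span y -> in_span (x + y).
Proof.
move=> + Sy; elim=> [|a {}x z Px _ IH]; first by rewrite add0r.
by rewrite -addrA; apply: spanDZ.
Qed.

Lemma spanZ a x : in_span x -> in_span (a *: x).
Proof.
elim=> [|b {}x z Px _ IH]; first by rewrite scaler0; exact: span0.
by rewrite scalerDr scalerA; apply: spanDZ.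
Qed.

Definition span : {pred V} := fun x => `[< in_span x >].

Lemma spanP x : reflect (in_span x) (x \in span).
Proof. exact: asboolP. Qed.

Lemma span_submod_closed : subsemimod_closed span.
Proof.
split; first split.
- by apply/spanP; exact: span0.
- by move=> x y /spanP Sx /spanP Sy; apply/spanP; exact: spanD.
- by move=> a x /spanP Sx; apply/spanP; exact: spanZ.
Qed.

HB.instance Definition _ :=
  GRing.isSubmodClosed.Build K V span span_submod_closed.

Definition subsp := {x : V | x \in span}.
HB.instance Definition _ := [isSub of subsp for @sval V _].
HB.instance Definition _ := [Choice of subsp by <:].
HB.instance Definition _ := [SubChoice_isSubLmodule of subsp by <:].

Definition quotsp := Quotient.quot span.
HB.instance Definition _ := Choice.on quotsp.
HB.instance Definition _ := GRing.Zmodule.on quotsp.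

Definition qpi (x : V) : quotsp := (\pi_(Quotient.quot span) x)%qT.
Definition qrepr (u : quotsp) : V := repr (u : Quotient.quot span).

Lemma qreprK u : qpi (qrepr u) = u. Proof. exact: reprK. Qed.

Lemma qpiP x y : qpi x = qpi y <-> in_span (x - y).
Proof.
split=> [e|/spanP]; last by rewrite Quotient.idealrBE => /eqP.
by apply/spanP; rewrite Quotient.idealrBE; apply/eqP.
Qed.

Lemma qpi_repr x : in_span (qrepr (qpi x) - x).
Proof. by apply/qpiP; rewrite qreprK. Qed.

Lemma qpiD x y : qpi (x + y) = qpi x + qpi y.
Proof. by rewrite /qpi !piE. Qed.

Lemma qpi0 : qpi 0 = 0. Proof. by rewrite /qpi !piE. Qed.

Definition qscale a (u : quotsp) : quotsp := qpi (a *: qrepr u).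

Lemma qpiZ a x : qpi (a *: x) = qscale a (qpi x).
Proof.
apply/qpiP; rewrite -scalerBr; apply: spanZ.
by rewrite -opprB -scaleN1r; apply: spanZ; exact: qpi_repr.
Qed.

Lemma qscaleA a b u : qscale a (qscale b u) = qscale (a * b) u.
Proof. by rewrite -[u]qreprK -!qpiZ scalerA. Qed.
Lemma qscale1 : left_id 1 qscale.
Proof. by move=> u; rewrite -[u]qreprK -!qpiZ scale1r. Qed.
Lemma qscaleDr : right_distributive qscale +%R.
Proof.
by move=> a u v; rewrite -[u]qreprK -[v]qreprK -qpiD -!qpiZ scalerDr qpiD.
Qed.
Lemma qscaleDl u : {morph qscale^~ u : a b / a + b}.
Proof. by move=> a b; rewrite -[u]qreprK -!qpiZ scalerDl qpiD. Qed.

HB.instance Definition _ := GRing.Zmodule_isLmodule.Build K quotsp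
  qscaleA qscale1 qscaleDr qscaleDl.

Lemma qpi_is_linear : linear qpi.
Proof. by move=> a x y; rewrite qpiD qpiZ. Qed.
HB.instance Definition _ := GRing.isLinear.Build K V quotsp _ qpi qpi_is_linear.

End Span.

Definition pres (K : fieldType) (T : choiceType) (R : {malg K[T]} -> Prop) :=
  quotsp R.
HB.instance Definition _ K T R := GRing.Lmodule.on (@pres K T R).

HB.lock Definition gen (K : fieldType) (T : choiceType)
  (R : {malg K[T]} -> Prop) (t : T) : pres R := qpi R << t >>.

Section Presented.
Variables (K : fieldType) (T : choiceType) (R : {malg K[T]} -> Prop).
Local Notation pres := (pres R).
Local Notation gen := (gen R).

Variable W : lmodType K.

Definition mext (f : T -> W) (g : {malg K[T]}) : W :=
  \sum_(t <- msupp g) g@_t *: f t.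

(* A total function; it is the linear map extending [f] as soon as [f]
   satisfies the relations (lemmas [pelim_linear] and [pelim_gen]). *)
Definition pelim (f : T -> W) (u : pres) : W := mext f (qrepr u).

Lemma mextEw f g (d : {fset T}) : (msupp g `<=` d)%fset ->
  mext f g = \sum_(t <- d) g@_t *: f t.
Proof.
move=> sgd; rewrite /mext; apply: big_fset_incl => // t _ tg.
by rewrite mcoeff_outdom // scale0r.
Qed.

Lemma mext_linear f : linear (mext f).
Proof.
move=> a g h; pose d := (msupp (a *: g + h) `|` (msupp g `|` msupp h))%fset.
rewrite !(@mextEw f _ d) ?fsubsetUl //; last 2 first.
- by rewrite fsubsetU // fsubsetUr orbT.
- by rewrite fsubsetU // fsubsetUl orbT.
rewrite scaler_sumr -big_split /=; apply: eq_bigr => t _.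
by rewrite mcoeffD mcoeffZ scalerDl scalerA.
Qed.

HB.instance Definition _ f :=
  GRing.isLinear.Build K {malg K[T]} W _ (mext f) (mext_linear f).

Lemma mextU f t : mext f << t >> = f t.
Proof.
by rewrite /mext msuppU oner_eq0 big_seq_fset1 mcoeffUU scale1r.
Qed.

Lemma pres_sum (u : pres) :
  u = \sum_(t <- msupp (qrepr u)) (qrepr u)@_t *: gen t.
Proof.
rewrite -[LHS]qreprK [in LHS](monalgE (qrepr u)) linear_sum /=.
apply: eq_bigr => t _; rewrite gen.unlock -linearZ /=; congr qpi.
by apply/malgP=> k; rewrite mcoeffZ !mcoeffU mulr_natr.
Qed.

Lemma pres_ext (f g : pres -> W) : linear f -> linear g ->
  (forall t, f (gen t) = g (gen t)) -> f =1 g.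
Proof.
move=> fl gl fg u.
pose F : {linear pres -> W} :=
  HB.pack f (GRing.isLinear.Build K pres W _ f fl).
pose G : {linear pres -> W} :=
  HB.pack g (GRing.isLinear.Build K pres W _ g gl).
rewrite -[f u]/(F u) -[g u]/(G u) [u]pres_sum !linear_sum.
by apply: eq_bigr => t _; rewrite !linearZ /= fg.
Qed.

Section Respects.
Variable f : T -> W.
Hypothesis fR : forall g, R g -> mext f g = 0.

Lemma mext_span g : in_span R g -> mext f g = 0.
Proof.
elim=> [|a x y /fR x0 _ y0]; first by rewrite linear0.
by rewrite linearP /= x0 y0 scaler0 addr0.
Qed.

Lemma pelim_qpi g : pelim f (qpi R g) = mext f g.
Proof. by have /mext_span/eqP := qpi_repr R g; rewrite linearB subr_eq0 => /eqP. Qed.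

Lemma pelim_gen t : pelim f (gen t) = f t.
Proof. by rewrite gen.unlock pelim_qpi mextU. Qed.

Lemma pelim_linear : linear (pelim f).
Proof.
move=> a u v; rewrite -[u]qreprK -[v]qreprK -linearP.
by rewrite !pelim_qpi linearP.
Qed.
End Respects.

End Presented.

Section Tensor.
Variables (K : fieldType) (A B : lmodType K).

Inductive bilin_rel : {malg K[(A * B)%type]} -> Prop :=
| BilinL c x y z :
    bilin_rel (<< (c *: x + y, z) >> - c *: << (x, z) >> - << (y, z) >>)
| BilinR c x y z :
    bilin_rel (<< (z, c *: x + y) >> - c *: << (z, x) >> - << (z, y) >>).

Definition tens := pres bilin_rel.
HB.instance Definition _ := GRing.Lmodule.on tens.

Definition tensor (a : A) (b : B) : tens := gen bilin_rel (a, b).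

Variable W : lmodType K.

Definition bilinear_map (f : A -> B -> W) :=
  (forall b, linear (f^~ b)) /\ (forall a, linear (f a)).

Definition telim (f : A -> B -> W) : tens -> W := pelim (fun p => f p.1 p.2).

Section Bilinear.
Variable f : A -> B -> W.
Hypothesis fbil : bilinear_map f.

Let f_rel g : bilin_rel g -> mext (fun p => f p.1 p.2) g = 0.
Proof.
case: fbil => fl fr.
by case=> c x y z; rewrite !linearB linearZ /= !mextU /= ?fl ?fr addrAC addrK subrr.
Qed.

Lemma telimE a b : telim f (tensor a b) = f a b.
Proof. exact: pelim_gen. Qed.

Lemma telim_linear : linear (telim f).
Proof. exact: pelim_linear. Qed.
End Bilinear.

Lemma tens_ext (f g : tens -> W) : linear f -> linear g ->
  (forall a b, f (tensor a b) = g (tensor a b)) -> f =1 g.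
Proof. by move=> fl gl fg; apply: pres_ext => // -[a b]; exact: fg. Qed.

End Tensor.

Section TensorTheory.
Variables (K : fieldType) (A B : lmodType K).

Lemma tensorPl b : linear (fun a : A => tensor a (b : B)).
Proof.
move=> c x y; apply/eqP; rewrite -subr_eq0 /tensor gen.unlock -linearZ opprD addrA -!linearB.
apply/eqP; rewrite -(linear0 (qpi _)); apply/qpiP; rewrite subr0.
by apply: span_gen; exact: BilinL.
Qed.

Lemma tensorPr a : linear (fun b : B => tensor (a : A) b).
Proof.
move=> c x y; apply/eqP; rewrite -subr_eq0 /tensor gen.unlock -linearZ opprD addrA -!linearB.
apply/eqP; rewrite -(linear0 (qpi _)); apply/qpiP; rewrite subr0.
by apply: span_gen; exact: BilinR.
Qed.

End TensorTheory.

(* [gpr V i] is the projection of V onto its summand of degree i. *)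
Record gspace (K : fieldType) := GSpace {
  gcar :> lmodType K;
  gpr : int -> gcar -> gcar;
  gpr_linear : forall i, linear (gpr i);
  gprI : forall i j x, gpr i (gpr j x) = if i == j then gpr j x else 0;
  gpr_sum : forall x, exists2 s : seq int, uniq s & x = \sum_(i <- s) gpr i x }.

HB.instance Definition _ (K : fieldType) (V : gspace K) i :=
  GRing.isLinear.Build K V V _ (@gpr K V i) (gpr_linear i).

Section Graded.
Variables (K : fieldType).
Implicit Type V : gspace K.

Section Shift.
Variable V : gspace K.

Fact gshift_linear i : linear (@gpr K V (i + 1)). Proof. exact: gpr_linear. Qed.
Fact gshiftI i j (x : V) :
  gpr (i + 1) (gpr (j + 1) x) = if i == j then gpr (j + 1) x else 0.
Proof. by rewrite gprI (inj_eq (addIr _)). Qed.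
Fact gshift_sum (x : V) :
  exists2 s : seq int, uniq s & x = \sum_(i <- s) gpr (i + 1) x.
Proof.
have [s us xs] := gpr_sum x; exists [seq i - 1 | i <- s].
  by rewrite map_inj_uniq //; exact: addIr.
by rewrite big_map [LHS]xs; apply: eq_bigr => i _; rewrite subrK.
Qed.

Definition gshift : gspace K := GSpace gshift_linear gshiftI gshift_sum.
End Shift.

(* Homogeneous elements of V together with a degree; 0 has every degree. *)
Definition homog V := {p : int * V | gpr p.1 p.2 == p.2}.
Definition hdeg V (x : homog V) : int := (sval x).1.
Definition hval V (x : homog V) : V := (sval x).2.

(* The degree one map s : V[1] -> V on homogeneous elements. *)
Definition susp V (x : homog (gshift V)) : homog V :=
  exist (fun p : int * V => gpr p.1 p.2 == p.2) (hdeg x + 1, hval x) (svalP x).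

Section SubQuotient.
Variables (V : gspace K) (P : V -> Prop).

Definition homog_part (x : V) := P x /\ exists i, gpr i x = x.

Lemma gpr_span i x : in_span homog_part x -> in_span homog_part (gpr i x).
Proof.
elim=> [|a {}x y [Px [j xj]] _ IH]; first by rewrite linear0; exact: span0.
rewrite linearP /=; apply: spanD IH; apply: spanZ.
rewrite -xj gprI; case: eqP => _; last exact: span0.
by rewrite xj; apply: span_gen; split=> //; exists j.
Qed.

Let Z := subsp homog_part.

Definition gsub_pr i (u : Z) : Z :=
  exist _ (gpr i (val u)) (introT (spanP _ _) (gpr_span i (elimT (spanP _ _) (valP u)))).

Fact gsub_linear i : linear (gsub_pr i).
Proof. by move=> a u v; apply: val_inj; rewrite /= linearP. Qed.
Fact gsubI i j u : gsub_pr i (gsub_pr j u) = if i == j then gsub_pr j u else 0.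
Proof. by apply: val_inj; rewrite (fun_if val) /= gprI. Qed.
Fact gsub_sum (u : Z) :
  exists2 s : seq int, uniq s & u = \sum_(i <- s) gsub_pr i u.
Proof.
have [s us xs] := gpr_sum (val u); exists s => //.
by apply: val_inj; rewrite [LHS]xs raddf_sum.
Qed.

Definition gsub : gspace K := GSpace gsub_linear gsubI gsub_sum.

(* [gsub_of] is the partial inverse of [gsub_val]: it is 0 outside the
   subspace. *)
Definition gsub_val (u : gsub) : V := val (u : Z).
Definition gsub_of (x : V) : gsub := insubd (0 : Z) x.

Let Q := quotsp homog_part.

Definition gquot_pr i (u : Q) : Q := qpi homog_part (gpr i (qrepr u)).

Lemma gquot_prE i x : gquot_pr i (qpi homog_part x) = qpi homog_part (gpr i x).
Proof.
apply/qpiP; have := gpr_span i (qpi_repr homog_part x).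
by rewrite linearB.
Qed.

Fact gquot_linear i : linear (gquot_pr i).
Proof.
move=> a u v; rewrite -[u]qreprK -[v]qreprK.
rewrite -[X in gquot_pr i X](linearP (qpi homog_part)) !gquot_prE.
by rewrite linearP [LHS]linearP.
Qed.
Fact gquotI i j u :
  gquot_pr i (gquot_pr j u) = if i == j then gquot_pr j u else 0.
Proof.
by rewrite -[u]qreprK !gquot_prE gprI; case: eqP => // _; rewrite linear0.
Qed.
Fact gquot_sum (u : Q) :
  exists2 s : seq int, uniq s & u = \sum_(i <- s) gquot_pr i u.
Proof.
have [s us xs] := gpr_sum (qrepr u); exists s => //.
by rewrite -[u in LHS]qreprK [in LHS]xs linear_sum.
Qed.

Definition gquot : gspace K := GSpace gquot_linear gquotI gquot_sum.
End SubQuotient.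

End Graded.

Section LinearPredicates.
Variables (K : fieldType) (U V W : lmodType K).

Lemma linear_addf (f g : U -> V) :
  linear f -> linear g -> linear (fun x => f x + g x).
Proof. by move=> fl gl a x y; rewrite fl gl scalerDr addrACA. Qed.

Lemma linear_scalef c (f : U -> V) : linear f -> linear (fun x => c *: f x).
Proof. by move=> fl a x y; rewrite fl scalerDr !scalerA mulrC. Qed.

Lemma linear_compf (f : V -> W) (g : U -> V) :
  linear f -> linear g -> linear (fun x => f (g x)).
Proof. by move=> fl gl a x y; rewrite gl fl. Qed.

Lemma linear_sumf (f : U -> V) I (r : seq I) (c : I -> K) (x : I -> U) :
  linear f -> f (\sum_(i <- r) c i *: x i) = \sum_(i <- r) c i *: f (x i).
Proof.
move=> fl; pose F : {linear U -> V} :=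
  HB.pack f (GRing.isLinear.Build K U V _ f fl).
rewrite -[f]/(F : U -> V) linear_sum; apply: eq_bigr => i _.
by rewrite linearZ.
Qed.

Lemma linearDf (f : U -> V) : linear f -> {morph f : x y / x + y}.
Proof. by move=> fl x y; rewrite -[x in LHS]scale1r fl scale1r. Qed.

Lemma linear0f (f : U -> V) : linear f -> f 0 = 0.
Proof. by move=> fl; apply: (addrI (f 0)); rewrite -linearDf // !addr0. Qed.

Lemma linearZf (f : U -> V) c x : linear f -> f (c *: x) = c *: f x.
Proof. by move=> fl; rewrite -[c *: x]addr0 fl linear0f // addr0. Qed.

End LinearPredicates.

Section SymCoalgebra.
Variables (K : fieldType) (V : gspace K).
Implicit Types (x y z : homog V) (u v w s t : seq (homog V)).

Definition wdeg w : int := \sum_(x <- w) hdeg x.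

Inductive sym_rel : {malg K[seq (homog V)]} -> Prop :=
| SymLin s t a x y z :
    hdeg x = hdeg z -> hdeg y = hdeg z -> hval z = a *: hval x + hval y ->
    sym_rel (<< s ++ z :: t >> - a *: << s ++ x :: t >> - << s ++ y :: t >>)
| SymComm s t x y :
    sym_rel (<< s ++ [:: x, y & t] >>
             - ((-1) ^ (hdeg x * hdeg y) : K) *: << s ++ [:: y, x & t] >>).

(* The graded symmetric algebra S V, with [sprod [:: x1; ..; xn]] the product
   of the xi; [sprod [::]] is the unit. *)
Definition Sym := pres sym_rel.
HB.instance Definition _ := GRing.Lmodule.on Sym.
Definition sprod w : Sym := gen sym_rel w.

Definition sym_deg (n : int) : Sym -> Prop :=
  in_span (fun a => exists2 w, wdeg w = n & a = sprod w).

(* All ways (p, u, v) to unshuffle a word w into subwords u and v, the Koszul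
   sign of passing from w to u v being (-1)^p. *)
Fixpoint unshuffles w : seq (int * seq (homog V) * seq (homog V)) :=
  if w is x :: w' then
    [seq (c.1.1, x :: c.1.2, c.2) | c <- unshuffles w'] ++
    [seq (c.1.1 + hdeg x * wdeg c.1.2, c.1.2, x :: c.2) | c <- unshuffles w']
  else [:: (0, [::], [::])].

Definition comul_word w : tens Sym Sym :=
  \sum_(c <- unshuffles w)
     ((-1) ^ c.1.1 : K) *: tensor (sprod c.1.2) (sprod c.2).

Definition comul : Sym -> tens Sym Sym := pelim comul_word.
Definition counit : Sym -> K^o := pelim (fun w => (w == [::])%:R).
Definition spr : Sym -> V :=
  pelim (fun w => if w is [:: x] then hval x else 0).

(* On elements of degree m this is multiplication by (-1)^(n m). *)
Definition sgn_op (n : int) : Sym -> Sym :=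
  pelim (fun w => ((-1) ^ (n * wdeg w) : K) *: sprod w).

Lemma sprod_lin s t a x y z :
  hdeg x = hdeg z -> hdeg y = hdeg z -> hval z = a *: hval x + hval y ->
  sprod (s ++ z :: t) = a *: sprod (s ++ x :: t) + sprod (s ++ y :: t).
Proof.
move=> xz yz e; apply/eqP; rewrite -subr_eq0 /sprod gen.unlock -linearZ opprD addrA -!linearB.
apply/eqP; rewrite -(linear0 (qpi _)); apply/qpiP; rewrite subr0.
by apply: span_gen; exact: SymLin.
Qed.

Lemma sprod_comm s t x y :
  sprod (s ++ [:: x, y & t])
    = ((-1) ^ (hdeg x * hdeg y) : K) *: sprod (s ++ [:: y, x & t]).
Proof.
apply/eqP; rewrite -subr_eq0 /sprod gen.unlock -linearZ -!linearB.
apply/eqP; rewrite -(linear0 (qpi _)); apply/qpiP; rewrite subr0.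
by apply: span_gen; exact: SymComm.
Qed.

Definition sym_compat (W : lmodType K) (f : seq (homog V) -> W) :=
  (forall s t a x y z,
    hdeg x = hdeg z -> hdeg y = hdeg z -> hval z = a *: hval x + hval y ->
    f (s ++ z :: t) = a *: f (s ++ x :: t) + f (s ++ y :: t)) /\
  (forall s t x y, f (s ++ [:: x, y & t])
     = ((-1) ^ (hdeg x * hdeg y) : K) *: f (s ++ [:: y, x & t])).

Section Elim.
Variables (W : lmodType K) (f : seq (homog V) -> W).
Hypothesis fc : sym_compat f.

Let f_rel g : sym_rel g -> mext f g = 0.
Proof.
case: fc => fl fs; case=> [s t a x y z xz yz e|s t x y].
  by rewrite !linearB linearZ /= !mextU (fl _ _ a x y) // addrAC addrK subrr.
by rewrite linearB linearZ /= !mextU fs subrr.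
Qed.

Lemma sym_elimE w : pelim f (sprod w) = f w. Proof. exact: pelim_gen. Qed.
Lemma sym_elim_linear : linear (pelim f : Sym -> W).
Proof. exact: pelim_linear. Qed.
End Elim.

Lemma wdeg_nil : wdeg [::] = 0. Proof. by rewrite /wdeg big_nil. Qed.
Lemma wdeg_cons x w : wdeg (x :: w) = hdeg x + wdeg w.
Proof. by rewrite /wdeg big_cons. Qed.
Lemma wdeg_cat u w : wdeg (u ++ w) = wdeg u + wdeg w.
Proof. by rewrite /wdeg big_cat. Qed.

Lemma counit_compat : @sym_compat K^o (fun w => (w == [::])%:R).
Proof.
split=> [s t a x y z _ _ _|s t x y].
  by case: s => [|? ?] /=; rewrite scaler0 addr0.
by case: s => [|? ?] /=; rewrite scaler0.
Qed.

Lemma counitE w : counit (sprod w) = (w == [::])%:R.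
Proof. exact: sym_elimE counit_compat _. Qed.
Lemma counit_linear : linear counit.
Proof. exact: sym_elim_linear counit_compat. Qed.

Lemma spr_compat :
  @sym_compat V (fun w => if w is [:: x] then hval x else 0).
Proof.
split=> [s t a x y z _ _ e|s t x y].
  by case: s t => [|? [|? ?]] [|? ?] //=; rewrite scaler0 addr0.
by case: s => [|? [|? ?]] /=; rewrite scaler0.
Qed.

Lemma sprE w : spr (sprod w) = if w is [:: x] then hval x else 0.
Proof. exact: sym_elimE spr_compat _. Qed.
Lemma spr_linear : linear spr.
Proof. exact: sym_elim_linear spr_compat. Qed.

Lemma sgn_op_compat n :
  sym_compat (fun w => ((-1) ^ (n * wdeg w) : K) *: sprod w).
Proof.
split=> [s t a x y z xz yz e|s t x y].
  rewrite (sprod_lin s t xz yz e) !wdeg_cat !wdeg_cons xz yz.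
  by rewrite scalerDr !scalerA mulrC.
rewrite sprod_comm !wdeg_cat !wdeg_cons (addrCA (hdeg x)).
by rewrite !scalerA mulrC.
Qed.

Lemma sgn_opE n w : sgn_op n (sprod w) = ((-1) ^ (n * wdeg w) : K) *: sprod w.
Proof. exact: sym_elimE (sgn_op_compat n) _. Qed.
Lemma sgn_op_linear n : linear (sgn_op n).
Proof. exact: sym_elim_linear (sgn_op_compat n). Qed.

Definition smul x : Sym -> Sym := pelim (fun w => sprod (x :: w)).

Lemma smul_compat x : sym_compat (fun w => sprod (x :: w)).
Proof.
split=> [s t a y z y' yy' zy' e|s t y z]; last exact: (sprod_comm (x :: s)).
exact: (sprod_lin (x :: s)).
Qed.

Lemma smulE x w : smul x (sprod w) = sprod (x :: w).
Proof. exact: sym_elimE (smul_compat x) _. Qed.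
Lemma smul_linear x : linear (smul x).
Proof. exact: sym_elim_linear (smul_compat x). Qed.

Let lmul_fun x (a b : Sym) : tens Sym Sym :=
  tensor (smul x a) b + tensor (sgn_op (hdeg x) a) (smul x b).

Definition lmul x : tens Sym Sym -> tens Sym Sym := telim (lmul_fun x).

Lemma lmul_bilinear x : bilinear_map (lmul_fun x).
Proof.
split=> [b|a]; apply: linear_addf.
- apply: (linear_compf (f := fun a => tensor a b)); [exact: tensorPl|exact: smul_linear].
- by apply: (linear_compf (f := fun a => tensor a _)); [exact: tensorPl|exact: sgn_op_linear].
- exact: tensorPr.
- by apply: linear_compf; [exact: tensorPr|exact: smul_linear].
Qed.

Lemma lmulE x a b : lmul x (tensor a b) =
  tensor (smul x a) b + tensor (sgn_op (hdeg x) a) (smul x b).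
Proof. exact: telimE (lmul_bilinear x) _ _. Qed.
Lemma lmul_linear x : linear (lmul x).
Proof. exact: telim_linear (lmul_bilinear x). Qed.

Lemma tensorZl c (a b : Sym) : tensor (c *: a) b = c *: tensor a b.
Proof. exact: (linearZf c a (tensorPl b)). Qed.
Lemma tensorZr c (a b : Sym) : tensor a (c *: b) = c *: tensor a b.
Proof. exact: (linearZf c b (tensorPr a)). Qed.

Lemma lmul_sprod x u v : lmul x (tensor (sprod u) (sprod v)) =
  tensor (sprod (x :: u)) (sprod v) +
  ((-1) ^ (hdeg x * wdeg u) : K) *: tensor (sprod u) (sprod (x :: v)).
Proof. by rewrite lmulE !smulE sgn_opE tensorZl. Qed.

Lemma comul_word_cons x w : comul_word (x :: w) = lmul x (comul_word w).
Proof.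
rewrite /comul_word /= big_cat !big_map (linear_sumf _ _ _ (@lmul_linear x)) /=.
rewrite -big_split /=; apply: eq_bigr => -[[p u] v] _ /=.
rewrite lmulE !smulE sgn_opE tensorZl scalerDr scalerA -expfzDr //.
by rewrite oppr_eq0 oner_eq0.
Qed.

Lemma tens_sym_ext (W : lmodType K) (f g : tens Sym Sym -> W) :
  linear f -> linear g ->
  (forall u v, f (tensor (sprod u) (sprod v)) = g (tensor (sprod u) (sprod v)))
  -> f =1 g.
Proof.
move=> fl gl fg; apply: tens_ext => // a b.
apply: (@pres_ext _ _ _ _ (fun a => f (tensor a b)) (fun a => g (tensor a b))).
- by apply: linear_compf => //; exact: tensorPl.
- by apply: linear_compf => //; exact: tensorPl.
move=> u.
apply: (@pres_ext _ _ _ _ (fun b => f (tensor (gen _ u) b))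
                          (fun b => g (tensor (gen _ u) b))).
- by apply: linear_compf => //; exact: tensorPr.
- by apply: linear_compf => //; exact: tensorPr.
by move=> v; exact: fg.
Qed.

Lemma lmul_lin a x y z X :
  hdeg x = hdeg z -> hdeg y = hdeg z -> hval z = a *: hval x + hval y ->
  lmul z X = a *: lmul x X + lmul y X.
Proof.
move=> xz yz e.
apply: (tens_sym_ext (f := lmul z) (g := fun X => a *: lmul x X + lmul y X)).
- exact: lmul_linear.
- by apply: linear_addf; [apply: linear_scalef|]; exact: lmul_linear.
move=> u v; rewrite !lmulE !smulE !sgn_opE xz yz.
rewrite !(sprod_lin [::] _ xz yz e) /= tensorPl tensorPr.
by rewrite scalerDr addrACA.
Qed.

Let lmul_comm_aux (W : lmodType K) (a b c : K) (T1 T2 T3 T4 : W) :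
  a * a = 1 ->
  a *: T1 + (a * b) *: T2 + c *: (T3 + b *: (a *: T4)) =
  a *: (T1 + (a * c) *: T3 + b *: (T2 + c *: T4)).
Proof.
move=> aa; rewrite !scalerDr !scalerA mulrA aa mul1r -!addrA.
congr (_ + _); rewrite addrCA; congr (_ + (_ + _ *: _)).
by rewrite -mulrA mulrC [b * a]mulrC.
Qed.

Lemma lmul_comm x y X :
  lmul x (lmul y X) = ((-1) ^ (hdeg x * hdeg y) : K) *: lmul y (lmul x X).
Proof.
apply: (tens_sym_ext (f := fun X => lmul x (lmul y X))
  (g := fun X => ((-1) ^ (hdeg x * hdeg y) : K) *: lmul y (lmul x X))).
- by apply: linear_compf; exact: lmul_linear.
- by apply: linear_scalef; apply: linear_compf; exact: lmul_linear.
move=> u v; rewrite !lmul_sprod.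
have lD z := linearDf (lmul_linear z).
have lZ z c A := linearZf c A (lmul_linear z).
rewrite !lD !lZ !lmul_sprod !wdeg_cons.
rewrite (sprod_comm [::] u x y) (sprod_comm [::] v x y) /=.
rewrite [tensor (_ *: sprod [:: y, x & u]) _]tensorZl.
rewrite [tensor _ (_ *: sprod [:: y, x & v])]tensorZr.
have N1 : (-1 : K) != 0 by rewrite oppr_eq0 oner_eq0.
have sq n : ((-1 : K) ^ n) * (-1) ^ n = 1.
  by rewrite -expfzMl mulrNN mulr1 exp1rz.
rewrite !mulrDr !expfzDr // [hdeg y * hdeg x]mulrC.
exact: lmul_comm_aux.
Qed.

Lemma comul_compat : sym_compat comul_word.
Proof.
have cat s t : comul_word (s ++ t) = foldr (fun x => lmul x) (comul_word t) s.
  by elim: s => //= x s IH; rewrite comul_word_cons IH.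
have flin s : linear (foldr (fun x => lmul x) ^~ s).
  elim: s => [|x s IH] //= a X Y; rewrite IH; exact: lmul_linear.
split=> [s t a x y z xz yz e|s t x y]; rewrite !cat !comul_word_cons.
  by rewrite (lmul_lin _ xz yz e) flin.
by rewrite lmul_comm (linearZf _ _ (flin s)).
Qed.

Lemma comulE w : comul (sprod w) = comul_word w.
Proof. exact: sym_elimE comul_compat _. Qed.
Lemma comul_linear : linear comul.
Proof. exact: sym_elim_linear comul_compat. Qed.

End SymCoalgebra.

Section Linfty.
Variable K : fieldType.
Implicit Types U V : gspace K.

(* Graded coderivation of degree n: [comul \o D = (D (x) 1 + 1 (x) D) \o comul],
   with (1 (x) D)(a (x) b) = (-1)^(n |a|) a (x) D b. *)
Definition coderivation V (n : int) (D : Sym V -> Sym V) :=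
  (forall w, sym_deg (wdeg w + n) (D (sprod w))) /\
  (forall a, comul (D a)
     = telim (fun x y => tensor (D x) y + tensor (sgn_op n x) (D y)) (comul a)).

Definition coalg_morphism U V (F : Sym U -> Sym V) :=
  [/\ forall w, sym_deg (wdeg w) (F (sprod w)),
      forall a, comul (F a) = telim (fun x y => tensor (F x) (F y)) (comul a),
      forall a, counit (F a) = counit a
    & F (sprod [::]) = sprod [::]].

(* The Taylor coefficient of order n is [taylor F] on words of length n. *)
Definition taylor U V (F : Sym U -> Sym V) (w : seq (homog U)) : V :=
  spr (F (sprod w)).

(* L-infinity structure on W, for V = W[1]. *)
Definition Linfty_structure V (D : Sym V -> Sym V) :=
  [/\ coderivation 1 D, forall a, D (D a) = 0 & D (sprod [::]) = 0].

Definition Linfty_morphism U V (D : Sym U -> Sym U) (D' : Sym V -> Sym V)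
    (F : Sym U -> Sym V) :=
  coalg_morphism F /\ (forall a, F (D a) = D' (F a)).

(* f : U -> V of degree 0 is bijective from ker d / im d to ker d' / im d'. *)
Definition cohomology_iso U V (d : homog U -> U) (d' : homog V -> V)
    (f : homog U -> V) :=
  (forall x, d x = 0 ->
     (exists2 y, hdeg y = hdeg x - 1 & f x = d' y) ->
     exists2 x', hdeg x' = hdeg x - 1 & hval x = d x') /\
  (forall y, d' y = 0 ->
     exists x, [/\ hdeg x = hdeg y, d x = 0
       & exists2 y', hdeg y' = hdeg y - 1 & hval y - f x = d' y']).

Definition Linfty_quasi_iso U V (D : Sym U -> Sym U) (D' : Sym V -> Sym V)
    (F : Sym U -> Sym V) :=
  Linfty_morphism D D' F /\
  cohomology_iso (fun x => taylor D [:: x]) (fun y => taylor D' [:: y])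
    (fun x => taylor F [:: x]).

(* phi[1] = s^-1 \o phi \o s^(x)k for a k-ary map phi, given on words of length
   k. The factors of s^(x)k are applied one after the other from the left, so
   that the j-th s passes s x_1, .., s x_(j-1): the sign exponent is the sum of
   (k - i) |s x_i|. Applying them from the right instead would multiply every
   binary and ternary phi[1] by -1; with the signs of [w3] below, the ternary
   coefficient making an L-infinity morphism with first coefficient phi_1[1]
   possible would then be - z_3[1] instead of z_3[1]. *)
Fixpoint shift_sign V (w : seq (homog V)) : int :=
  if w is x :: w' then (size w')%:Z * hdeg x + shift_sign w' else 0.

Definition shift_map V (W : lmodType K) (phi : seq (homog V) -> W)
    (w : seq (homog (gshift V))) : W :=
  let v := map (@susp K V) w in ((-1) ^ shift_sign v : K) *: phi v.

End Linfty.

Section DGLA.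
Variables (K : fieldType) (V : gspace K) (b : V -> V) (br : V -> V -> V).

Definition dgla_map (w : seq (homog V)) : V :=
  match w with
  | [:: x] => b (hval x)
  | [:: x; y] => br (hval x) (hval y)
  | _ => 0
  end.

Definition dgla_Linfty (D : Sym (gshift V) -> Sym (gshift V)) :=
  Linfty_structure D /\ (forall w, taylor D w = shift_map dgla_map w).

Definition cocycles : gspace K := gsub (fun x : V => b x = 0).

(* H^i is the quotient of the cocycles by the coboundaries of degree i. *)
Definition cohom : gspace K :=
  gquot (fun z : cocycles => exists x : V, gsub_val z = b x).

(* The projection p from the cocycles to the cohomology, extended by 0 to
   elements that are not cocycles. *)
Definition cls (x : V) : cohom := qpi _ (gsub_of (fun x : V => b x = 0) x).
Definition crepr (u : cohom) : V := gsub_val (qrepr u : cocycles).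

Definition cohom_br (u v : cohom) : cohom := cls (br (crepr u) (crepr v)).

Definition char_data (phi1 : cohom -> V) (phi2 : cohom -> cohom -> V) :=
  [/\ linear phi1 /\ (forall y : homog cohom,
          [/\ gpr (hdeg y) (phi1 (hval y)) = phi1 (hval y),
              b (phi1 (hval y)) = 0 & cls (phi1 (hval y)) = hval y]),
      (forall y, linear (phi2^~ y)) /\ (forall y, linear (phi2 y)),
      forall y y' : homog cohom,
        gpr (hdeg y + hdeg y' - 1) (phi2 (hval y) (hval y'))
          = phi2 (hval y) (hval y'),
      forall y y' : homog cohom, phi2 (hval y) (hval y')
          = - (((-1) ^ (hdeg y * hdeg y') : K) *: phi2 (hval y') (hval y))
    & forall y y',
        b (phi2 y y') + br (phi1 y) (phi1 y') - phi1 (cohom_br y y') = 0].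

Definition w3 (phi1 : cohom -> V) (phi2 : cohom -> cohom -> V)
    (y1 y2 y3 : homog cohom) : V :=
  let sg n : K := (-1) ^ n in
  let d1 := hdeg y1 in let d2 := hdeg y2 in let d3 := hdeg y3 in
  let v1 := hval y1 in let v2 := hval y2 in let v3 := hval y3 in
  sg d1 *: br (phi1 v1) (phi2 v2 v3)
  - sg (d2 + d1 * d2) *: br (phi1 v2) (phi2 v1 v3)
  + sg (d3 + d3 * (d1 + d2)) *: br (phi1 v3) (phi2 v1 v2)
  - phi2 (cohom_br v1 v2) v3
  + sg (d2 * d3) *: phi2 (cohom_br v1 v3) v2
  - sg ((d2 + d3) * d1) *: phi2 (cohom_br v2 v3) v1.

Definition z3 (phi1 : cohom -> V) (phi2 : cohom -> cohom -> V)
    (w : seq (homog cohom)) : cohom :=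
  if w is [:: y1; y2; y3] then cls (w3 phi1 phi2 y1 y2 y3) else 0.

End DGLA.

Definition formal (K : fieldType) (V : gspace K) (b : V -> V)
    (br : V -> V -> V) :=
  exists (DH : {linear Sym (gshift (cohom b)) -> Sym (gshift (cohom b))})
         (DV : {linear Sym (gshift V) -> Sym (gshift V)})
         (F : {linear Sym (gshift (cohom b)) -> Sym (gshift V)}),
    [/\ dgla_Linfty (fun=> 0) (cohom_br (b := b) br) DH,
        dgla_Linfty b br DV
      & Linfty_quasi_iso DH DV F].

Import ssrcomplements mpoly.

Section SO3.
Variable K : fieldType.

Local Notation Sg := {mpoly K[3]}.

Definition so3_br (x y : 'rV[K]_3) : 'rV[K]_3 :=
  \row_(k < 3) (x 0 (k + 1) * y 0 (k + 2) - x 0 (k + 2) * y 0 (k + 1)).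

Definition e_ (i : 'I_3) : 'rV[K]_3 := delta_mx 0 i.

Definition so3_ad (x : 'rV[K]_3) : 'M[K]_3 := lin1_mx (so3_br x).

Definition killing (x y : 'rV[K]_3) : K := \tr (so3_ad x *m so3_ad y).

Lemma so3_brE :
  [/\ so3_br (e_ 0) (e_ 1) = e_ 2, so3_br (e_ 1) (e_ 2) = e_ 0
    & so3_br (e_ 2) (e_ 0) = e_ 1].
Proof.
by split; apply/rowP => k; rewrite !mxE eqxx /=;
  case: k => [[|[|[|//]]] ?]; rewrite /= ?mulr1 ?mulr0 ?mul0r ?subr0 ?subrr.
Qed.

Lemma killingE i j : killing (e_ i) (e_ j) = (-2) *+ (i == j).
Proof.
rewrite /killing /mxtrace !big_ord_recl big_ord0 !mxE.
rewrite !big_ord_recl !big_ord0 !mxE.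
case: i => [[|[|[|//]]] ?]; case: j => [[|[|[|//]]] ?];
  rewrite /= ?(mulr0, mul0r, mulr1, mul1r, subr0, sub0r, addr0, add0r, mulrN,
    mulNr, opprK, oppr0, mulrNN, mulr1n, mulr0n); ring.
Qed.

Definition so3_c (i j k : 'I_3) : K := so3_br (e_ j) (e_ k) 0 i.

(* S g (x) Lambda g^*: the coordinate at [set i1 < .. < ik] is the coefficient
   of eps^i1 /\ .. /\ eps^ik, in S g = K[e_0, e_1, e_2]. *)
Local Notation CE := {ffun {set 'I_3} -> Sg}.

Definition formdeg (I : {set 'I_3}) : int := #|I|%:Z.

Definition form_part (k : int) (F : CE) : CE :=
  [ffun I : {set 'I_3} => if formdeg I == k then F I else 0].

Fact form_part_linear k : linear (form_part k).
Proof.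
move=> a F G; apply/ffunP => I; rewrite !ffunE.
by case: ifP => _; rewrite ?scaler0 ?addr0.
Qed.
Fact form_partI i j F :
  form_part i (form_part j F) = if i == j then form_part j F else 0.
Proof.
apply/ffunP => I; have [->|ne] := eqVneq i j; rewrite !ffunE.
  by case: eqP.
by case: eqP => // ->; rewrite (negbTE ne).
Qed.
Fact form_part_sum F :
  exists2 s : seq int, uniq s & F = \sum_(k <- s) form_part k F.
Proof.
exists [seq n%:Z | n <- iota 0 4]; first by [].
apply/ffunP => I; rewrite sum_ffunE big_map.
have I4 : (#|I| < 4)%N by rewrite ltnS (leq_trans (max_card _)) ?card_ord.
rewrite (bigD1_seq #|I|) ?mem_iota ?iota_uniq //= ffunE eqxx.
rewrite big1 ?addr0 // => n ne; rewrite ffunE; case: eqP => // -[e].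
by rewrite e eqxx in ne.
Qed.

Definition CE_gspace : gspace K :=
  GSpace form_part_linear form_partI form_part_sum.
Definition GG : gspace K := gshift CE_gspace.

Definition inv_count (I J : {set 'I_3}) : nat :=
  #|[set p : 'I_3 * 'I_3 | [&& p.1 \in I, p.2 \in J & (p.2 < p.1)%N]]|.

Definition wedge (F G : CE) : CE :=
  [ffun L : {set 'I_3} => \sum_(I : {set 'I_3} | I \subset L)
     (-1) ^+ inv_count I (L :\: I) * (F I * G (L :\: I))].

(* Contraction of the last argument, i.e. the right antiderivation with
   contr i (eps j) = delta_ij. It is for this one that the formula defining
   the Schouten bracket gives a graded Lie bracket: with contraction of the
   first argument, [pi, [pi, e_k]] is not 0. *)
Definition contr (i : 'I_3) (F : CE) : CE :=
  [ffun J : {set 'I_3} => if i \in J then 0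
             else (-1) ^+ #|[set j in J | (i < j)%N]| * F (i |: J)].

Definition cderiv (i : 'I_3) (F : CE) : CE := [ffun I : {set 'I_3} => (F I)^`M(i)].

Definition smulf (f : Sg) (F : CE) : CE := [ffun I : {set 'I_3} => f * F I].

Definition CE_one : CE := [ffun I : {set 'I_3} => (I == set0)%:R].
Definition eps (i : 'I_3) : CE := [ffun I : {set 'I_3} => (I == [set i])%:R].

Definition schouten_hom (k l : int) (F G : CE) : CE :=
  \sum_i wedge (contr i F) (cderiv i G)
  - ((-1) ^ ((k - 1) * (l - 1)) : K) *: \sum_i wedge (contr i G) (cderiv i F).

Definition schouten (F G : GG) : GG :=
  \sum_(k < 4) \sum_(l < 4)
     schouten_hom k l (form_part k F) (form_part l G).

Definition pi_g : CE :=
  2^-1 *: \sum_i \sum_j \sum_k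
     so3_c i j k *: smulf 'X_i (wedge (eps j) (eps k)).

Definition delta_g (F : GG) : GG := schouten pi_g F.

Definition killing_mx : 'M[K]_3 := \matrix_(i, j) killing (e_ i) (e_ j).

Definition q_ : Sg := \sum_i \sum_j (invmx killing_mx i j) *: ('X_i * 'X_j).

Definition Cq (f : {poly K}) : Sg := horner_alg q_ f.

Definition Euler : CE := \sum_i smulf 'X_i (eps i).

(* The alternating form Omega(x, y, z) = killing x [y, z]; cf. pi_g for the
   normalisation 1/3! in terms of all triples of indices. *)
Definition Omega : CE :=
  6^-1 *: \sum_i \sum_j \sum_k
     killing (e_ i) (so3_br (e_ j) (e_ k)) *:
       wedge (eps i) (wedge (eps j) (eps k)).

Definition red_gen (F : GG) : Prop := exists f : {poly K},
  [\/ F = smulf (Cq f) CE_one, F = smulf (Cq f) Euler,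
      F = smulf (Cq f) pi_g | F = smulf (Cq f) Omega].

Definition GG_red : gspace K := gsub red_gen.

Definition delta_red (x : GG_red) : GG_red :=
  gsub_of red_gen (delta_g (gsub_val x)).
Definition schouten_red (x y : GG_red) : GG_red :=
  gsub_of red_gen (schouten (gsub_val x) (gsub_val y)).

Definition HH : gspace K := cohom delta_g.
Definition hcls (F : GG) : HH := cls delta_g F.

Definition natural_injection (i : HH -> GG_red) :=
  forall y : HH, exists f g : {poly K},
    let F := smulf (Cq f) CE_one + smulf (Cq g) Omega in
    gsub_val (i y) = F /\ hcls F = y.

End SO3.

(* Main.v *)
Require Import Defs.
From HB Require Import structures.
From mathcomp Require Import all_boot all_order all_algebra.
From mathcomp Require Import ring.
From mathcomp Require Import boolp reals complex.
From mathcomp Require Import finmap monalg.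
From mathcomp Require ssrcomplements mpoly.

(** A cochain is a tuple (f, V, W, t) of a polynomial f, two polynomial vector
    fields and a polynomial t.  With the angular momentum operators
    L = x × ∇ the differential maps f to L f, V to L × V - V and W to L · W.
    Every polynomial is the sum of an element of C[q] and of an image of L · L,
    whose kernel is C[q]; hence the cohomology is C[q] 1 + C[q] Ω.

    On the reduced complex the bracket is an explicit expression in the four
    coefficient polynomials.  Coderivations and coalgebra morphisms are
    determined by their Taylor coefficients, so all L-infinity identities reduce
    to polynomial identities for words of length at most four.  The square of
    the structure d_3 vanishes because e^{*φ} intertwines it with a square-zero
    coderivation and is injective on primitive elements.

    Non-formality: all higher brackets of the cohomology vanish.  For a
    quasi-isomorphism F take x_1, x_2 with F(x_1) = q and F(x_2) = Ω - δW.  The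
    vector field V = F(x_1, x_2) satisfies L × V - V = s x with
    s = - 2 - L · W by the identity of order two, and V · x = 0 by the one of
    order three on (x_1, x_1, x_2), where all other terms vanish by degree.
    Pairing the former with x puts - 2 (x · x) into the image of L ·, which
    meets C[q] in 0. *)

Set Implicit Arguments.
Unset Strict Implicit.
Unset Printing Implicit Defensive.

Import GRing.Theory.
Local Open Scope ring_scope.

(** * Words, shuffles and the symmetric coalgebra *)

(** The constants come from one computation. For f, g in C[q] the bracket of f 1 with g Ω is -2 f' g
    π, and c π is the coboundary of c E. This leads to 2 f' g E as phi_2 on this pair, and to -2 f'
    g E as φ_2 after the shift. Bracketing f_1 1 with 2 f_2' g E gives -4 q f_1' f_2' g; [w3]
    contains two such terms, which add up to the factor -8. The ground field enters only through
    [K0]: positive integers are invertible. This yields the divided powers in the exponential of a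
    Taylor coefficient, the fact that primitive elements of [Sym V] are vectors, and the
    invertibility of the eigenvalues l (l + 1) of the Casimir operator. The obstacle is signs. A
    homogeneous element carries its degree as a label, and 0 carries every degree. Identities with
    Koszul signs are therefore checked after a split by parity, which leaves polynomial identities
    without signs. *)

Section Signs.
Variable K : fieldType.
Local Notation sg n := ((-1) ^ (n) : K).

Lemma sgD m n : sg (m + n) = sg m * sg n.
Proof. by rewrite expfzDr // oppr_eq0 oner_eq0. Qed.

Lemma sg_sq n : sg n * sg n = 1.
Proof. by rewrite -expfzMl mulrNN mulr1 exp1rz. Qed.

(** The later case splits know only the signs [sg m] and [sg n], not the degrees; this form
    evaluates a Koszul sign from them. *)
Lemma sgM2 m n : sg (m * n) = if sg m == 1 then 1 else sg n.
Proof.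
rewrite -exprz_exp.
have [-> | m1] := eqVneq (sg m) 1; first by rewrite exp1rz.
suff -> : sg m = -1 by [].
by have /eqP := sg_sq m; rewrite -expr2 sqrf_eq1 (negbTE m1) /= => /eqP->.
Qed.
End Signs.

Section LinearPredicatesMore.
Variables (K : fieldType) (A B C D : lmodType K).

Lemma linear_zero : linear (fun _ : A => 0 : B).
Proof. by move=> a x y; rewrite scaler0 addr0. Qed.

Lemma linearBf (f : A -> B) : linear f -> {morph f : x y / x - y}.
Proof.
by move=> fl x y; rewrite (linearDf fl) -[- y]scaleN1r (linearZf _ _ fl) scaleN1r.
Qed.

Lemma linear_sum1 (f : A -> B) (I : Type) (r : seq I) (x : I -> A) : linear f ->
  f (\sum_(i <- r) x i) = \sum_(i <- r) f (x i).
Proof.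
move=> fl; elim: r => [|i r IH]; first by rewrite !big_nil (linear0f fl).
by rewrite !big_cons (linearDf fl) IH.
Qed.

Lemma linear_bigf (I : Type) (r : seq I) (f : I -> A -> B) :
  (forall i, linear (f i)) -> linear (fun a => \sum_(i <- r) f i a).
Proof.
move=> fl a x y; rewrite scaler_sumr -big_split; apply: eq_bigr => i _.
exact: fl.
Qed.

Lemma bilinear_tensor (F : A -> C) (G : B -> D) :
  linear F -> linear G -> bilinear_map (fun x y => tensor (F x) (G y)).
Proof.
move=> Fl Gl; split=> [b|a].
  by apply: (linear_compf (f := fun z => tensor z (G b))) => //; exact: tensorPl.
by apply: linear_compf => //; exact: tensorPr.
Qed.

Lemma bilinearD (f g : A -> B -> C) :
  bilinear_map f -> bilinear_map g -> bilinear_map (fun x y => f x y + g x y).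
Proof. by move=> [fl fr] [gl gr]; split=> ?; apply: linear_addf. Qed.

Lemma bilinear_comp2 (f : C -> D -> B) (F : A -> C) (E : lmodType K) (G : E -> D) :
  bilinear_map f -> linear F -> linear G ->
  bilinear_map (fun x y => f (F x) (G y)).
Proof.
move=> [fl fr] Fl Gl; split=> [b|a].
  exact: (linear_compf (f := fun z => f z (G b))).
exact: linear_compf.
Qed.
End LinearPredicatesMore.

Lemma tensor0l (K : fieldType) (A B : lmodType K) (b : B) : tensor (0 : A) b = 0.
Proof. by apply: (linear0f (f := fun a : A => tensor a b)); exact: tensorPl. Qed.

Lemma tensor0r (K : fieldType) (A B : lmodType K) (a : A) : tensor a (0 : B) = 0.
Proof. by apply: (linear0f (f := fun b : B => tensor a b)); exact: tensorPr. Qed.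

(** Sweedler notation for the shuffle comultiplication. [T] is any function of two subwords, so
    expressions can be summed before they are known to factor through [Sym V]. *)
HB.lock Definition shsum (K : fieldType) (V : gspace K) (W : lmodType K)
    (w : seq (homog V)) (T : seq (homog V) -> seq (homog V) -> W) : W :=
  \sum_(c <- unshuffles w) ((-1) ^ c.1.1 : K) *: T c.1.2 c.2.

Section Shuffles.
Variables (K : fieldType) (V : gspace K).
Implicit Types (x : homog V) (u v w : seq (homog V)) (W : lmodType K).
Local Notation sg n := ((-1) ^ (n) : K).

Lemma shsum_nil W T : @shsum K V W [::] T = T [::] [::].
Proof. by rewrite shsum.unlock big_seq1 /= expr0z scale1r. Qed.

Lemma shsum_cons W x w T : @shsum K V W (x :: w) T =
  shsum w (fun u v => T (x :: u) v)
  + shsum w (fun u v => sg (hdeg x * wdeg u) *: T u (x :: v)).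
Proof.
rewrite shsum.unlock /= big_cat !big_map /=; congr (_ + _).
by apply: eq_bigr => c _; rewrite scalerA sgD.
Qed.

Lemma shsum1 W x T : @shsum K V W [:: x] T = T [:: x] [::] + T [::] [:: x].
Proof. by rewrite shsum_cons !shsum_nil wdeg_nil mulr0 expr0z scale1r. Qed.

Lemma shsum2 W x y T : @shsum K V W [:: x; y] T =
  T [:: x; y] [::] + T [:: x] [:: y]
  + sg (hdeg x * hdeg y) *: T [:: y] [:: x] + T [::] [:: x; y].
Proof.
rewrite shsum_cons !shsum1 /= wdeg_cons wdeg_nil mulr0 expr0z scale1r addr0.
by rewrite addrA.
Qed.

Lemma shsum3 W x y z T : @shsum K V W [:: x; y; z] T =
  T [:: x; y; z] [::] + T [:: x; y] [:: z]
  + sg (hdeg y * hdeg z) *: T [:: x; z] [:: y]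
  + T [:: x] [:: y; z] + sg (hdeg x * (hdeg y + hdeg z)) *: T [:: y; z] [:: x]
  + sg (hdeg x * hdeg y) *: T [:: y] [:: x; z]
  + sg (hdeg y * hdeg z) *: (sg (hdeg x * hdeg z) *: T [:: z] [:: x; y])
  + T [::] [:: x; y; z].
Proof.
rewrite shsum_cons !shsum2 /= !wdeg_cons wdeg_nil mulr0 expr0z scale1r !addr0.
by rewrite !addrA.
Qed.

(** The congruence hands back two invariants of an unshuffle, total degree and total length; many
    sign and vanishing arguments below rest on them. *)
Lemma eq_shsum W w T T' :
  (forall u v, wdeg u + wdeg v = wdeg w -> (size u + size v = size w)%N ->
     T u v = T' u v) ->
  @shsum K V W w T = shsum w T'.
Proof.
elim: w T T' => [|x w IH] T T' TT; first by rewrite !shsum_nil TT // wdeg_nil addr0.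
rewrite !shsum_cons; congr (_ + _); apply: IH => u v e s.
  by apply: TT; rewrite /= ?addSn ?s // !wdeg_cons -addrA e.
rewrite TT //=; last by rewrite addnS s.
by rewrite !wdeg_cons addrCA e.
Qed.

Lemma shsumD W w T T' :
  @shsum K V W w (fun u v => T u v + T' u v) = shsum w T + shsum w T'.
Proof. by rewrite shsum.unlock -big_split; apply: eq_bigr => c _; rewrite scalerDr. Qed.

Lemma shsum0 W w : @shsum K V W w (fun _ _ => 0) = 0.
Proof. by rewrite shsum.unlock big1 // => c _; rewrite scaler0. Qed.

Lemma shsum_sum W w I (r : seq I) (T : I -> seq (homog V) -> seq (homog V) -> W) :
  shsum w (fun u v => \sum_(i <- r) T i u v) = \sum_(i <- r) shsum w (T i).
Proof.
rewrite shsum.unlock exchange_big; apply: eq_bigr => c _.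
by rewrite scaler_sumr.
Qed.

Lemma linear_shsum W W' (f : W -> W') w T :
  linear f -> f (shsum w T) = shsum w (fun u v => f (T u v)).
Proof. by move=> fl; rewrite shsum.unlock linear_sumf. Qed.

Lemma shsumZ W c w T : @shsum K V W w (fun u v => c *: T u v) = c *: shsum w T.
Proof.
by rewrite (linear_shsum (f := fun z => c *: z)) //; apply: linear_scalef.
Qed.

Lemma telim_comul W (f : Sym V -> Sym V -> W) w : bilinear_map f ->
  telim f (comul (sprod w)) = shsum w (fun u v => f (sprod u) (sprod v)).
Proof.
move=> fb; rewrite shsum.unlock comulE /comul_word linear_sumf; last exact: telim_linear.
by apply: eq_bigr => c _; rewrite telimE.
Qed.

Lemma comul_shsum w :
  comul (sprod w) = shsum w (fun u v => tensor (sprod u) (sprod v)).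
Proof. by rewrite shsum.unlock comulE. Qed.

(** Coassociativity. No extra sign appears, because the three subwords stand in the same order on
    both sides. *)
Lemma shsum_assoc W w (T : seq (homog V) -> seq (homog V) -> seq (homog V) -> W) :
  shsum w (fun u v => shsum v (fun v1 v2 => T u v1 v2))
    = shsum w (fun u v => shsum u (fun u1 u2 => T u1 u2 v)).
Proof.
elim: w T => [|x w IH] T; first by rewrite !shsum_nil.
rewrite !shsum_cons.
under [in RHS]eq_shsum => u v _ _ do rewrite shsum_cons.
under [in X in _ + X = _]eq_shsum => u v _ _ do rewrite shsum_cons scalerDr.
rewrite !shsumD addrA; congr (_ + _ + _).
- exact: IH.
- under eq_shsum => u v _ _ do rewrite -shsumZ.
  exact: IH (fun u v1 v2 => _ *: T u (x :: v1) v2).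
- under eq_shsum => u v _ _ do rewrite -shsumZ.
  rewrite (IH (fun u v1 v2 => _ *: (_ *: T u v1 (x :: v2)))).
  apply: eq_shsum => u v _ _; rewrite -shsumZ; apply: eq_shsum => u1 u2 e _.
  by rewrite scalerA -sgD -mulrDr e.
Qed.

Lemma shsum_comm W w T :
  @shsum K V W w T = shsum w (fun u v => sg (wdeg u * wdeg v) *: T v u).
Proof.
elim: w T => [|x w IH] T.
  by rewrite !shsum_nil !wdeg_nil mulr0 expr0z scale1r.
rewrite !shsum_cons addrC [X in X + _ = _]IH [X in _ + X = _]IH.
congr (_ + _); apply: eq_shsum => u v _ _.
  rewrite scalerA wdeg_cons -sgD; congr (_ *: _).
  by rewrite mulrDl [hdeg x * _]mulrC addrC [wdeg v * _]mulrC.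
by rewrite wdeg_cons scalerA mulrDr sgD [wdeg u * hdeg x]mulrC mulrA sg_sq mul1r.
Qed.

Lemma shsum_nilr W w (T : seq (homog V) -> W) :
  shsum w (fun u v => if v is [::] then T u else 0) = T w.
Proof.
elim: w T => [|x w IH] T; first by rewrite shsum_nil.
rewrite shsum_cons (IH (fun u => T (x :: u))).
under eq_shsum => u v _ _ do rewrite scaler0.
by rewrite shsum0 addr0.
Qed.

Lemma shsum_nill W w (T : seq (homog V) -> W) :
  shsum w (fun u v => if u is [::] then T v else 0) = T w.
Proof.
elim: w T => [|x w IH] T; first by rewrite shsum_nil.
rewrite shsum_cons shsum0 add0r -(IH (fun v => T (x :: v))).
apply: eq_shsum => -[|y u] v _ _; last by rewrite scaler0.
by rewrite wdeg_nil mulr0 expr0z scale1r.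
Qed.

(** Isolates the primitive part of a comultiplication once the proper splittings are known to
    vanish. *)
Lemma shsum_ends W w T : w != [::] ->
  (forall u v, u != [::] -> v != [::] -> (size u + size v = size w)%N ->
     T u v = 0) ->
  @shsum K V W w T = T w [::] + T [::] w.
Proof.
move=> w0 TT; rewrite -(shsum_nilr w (fun u => T u [::])).
rewrite -(shsum_nill w (T [::])) -shsumD; apply: eq_shsum => u v _.
case: u v => [|x u] [|y v] s; rewrite ?add0r ?addr0 //; last exact: TT.
by move: w0; rewrite -size_eq0 -s.
Qed.

End Shuffles.

Section Words.
Variables (K : fieldType) (V : gspace K).
Implicit Types (x y : homog V) (u v w : seq (homog V)) (a b : Sym V).
Local Notation sg n := ((-1) ^ (n) : K).

Lemma sprod_zero u v x : hval x = 0 -> sprod (u ++ x :: v) = 0.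
Proof.
move=> x0; have := @sprod_lin _ _ u v 1 x x x erefl erefl.
rewrite x0 scaler0 addr0 scale1r => /(_ erefl) /eqP.
by rewrite -subr_eq0 opprD addrA subrr sub0r oppr_eq0 => /eqP.
Qed.

Lemma sym_ext (W : lmodType K) (f g : Sym V -> W) : linear f -> linear g ->
  (forall w, f (sprod w) = g (sprod w)) -> f =1 g.
Proof. exact: pres_ext. Qed.

Lemma smul_lin c x y z a :
  hdeg x = hdeg z -> hdeg y = hdeg z -> hval z = c *: hval x + hval y ->
  smul z a = c *: smul x a + smul y a.
Proof.
move=> xz yz e; apply: (sym_ext (f := smul z) (g := fun a => _ *: smul x a + smul y a)).
- exact: smul_linear.
- by apply: linear_addf; [apply: linear_scalef|]; exact: smul_linear.
by move=> w; rewrite !smulE (sprod_lin [::] w xz yz e).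
Qed.

Lemma smul_zero x a : hval x = 0 -> smul x a = 0.
Proof.
move=> x0; apply: (sym_ext (f := smul x) (g := fun=> 0)).
- exact: smul_linear.
- exact: linear_zero.
by move=> w; rewrite smulE (@sprod_zero [::]).
Qed.

Lemma homogP (x : homog V) : gpr (hdeg x) (hval x) = hval x.
Proof. exact: (eqP (svalP x)). Qed.

Fact hcomp_subproof i (v : V) : gpr i (gpr i v) == gpr i v.
Proof. by rewrite gprI eqxx. Qed.

Definition hcomp i (v : V) : homog V :=
  exist (fun p : int * V => gpr p.1 p.2 == p.2) (i, gpr i v) (hcomp_subproof i v).

Lemma hcompK x : hcomp (hdeg x) (hval x) = x.
Proof. by case: x => [[i v] p]; apply: val_inj; rewrite /= (eqP p). Qed.

Definition gsupp (v : V) : seq int := s2val (cid2 (gpr_sum v)).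

Lemma gpr_notin (v : V) i : i \notin gsupp v -> gpr i v = 0.
Proof.
rewrite /gsupp; case: (cid2 _) => s /= us vs si.
rewrite vs linear_sum big1_seq // => j /= js; rewrite gprI.
by case: eqP => // ij; rewrite ij js in si.
Qed.

(** Product of an arbitrary vector with an element of [Sym V]. Letters are homogeneous, so [v] is
    split into components along [gsupp v], a list obtained by choice; [lsm_on] shows that every list
    carrying all components gives the same value. *)
Definition lsm (v : V) a : Sym V := \sum_(i <- gsupp v) smul (hcomp i v) a.

Lemma lsm_on t (v : V) a : uniq t -> (forall i, i \notin t -> gpr i v = 0) ->
  lsm v a = \sum_(i <- t) smul (hcomp i v) a.
Proof.
(* Both lists are enlarged to their union; the added components of [v] are 0. *)
have main s t' : uniq s -> (forall i, i \notin s -> gpr i v = 0) ->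
    \sum_(i <- s) smul (hcomp i v) a
      = \sum_(i <- undup (s ++ t')) smul (hcomp i v) a.
  move=> us vs; rewrite [RHS](bigID (mem s)) /= [X in _ + X]big1 ?addr0.
    rewrite -[RHS]big_filter; apply: perm_big; apply: uniq_perm => //.
      by rewrite filter_uniq ?undup_uniq.
    by move=> i; rewrite mem_filter mem_undup mem_cat; case: (i \in s).
  by move=> i si; rewrite smul_zero // /hval /= vs.
move=> ut vt; have us : uniq (gsupp v) by rewrite /gsupp; case: (cid2 _).
rewrite /lsm (main (gsupp v) t us (@gpr_notin v)) (main t (gsupp v) ut vt).
apply: perm_big; apply: uniq_perm; rewrite ?undup_uniq // => i.
by rewrite !mem_undup !mem_cat orbC.
Qed.

Lemma lsm_bilinear : bilinear_map lsm.
Proof.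
split=> [a c v v'|v]; last by apply: linear_bigf => i; exact: smul_linear.
pose t := undup (gsupp v ++ gsupp v').
have tv i : i \notin t -> gpr i v = 0 /\ gpr i v' = 0.
  by rewrite mem_undup mem_cat negb_or => /andP[/gpr_notin-> /gpr_notin->].
rewrite !(@lsm_on t) ?undup_uniq //; try by move=> i /tv[].
  rewrite scaler_sumr -big_split; apply: eq_bigr => i _.
  by apply: smul_lin => //; rewrite /hval /= linearP.
by move=> i /tv[v0 v'0]; rewrite linearP /= v0 v'0 scaler0 addr0.
Qed.

Lemma lsm_linear (v : V) : linear (lsm v). Proof. by case: lsm_bilinear. Qed.
Lemma lsm_linearl a : linear (lsm^~ a). Proof. by case: lsm_bilinear. Qed.

Lemma lsm_hval x a : lsm (hval x) a = smul x a.
Proof.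
rewrite (@lsm_on [:: hdeg x]) ?big_seq1 ?hcompK // => i.
by rewrite inE -homogP gprI => /negbTE->.
Qed.

Lemma lsm0 a : lsm 0 a = 0. Proof. exact: (linear0f (lsm_linearl a)). Qed.

Lemma comul_smul x a : comul (smul x a) = lmul x (comul a).
Proof.
apply: (sym_ext (f := fun a => comul (smul x a)) (g := fun a => lmul x (comul a))).
- by apply: linear_compf; [exact: comul_linear|exact: smul_linear].
- by apply: linear_compf; [exact: lmul_linear|exact: comul_linear].
by move=> w; rewrite smulE !comulE comul_word_cons.
Qed.

Lemma counit_smul x a : counit (smul x a) = 0.
Proof.
apply: (sym_ext (f := fun a => counit (smul x a)) (g := fun=> 0)).
- by apply: linear_compf; [exact: counit_linear|exact: smul_linear].
- exact: linear_zero.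
by move=> w; rewrite smulE counitE.
Qed.

Lemma spr_smul x a : spr (smul x a) = (counit a : K) *: hval x.
Proof.
apply: (sym_ext (f := fun a => spr (smul x a)) (g := fun a => (counit a : K) *: hval x)).
- by apply: linear_compf; [exact: spr_linear|exact: smul_linear].
- by move=> c a' b'; rewrite counit_linear scalerDl scalerA.
by case=> [|y w]; rewrite smulE sprE counitE ?scale1r ?scale0r.
Qed.

Lemma sym_deg0 n : sym_deg n (0 : Sym V). Proof. exact: span0. Qed.
Lemma sym_degD n a b : sym_deg n a -> sym_deg n b -> sym_deg n (a + b).
Proof. exact: spanD. Qed.
Lemma sym_degZ n c a : sym_deg n a -> sym_deg n (c *: a).
Proof. exact: spanZ. Qed.
Lemma sym_deg_sprod w : sym_deg (wdeg w) (sprod w).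
Proof. by apply: span_gen; exists w. Qed.
Lemma sym_deg_sum n I (r : seq I) (F : I -> Sym V) :
  (forall i, sym_deg n (F i)) -> sym_deg n (\sum_(i <- r) F i).
Proof.
move=> Fn; elim/big_rec: _ => [|i a _ an]; first exact: sym_deg0.
exact: sym_degD.
Qed.
Lemma sym_deg_smul n x a : sym_deg n a -> sym_deg (hdeg x + n) (smul x a).
Proof.
elim=> [|c _ y [w <- ->] _ IH].
  by rewrite (linear0f (smul_linear x)); exact: sym_deg0.
rewrite smul_linear; apply: sym_degD => //; apply: sym_degZ.
by rewrite smulE -wdeg_cons; exact: sym_deg_sprod.
Qed.

Lemma sgn_op_deg n m a : sym_deg m a -> sgn_op n a = sg (n * m) *: a.
Proof.
elim=> [|c _ y [w <- ->] _ IH].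
  by rewrite (linear0f (sgn_op_linear n)) scaler0.
by rewrite sgn_op_linear sgn_opE IH scalerDr !scalerA mulrC.
Qed.

Lemma spr_deg n a : sym_deg n a -> gpr n (spr a) = spr a.
Proof.
elim=> [|c _ y [w <- ->] _ IH].
  by rewrite (linear0f (@spr_linear K V)) linear0.
rewrite spr_linear linearP /= IH sprE; congr (_ *: _ + _).
move: w {IH} => [|x [|? ?]]; rewrite ?linear0 // wdeg_cons wdeg_nil addr0.
exact: homogP.
Qed.

End Words.

(** * Coderivations and coalgebra morphisms from Taylor coefficients *)

Section Convolution.
Variables (K : fieldType) (U V : gspace K).
Implicit Types (u v w : seq (homog U)) (a : Sym U).
Local Notation sg n := ((-1) ^ (n) : K).

Variables (n : int) (phi : Sym U -> V).
Hypothesis phi_linear : linear phi.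
Hypothesis phi_deg : forall w, gpr (wdeg w + n) (phi (sprod w)) = phi (sprod w).

(** Convolution product of [phi], whose values are vectors, with [G]. Both extensions from Taylor
    coefficients are built from it: the coderivation of d is the product of d with the identity, and
    the morphism of φ is the convolution exponential of φ. *)
Definition conv (G : Sym U -> Sym V) a : Sym V :=
  telim (fun x y => lsm (phi x) (G y)) (comul a).

Lemma conv_bilinear (G : Sym U -> Sym V) : linear G ->
  @bilinear_map K (Sym U) (Sym U) (Sym V) (fun x y => lsm (phi x) (G y)).
Proof. by move=> Gl; apply: (bilinear_comp2 (f := @lsm K V)) => //; exact: lsm_bilinear. Qed.

Lemma conv_linear G : linear G -> linear (conv G).
Proof.
move=> Gl; apply: linear_compf; last exact: comul_linear.
exact: telim_linear (conv_bilinear Gl).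
Qed.

Definition phiw w : homog V := hcomp (wdeg w + n) (phi (sprod w)).

Lemma hval_phiw w : hval (phiw w) = phi (sprod w).
Proof. exact: phi_deg. Qed.

Lemma conv_sprod G w : linear G ->
  conv G (sprod w) = shsum w (fun u v => smul (phiw u) (G (sprod v))).
Proof.
move=> Gl; rewrite /conv telim_comul; last exact: conv_bilinear.
by apply: eq_shsum => u v _ _; rewrite -hval_phiw lsm_hval.
Qed.

Lemma conv_deg G m w : linear G ->
  (forall v, sym_deg (wdeg v + m) (G (sprod v))) ->
  sym_deg (wdeg w + n + m) (conv G (sprod w)).
Proof.
move=> Gl Gd; rewrite conv_sprod //.
(* The test holds for every unshuffle. It keeps the degree information after [shsum] is opened as a
   plain sum over triples, which do not carry it. *)
have -> : shsum w (fun u v => smul (phiw u) (G (sprod v)))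
  = shsum w (fun u v => if wdeg u + wdeg v == wdeg w
                        then smul (phiw u) (G (sprod v)) else 0).
  by apply: eq_shsum => u v -> _; rewrite eqxx.
rewrite shsum.unlock; apply: sym_deg_sum => c; apply: sym_degZ.
case: eqP => [<-|_]; last exact: sym_deg0.
have := sym_deg_smul (phiw c.1.2) (Gd c.2).
by congr (sym_deg _ _); rewrite /hdeg /= addrA; congr (_ + _); rewrite addrAC.
Qed.

(** The new factor [phiw u] joins the left or the right tensor factor. On the left, coassociativity
    regroups it. On the right it must first pass [A v1]; this is a cocommutativity exchange, whose
    sign cancels all but n times the degree of the word passed. *)
Lemma shsum_leibniz (W : lmodType K) (T : Sym V -> Sym V -> W)
    (A B : seq (homog U) -> Sym V) w : bilinear_map T ->
  shsum w (fun u v => shsum v (fun v1 v2 =>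
     T (smul (phiw u) (A v1)) (B v2)
     + sg ((wdeg u + n) * wdeg v1) *: T (A v1) (smul (phiw u) (B v2)))) =
  shsum w (fun u v => T (shsum u (fun u1 u2 => smul (phiw u1) (A u2))) (B v))
  + shsum w (fun u v => sg (n * wdeg u) *:
      T (A u) (shsum v (fun v1 v2 => smul (phiw v1) (B v2)))).
Proof.
move=> [Tl Tr].
under eq_shsum => u v _ _ do rewrite shsumD.
rewrite shsumD; congr (_ + _).
  rewrite (shsum_assoc w (fun u v1 v2 => T (smul (phiw u) (A v1)) (B v2))).
  apply: eq_shsum => u v _ _.
  by rewrite (linear_shsum (f := fun z => T z (B v))).
rewrite (shsum_assoc w (fun u v1 v2 => _ *: T (A v1) (smul (phiw u) (B v2)))).
under eq_shsum => u v _ _ do rewrite shsum_comm.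
rewrite -(shsum_assoc w (fun u v1 v2 => _ *: (_ *: T (A u) (smul (phiw v1) (B v2))))).
apply: eq_shsum => u v _ _; rewrite (linear_shsum (f := T (A u))) //.
rewrite -shsumZ; apply: eq_shsum => v1 v2 _ _; rewrite scalerA; congr (_ *: _).
by rewrite mulrDl sgD mulrA [wdeg v1 * _]mulrC sg_sq mul1r.
Qed.

Lemma shsum_lmul (A B : seq (homog U) -> Sym V) w :
  (forall v, sym_deg (wdeg v) (A v)) ->
  shsum w (fun u v => shsum v (fun v1 v2 =>
             lmul (phiw u) (tensor (A v1) (B v2)))) =
  shsum w (fun u v => tensor (shsum u (fun u1 u2 => smul (phiw u1) (A u2))) (B v))
  + shsum w (fun u v => sg (n * wdeg u) *:
      tensor (A u) (shsum v (fun v1 v2 => smul (phiw v1) (B v2)))).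
Proof.
move=> Ad; apply: etrans; last first.
  by apply: shsum_leibniz; apply: bilinear_tensor.
apply: eq_shsum => u v _ _; apply: eq_shsum => v1 v2 _ _.
by rewrite lmulE (sgn_op_deg _ (Ad v1)) tensorZl.
Qed.

End Convolution.

Section Coderivations.
Variables (K : fieldType) (V : gspace K).
Implicit Types (u v w : seq (homog V)).
Local Notation sg n := ((-1) ^ (n) : K).

Variables (n : int) (d : Sym V -> V).
Hypothesis d_linear : linear d.
Hypothesis d_deg : forall w, gpr (wdeg w + n) (d (sprod w)) = d (sprod w).

Definition coder : Sym V -> Sym V := conv d id.

Lemma id_linear : linear (@id (Sym V)). Proof. by []. Qed.

Lemma coder_linear : linear coder.
Proof. exact: (conv_linear d_linear (G := id) id_linear). Qed.

Lemma coder_sprod w :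
  coder (sprod w) = shsum w (fun u v => smul (phiw n d u) (sprod v)).
Proof. exact: (conv_sprod d_linear d_deg w (G := id) id_linear). Qed.

Lemma coderivation_words D : linear D ->
  (forall w, comul (D (sprod w))
     = shsum w (fun u v => tensor (D (sprod u)) (sprod v)
                 + sg (n * wdeg u) *: tensor (sprod u) (D (sprod v)))) ->
  forall a, comul (D a)
     = telim (fun x y => tensor (D x) y + tensor (sgn_op n x) (D y)) (comul a).
Proof.
move=> Dl Dw.
have bil : bilinear_map (fun x y => tensor (D x) y + tensor (sgn_op n x) (D y)).
  apply: bilinearD; apply: bilinear_tensor => //.
  exact: sgn_op_linear.
apply: sym_ext.
- by apply: linear_compf => //; exact: comul_linear.
- by apply: linear_compf; [exact: telim_linear bil|exact: comul_linear].
move=> w; rewrite Dw; apply: etrans; last by symmetry; exact: (telim_comul w bil).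
apply: eq_shsum => u v _ _; congr (_ + _).
by rewrite sgn_opE tensorZl.
Qed.

Lemma coder_coderivation : coderivation n coder.
Proof.
split=> [w|].
  rewrite -[wdeg w + n]addr0; apply: conv_deg => // v.
  by rewrite addr0; exact: sym_deg_sprod.
apply: coderivation_words => [|w]; first exact: coder_linear.
rewrite coder_sprod (linear_shsum _ _ (@comul_linear K V)).
under eq_shsum => u v _ _ do rewrite comul_smul comul_shsum
  (linear_shsum _ _ (@lmul_linear _ _ _)).
apply: etrans; first by apply: (shsum_lmul n d); exact: sym_deg_sprod.
apply: etrans; first by symmetry; exact: shsumD.
by apply: eq_shsum => u v _ _; rewrite !coder_sprod.
Qed.

Lemma taylor_coder w : taylor coder w = d (sprod w).
Proof.
rewrite /taylor coder_sprod (linear_shsum _ _ (@spr_linear K V)).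
rewrite -[RHS](shsum_nilr w (fun u => d (sprod u))).
apply: eq_shsum => u v _ _; rewrite spr_smul counitE hval_phiw //.
by case: v => [|? ?]; rewrite ?scale1r ?scale0r.
Qed.
End Coderivations.

(** * Primitive elements of the symmetric coalgebra *)

Section Primitive.
Variables (K : fieldType) (V : gspace K).
Implicit Types (x y : homog V) (u v w : seq (homog V)) (a b : Sym V).
Local Notation sg n := ((-1) ^ (n) : K).

Lemma tpart_compat n : @sym_compat K V (Sym V)
  (fun w => if size w == n then sprod w else 0).
Proof.
split=> [s t c x y z xz yz e|s t x y]; rewrite !size_cat /=.
  by case: eqP => _; [exact: sprod_lin|rewrite scaler0 addr0].
by case: eqP => _; [exact: sprod_comm|rewrite scaler0].
Qed.

Definition tpart n : Sym V -> Sym V :=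
  pelim (fun w => if size w == n then sprod w else 0).

Lemma tpart_sprod n w : tpart n (sprod w) = if size w == n then sprod w else 0.
Proof. exact: sym_elimE (tpart_compat n) _. Qed.
Lemma tpart_linear n : linear (tpart n).
Proof. exact: sym_elim_linear (tpart_compat n). Qed.

(** A representative of [a] is a finite combination of words of length less than [N], so [a] is the
    sum of its first [N] parts. *)
Lemma tpart_eq0 a : (forall n, tpart n a = 0) -> a = 0.
Proof.
move=> a0; pose S := msupp (qrepr a); pose N := \max_(t <- S) (size t).+1.
have lin : linear (fun a => \sum_(n < N) tpart n a).
  by apply: linear_bigf => n; exact: tpart_linear.
suff e : \sum_(n < N) tpart n a = a by rewrite -e big1.
have aE := pres_sum a; rewrite -/S in aE; rewrite [in LHS]aE [RHS]aE.
rewrite (linear_sumf _ _ _ lin) big_seq [RHS]big_seq.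
apply: eq_bigr => t tS; congr (_ *: _).
have tN : (size t < N)%N by rewrite /N (big_rem t) //= leq_maxl.
rewrite (bigD1 (Ordinal tN)) //= big1; first by rewrite addr0 (tpart_sprod _ t) eqxx.
by move=> i it; rewrite (tpart_sprod _ t) eq_sym -[_ == _]/(i == Ordinal tN) (negbTE it).
Qed.

Lemma smul_comm x y a :
  smul x (smul y a) = sg (hdeg x * hdeg y) *: smul y (smul x a).
Proof.
apply: (sym_ext (f := fun a => smul x (smul y a))
  (g := fun a => sg (hdeg x * hdeg y) *: smul y (smul x a))).
- by apply: linear_compf; exact: smul_linear.
- by apply: linear_scalef; apply: linear_compf; exact: smul_linear.
by move=> w; rewrite !smulE (sprod_comm [::]).
Qed.

Definition mulw u b : Sym V := foldr (fun x => smul x) b u.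

Lemma mulw_linear u : linear (mulw u).
Proof.
elim: u => [|x u IH] //=; apply: (linear_compf (f := smul x)) => //.
exact: smul_linear.
Qed.

Lemma mulw_sprod u v : mulw u (sprod v) = sprod (u ++ v).
Proof. by elim: u => //= x u ->; rewrite smulE. Qed.

Lemma mulw_compat b : sym_compat (mulw ^~ b).
Proof.
have cat s t : mulw (s ++ t) b = mulw s (mulw t b) by rewrite /mulw foldr_cat.
split=> [s t c x y z xz yz e|s t x y]; rewrite !cat /=.
  by rewrite (smul_lin _ xz yz e) mulw_linear.
by rewrite smul_comm (linearZf _ _ (mulw_linear s)).
Qed.

Definition mul a b : Sym V := pelim (mulw ^~ b) a.

Lemma mul_sprod u b : mul (sprod u) b = mulw u b.
Proof. exact: sym_elimE (mulw_compat b) _. Qed.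

Lemma mul_bilinear : bilinear_map mul.
Proof.
split=> [b|a]; first exact: sym_elim_linear (mulw_compat b).
have pl b := sym_elim_linear (mulw_compat b).
move=> c b b'; apply: (sym_ext (f := fun a => mul a (c *: b + b'))
  (g := fun a => c *: mul a b + mul a b')) => [||u].
- exact: pl.
- by apply: linear_addf; [apply: linear_scalef|]; exact: pl.
by rewrite !mul_sprod mulw_linear.
Qed.

Definition mul2 : tens (Sym V) (Sym V) -> Sym V := telim mul.

Lemma mul2_linear : linear mul2. Proof. exact: telim_linear mul_bilinear. Qed.

Lemma mulw_smul x u b : mulw u (smul x b) = sg (hdeg x * wdeg u) *: smul x (mulw u b).
Proof.
elim: u => [|y u IH] /=; first by rewrite wdeg_nil mulr0 expr0z scale1r.
rewrite IH (linearZf _ _ (smul_linear y)) smul_comm scalerA -sgD; congr (_ ^ _ *: _).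
by rewrite wdeg_cons mulrDr addrC mulrC.
Qed.

(** The letter x is primitive, so comultiplying and then multiplying counts it twice. This is the
    source of the factor 2^n on words of length n. *)
Lemma mul2_lmul x X : mul2 (lmul x X) = 2 *: smul x (mul2 X).
Proof.
apply: (tens_sym_ext (f := fun X => mul2 (lmul x X))
  (g := fun X => 2 *: smul x (mul2 X))) => [||u v].
- by apply: linear_compf; [exact: mul2_linear|exact: lmul_linear].
- apply: linear_scalef.
  by apply: linear_compf; [exact: smul_linear|exact: mul2_linear].
rewrite lmul_sprod (linearDf mul2_linear) (linearZf _ _ mul2_linear).
rewrite /mul2 !(telimE mul_bilinear) !mul_sprod -[sprod (x :: v)]smulE.
by rewrite mulw_smul scalerA sg_sq scale1r scaler_nat mulr2n.
Qed.

Lemma mul2_comul w : mul2 (comul (sprod w)) = 2 ^+ size w *: sprod w.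
Proof.
elim: w => [|x w IH].
  rewrite comul_shsum shsum_nil /mul2 (telimE mul_bilinear) mul_sprod.
  by rewrite scale1r.
rewrite -[in LHS]smulE comul_smul mul2_lmul IH (linearZf _ _ (smul_linear x)).
by rewrite smulE scalerA exprS.
Qed.

Lemma tpart1 a : tpart 1 a = lsm (spr a) (sprod [::]).
Proof.
move: a; apply: sym_ext => [||u].
- exact: tpart_linear.
- by apply: (linear_compf (f := fun v : V => lsm v (sprod [::]))); [exact: lsm_linearl|exact: spr_linear].
rewrite tpart_sprod sprE; case: u => [|x [|? ?]] //=; rewrite ?lsm0 //.
by rewrite lsm_hval smulE.
Qed.

Lemma tpart_tpart m n a : tpart m (tpart n a) = if m == n then tpart n a else 0.
Proof.
move: a; apply: sym_ext => [||u].
- by apply: linear_compf; exact: tpart_linear.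
- by case: eqP => _; [exact: tpart_linear|exact: linear_zero].
rewrite !tpart_sprod; case: eqP => [e|_]; last first.
  by rewrite (linear0f (@tpart_linear _)) if_same.
by rewrite tpart_sprod e eq_sym.
Qed.

Lemma spr_lsm (v : V) : spr (lsm v (sprod [::])) = v.
Proof.
rewrite (linear_sum1 _ _ (@spr_linear K V)).
transitivity (\sum_(i <- gsupp v) gpr i v); last by rewrite /gsupp; case: (cid2 _).
by apply: eq_bigr => i _; rewrite smulE sprE.
Qed.

Hypothesis K0 : forall n, n.+1%:R != 0 :> K.

(* The composite of comultiplication and multiplication is 2^n on S^n but 2 on
   a primitive element, which therefore lies in S^1. *)
Lemma primitive_lsm a :
  comul a = tensor a (sprod [::]) + tensor (sprod [::]) a -> a = lsm (spr a) (sprod [::]).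
Proof.
move=> prim; have mula : mul2 (comul a) = 2 *: a.
  rewrite prim (linearDf mul2_linear) /mul2 !(telimE mul_bilinear) mul_sprod.
  rewrite scaler_nat mulr2n; congr (_ + _).
  apply: (sym_ext (f := fun a => mul a (sprod [::])) (g := id)) => // [|u].
    by case: mul_bilinear.
  by rewrite mul_sprod mulw_sprod cats0.
rewrite -tpart1; apply/eqP; rewrite -subr_eq0; apply/eqP; apply: tpart_eq0 => n.
rewrite (linearBf (@tpart_linear n)) tpart_tpart.
have [->|n1] := eqVneq n 1%N; [by rewrite subrr|rewrite subr0].
have e : tpart n (mul2 (comul a)) = 2 ^+ n *: tpart n a.
  apply: (sym_ext (f := fun a => tpart n (mul2 (comul a)))
    (g := fun a => 2 ^+ n *: tpart n a)) => [||w].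
  - apply: linear_compf; first exact: tpart_linear.
    by apply: linear_compf; [exact: mul2_linear|exact: comul_linear].
  - by apply: linear_scalef; exact: tpart_linear.
  rewrite mul2_comul (linearZf _ _ (@tpart_linear n)) !tpart_sprod.
  by case: eqP => [->|_]; rewrite ?scaler0.
move: e; rewrite mula (linearZf _ _ (@tpart_linear n)) => /eqP.
rewrite -subr_eq0 -scalerBl scaler_eq0 => /orP[|/eqP//].
(* The factor 2 - 2^n is 1 for n = 0; for n >= 2 it is -2 times a positive integer, hence
   nonzero. *)
case: n n1 => [|[|n]] // _; first by rewrite expr0 addrK oner_eq0.
rewrite 2!exprS -{1}[2]mulr1 -mulrBr mulf_eq0 (negbTE (K0 1)) /=.
rewrite -opprB oppr_eq0 -natrX -natrM.
have -> : (2 * 2 ^ n = (2 * 2 ^ n).-1.+1)%N by rewrite prednK ?muln_gt0 ?expn_gt0.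
rewrite -natr1 addrK.
have -> : ((2 * 2 ^ n).-1 = (2 * 2 ^ n).-2.+1)%N.
  by case: (2 ^ n)%N (expn_gt0 2 n) => // k _; rewrite mulnS.
by rewrite (negbTE (K0 _)).
Qed.

End Primitive.

(** * Vanishing of coderivations along a morphism *)

Section Uniqueness.
Variables (K : fieldType) (U V : gspace K).
Hypothesis K0 : forall n, n.+1%:R != 0 :> K.
Local Notation sg n := ((-1) ^ (n) : K).

(** [P] is a coderivation along [F]. By induction on the length the proper splittings of w
    contribute 0, so [P (sprod w)] is primitive, hence a vector, and the last hypothesis applies.
    The uses are P = D, P = D ∘ D and P = F ∘ D - D' ∘ F. As that hypothesis speaks only of values
    that are already vectors, it can be verified by any map that is injective on vectors. *)
Lemma coderivation_along_eq0 (n : int) (F P : Sym U -> Sym V) :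
  F (sprod [::]) = sprod [::] ->
  (forall w, comul (P (sprod w)) = shsum w (fun u v =>
     tensor (P (sprod u)) (F (sprod v))
     + sg (n * wdeg u) *: tensor (F (sprod u)) (P (sprod v)))) ->
  (forall w v, P (sprod w) = lsm v (sprod [::]) -> v = 0) ->
  forall w, P (sprod w) = 0.
Proof.
move=> F1 Pc Ps w; have [m] := ubnP (size w); elim: m w => // m IH w wm.
have prim u : comul (P (sprod u)) = tensor (P (sprod u)) (sprod [::]) + tensor (sprod [::]) (P (sprod u)) ->
    P (sprod u) = 0.
  by move/(primitive_lsm K0) => e; rewrite e (Ps u _ e) lsm0.
have [->|w0] := eqVneq w [::].
  apply: prim.
  by rewrite Pc shsum_nil wdeg_nil mulr0 expr0z scale1r F1.
have P1 : P (sprod [::]) = 0.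
  by apply: IH; move: wm w0; case: w => //= x w; rewrite ltnS; case: m.
apply: prim.
rewrite Pc shsum_ends //.
  by rewrite P1 F1 !tensor0r !tensor0l scaler0 addr0 add0r wdeg_nil mulr0 expr0z scale1r.
move: wm; rewrite ltnS => wm u v u0 v0 s; rewrite !IH ?tensor0r ?tensor0l ?scaler0 ?addr0 //.
  apply: leq_trans wm; rewrite -s -[X in (X < _)%N]add0n ltn_add2r.
  by case: u u0 {s}.
apply: leq_trans wm; rewrite -s -[X in (X < _)%N]addn0 ltn_add2l.
by case: v v0 {s}.
Qed.

Lemma comul_coderivation n (D : Sym U -> Sym U) w : coderivation n D -> linear D ->
  comul (D (sprod w)) = shsum w (fun u v =>
     tensor (D (sprod u)) (sprod v)
     + sg (n * wdeg u) *: tensor (sprod u) (D (sprod v))).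
Proof.
move=> [_ Dc] Dl; rewrite Dc; apply: etrans.
  apply: (telim_comul w (f := fun x y => tensor (D x) y + tensor (sgn_op n x) (D y))).
  apply: bilinearD; apply: bilinear_tensor => //.
  exact: sgn_op_linear.
apply: eq_shsum => u v _ _; congr (_ + _).
by rewrite sgn_opE tensorZl.
Qed.

Lemma comul_coalg (F : Sym U -> Sym V) w : coalg_morphism F -> linear F ->
  comul (F (sprod w))
    = shsum w (fun u v => tensor (F (sprod u)) (F (sprod v))).
Proof.
move=> [_ Fc _ _] Fl; rewrite Fc; apply: (telim_comul w).
by apply: bilinear_tensor.
Qed.
End Uniqueness.

Lemma tensorBl (K : fieldType) (A B : lmodType K) (a a' : A) (b : B) :
  tensor (a - a') b = tensor a b - tensor a' b.
Proof. exact: (linearBf (tensorPl b)). Qed.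

Lemma tensorBr (K : fieldType) (A B : lmodType K) (a : A) (b b' : B) :
  tensor a (b - b') = tensor a b - tensor a b'.
Proof. exact: (linearBf (tensorPr a)). Qed.

Lemma scaleN1_addB (K : fieldType) (W : lmodType K) (s : K) (X Y A B : W) :
  -1 *: (X + s *: Y) + (A + s *: B) = (A - X) + s *: (B - Y).
Proof. by rewrite scaleN1r scalerBr opprD addrACA [A - X]addrC [s *: B - _]addrC. Qed.

Section UniquenessApplied.
Variables (K : fieldType) (U V : gspace K).
Hypothesis K0 : forall n, n.+1%:R != 0 :> K.
Local Notation sg n := ((-1) ^ (n) : K).

Lemma coderivation_eq0 n (D : Sym U -> Sym U) : coderivation n D -> linear D ->
  (forall w, taylor D w = 0) -> forall w, D (sprod w) = 0.
Proof.
move=> Dc Dl D0.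
apply: (coderivation_along_eq0 K0 (F := id) erefl (fun w => comul_coderivation w Dc Dl)) => w v e.
by rewrite -[v]spr_lsm -e; exact: D0.
Qed.

(** The square of an odd coderivation is a coderivation of degree 2: the two mixed terms cancel,
    because passing D u instead of u changes the sign. *)
Lemma coderivation_sq_eq0 (D : Sym U -> Sym U) : coderivation 1 D -> linear D ->
  (forall w v, D (D (sprod w)) = lsm v (sprod [::]) -> v = 0) -> forall a, D (D a) = 0.
Proof.
move=> Dc Dl D0; have DDl : linear (fun a => D (D a)) by exact: linear_compf.
apply: (sym_ext (g := fun=> 0)) => //; first exact: linear_zero.
apply: (coderivation_along_eq0 K0 (n := 2) (F := id) (P := fun a => D (D a)) erefl _ D0) => w.
have b1 : bilinear_map (fun x y : Sym U => tensor (D x) y + tensor (sgn_op 1 x) (D y)).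
  apply: bilinearD; apply: bilinear_tensor => //; exact: sgn_op_linear.
case: (Dc) => Dd Dcom.
rewrite Dcom (comul_coderivation w Dc Dl) (linear_shsum _ _ (telim_linear b1)).
apply: eq_shsum => u v _ _.
rewrite (linearDf (telim_linear b1)) (linearZf _ _ (telim_linear b1)).
rewrite !(telimE b1) (sgn_op_deg _ (Dd u)) sgn_opE !tensorZl scalerDr !scalerA.
set A := tensor (D (D _)) _; set B := tensor (D _) (D _); set C := tensor (sprod u) _.
have -> : sg (2 * wdeg u) = sg (1 * wdeg u) * sg (1 * wdeg u).
  by rewrite -sgD -mulrDl.
have -> : sg (1 * (wdeg u + 1)) = - sg (1 * wdeg u).
  by rewrite mulrDr sgD mulr1 expr1z mulrN1.
by rewrite scaleNr addrA addrNK.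
Qed.

(** The difference F ∘ D - D' ∘ F is a coderivation along F, so it suffices that its components in
    [V] vanish. *)
Lemma Linfty_morphism_words (D : Sym U -> Sym U) (D' : Sym V -> Sym V) (F : Sym U -> Sym V) :
  coderivation 1 D -> linear D -> coderivation 1 D' -> linear D' ->
  coalg_morphism F -> linear F ->
  (forall w, spr (F (D (sprod w))) = spr (D' (F (sprod w)))) ->
  Linfty_morphism D D' F.
Proof.
move=> Dc Dl D'c D'l Fc Fl e; split=> // a; apply/eqP; rewrite -subr_eq0; apply/eqP.
have lin : linear (fun a => F (D a) - D' (F a)).
  move=> c x y; rewrite Dl Fl Fl D'l; rewrite opprD addrACA.
  by rewrite -scalerBr.
apply: (sym_ext (f := fun a => F (D a) - D' (F a)) (g := fun=> 0)) => //.
  exact: linear_zero.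
case: (Fc) => Fd Fcom _ F1.
apply: (coderivation_along_eq0 K0 (P := fun a => F (D a) - D' (F a)) (n := 1) F1) => w; last first.
  by move=> v ev; rewrite -[v]spr_lsm -ev (linearBf (@spr_linear K V)) e subrr.
have lc := @comul_linear K V.
have bF : bilinear_map (fun x y : Sym U => tensor (F x) (F y)) by exact: bilinear_tensor.
have b1 : bilinear_map (fun x y : Sym V => tensor (D' x) y + tensor (sgn_op 1 x) (D' y)).
  by apply: bilinearD; apply: bilinear_tensor => //; exact: sgn_op_linear.
have -> : F (D (sprod w)) - D' (F (sprod w)) = -1 *: D' (F (sprod w)) + F (D (sprod w)).
  by rewrite scaleN1r addrC.
rewrite lc Fcom (comul_coderivation w Dc Dl) (linear_shsum _ _ (telim_linear bF)).
case: (D'c) => _ ->.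
rewrite (comul_coalg w Fc Fl) (linear_shsum _ _ (telim_linear b1)).
rewrite -shsumZ -shsumD; apply: eq_shsum => u v _ _.
rewrite (linearDf (telim_linear bF)) (linearZf _ _ (telim_linear bF)).
rewrite !(telimE b1) !(telimE bF) (sgn_op_deg _ (Fd u)) !tensorZl.
rewrite tensorBl tensorBr; exact: scaleN1_addB.
Qed.

End UniquenessApplied.

(** Bookkeeping of the Leibniz rule for divided powers: after reindexing, the same term occurs with
    the weights j and k + 1 - j, which add up to k + 1. *)
Lemma sum_antidiagonal (K : fieldType) (W : lmodType K) (A : nat -> nat -> W) k :
  \sum_(j < k.+1) (j.+1%:R *: A j.+1 (k - j)%N + (k - j)%N.+1%:R *: A j (k - j)%N.+1)
    = k.+1%:R *: \sum_(j < k.+2) A j (k.+1 - j)%N.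
Proof.
rewrite scaler_sumr.
have e (j : 'I_k.+2) : true -> k.+1%:R *: A j (k.+1 - j)%N
    = j%:R *: A j (k.+1 - j)%N + (k.+1 - j)%N%:R *: A j (k.+1 - j)%N.
  by move=> _; rewrite -scalerDl -natrD subnKC // -ltnS.
rewrite (eq_bigr _ e) !big_split /=; congr (_ + _).
  rewrite [RHS]big_ord_recl scale0r add0r; apply: eq_bigr => j _.
  by rewrite lift0 subSS.
rewrite [RHS]big_ord_recr /= subnn scale0r addr0; apply: eq_bigr => j _.
by rewrite subSn // -ltnS ltn_ord.
Qed.

Lemma sum_triangle (K : fieldType) (W : lmodType K) (A : nat -> nat -> W) M :
  \sum_(k < M) \sum_(j < k.+1) A j (k - j)%N
    = \sum_(i < M) \sum_(l < M - i) A i l.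
Proof.
elim: M => [|M IH]; first by rewrite !big_ord0.
rewrite big_ord_recr /= IH [X in X + _](_ : _ = \sum_(i < M.+1) \sum_(l < M - i) A i l).
  rewrite -big_split /=; apply: eq_bigr => i _.
  by rewrite subSn ?big_ord_recr // -ltnS ltn_ord.
by rewrite big_ord_recr /= subnn big_ord0 addr0.
Qed.

(** * The convolution exponential *)

Section Exponential.
Variables (K : fieldType) (U V : gspace K).
Implicit Types (u v w : seq (homog U)) (a b : Sym U).
Hypothesis K0 : forall n, n.+1%:R != 0 :> K.

Variable phi : Sym U -> V.
Hypothesis phi_linear : linear phi.
Hypothesis phi_deg0 : forall w, gpr (wdeg w) (phi (sprod w)) = phi (sprod w).
Hypothesis phi1 : phi (sprod [::]) = 0.

Let phi_deg w : gpr (wdeg w + 0) (phi (sprod w)) = phi (sprod w).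
Proof. by rewrite addr0. Qed.

(* The k-th divided power of phi for the convolution product. *)
Fixpoint expk k : Sym U -> Sym V :=
  if k is k'.+1 then fun a => k%:R^-1 *: conv phi (expk k') a
  else fun a => (counit a : K) *: sprod [::].

Lemma expk_linear k : linear (expk k).
Proof.
elim: k => [|k IH] /=.
  by move=> c a b; rewrite counit_linear scalerDl scalerA.
by apply: linear_scalef; exact: conv_linear.
Qed.

Lemma expkS k w : k.+1%:R *: expk k.+1 (sprod w)
  = shsum w (fun u v => smul (phiw 0 phi u) (expk k (sprod v))).
Proof.
rewrite /= scalerA divff ?K0 // scale1r.
exact: (conv_sprod phi_linear phi_deg w (expk_linear k)).
Qed.

Lemma expk_sprodS k w : expk k.+1 (sprod w)
  = k.+1%:R^-1 *: shsum w (fun u v => smul (phiw 0 phi u) (expk k (sprod v))).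
Proof. by rewrite -expkS scalerA mulVf ?K0 // scale1r. Qed.

Lemma expk_deg k w : sym_deg (wdeg w) (expk k (sprod w)).
Proof.
elim: k w => [|k IH] w /=.
  rewrite counitE; case: eqP => [->|_]; rewrite ?scale1r ?scale0r.
    by rewrite wdeg_nil -(wdeg_nil V); exact: sym_deg_sprod.
  exact: sym_deg0.
apply: sym_degZ; have := conv_deg phi_linear phi_deg (m := 0) w (expk_linear k).
by rewrite !addr0; apply=> v; rewrite addr0.
Qed.

Lemma expk_small k w : (size w < k)%N -> expk k (sprod w) = 0.
Proof.
elim: k w => // k IH w wk; rewrite expk_sprodS.
rewrite (_ : shsum _ _ = 0) ?scaler0 //.
rewrite -[RHS](shsum0 _ w); apply: eq_shsum => -[|x u] v _ s.
  by rewrite smul_zero // hval_phiw.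
rewrite IH ?(linear0f (smul_linear _)) //.
by rewrite -ltnS (leq_trans _ wk) // -s /= addSn !ltnS leq_addl.
Qed.

Local Notation A w j l :=
  (shsum w (fun u v => tensor (expk j (sprod u)) (expk l (sprod v)))).

(** By [shsum_lmul] one more factor of φ raises either the left or the right power by one;
    [sum_antidiagonal] collects the resulting weights, and the common factor k + 1 is cancelled. *)
Lemma comul_expk k w :
  comul (expk k (sprod w)) = \sum_(j < k.+1) A w j (k - j)%N.
Proof.
elim: k w => [|k IH] w.
  rewrite big_ord1 /= (linearZf _ _ (@comul_linear K V)) comul_shsum shsum_nil counitE.
  have [->|w0] := eqVneq w [::].
    by rewrite shsum_nil /= counitE eqxx !scale1r.
  rewrite scale0r -[LHS](shsum0 _ w); apply: eq_shsum => u v _ s.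
  rewrite !counitE tensorZl tensorZr scalerA.
  case: u v s => [|x u] [|y v] s; rewrite ?mulr0 ?mul0r ?scale0r //.
  by move: w0; rewrite -size_eq0 -s.
apply: (@scalerI _ _ k.+1%:R); first exact: K0.
rewrite -(linearZf _ _ (@comul_linear K V)) expkS.
rewrite (linear_shsum _ _ (@comul_linear K V)).
apply: etrans; first last.
  exact: (sum_antidiagonal (fun j l => A w j l)).
transitivity (\sum_(j < k.+1) shsum w (fun u v => shsum v (fun v1 v2 =>
   lmul (phiw 0 phi u) (tensor (expk j (sprod v1)) (expk (k - j)%N (sprod v2)))))).
  rewrite -shsum_sum; apply: eq_shsum => u v _ _; rewrite comul_smul IH.
  have ll := @lmul_linear _ _ (phiw 0 phi u).
  rewrite (linear_sum1 _ _ ll); apply: eq_bigr => j _.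
  by rewrite (linear_shsum _ _ ll).
apply: eq_bigr => j _; apply: etrans.
  apply: (@shsum_lmul _ _ _ 0 phi (fun v => expk j (sprod v))
            (fun v => expk (k - j)%N (sprod v)) w).
  by move=> v; exact: expk_deg.
congr (_ + _).
  rewrite -shsumZ; apply: eq_shsum => u v _ _.
  by rewrite -expkS tensorZl.
rewrite -shsumZ; apply: eq_shsum => u v _ _.
by rewrite mul0r expr0z scale1r -expkS tensorZr.
Qed.

(** The exponential series. It is finite on each word because φ kills the unit, so the powers above
    the length vanish ([expk_small]); [coexp_sprod] allows any larger bound. *)
Definition coexp : Sym U -> Sym V :=
  pelim (fun w => \sum_(k < (size w).+1) expk k (sprod w)).

Lemma expk_sum_wide w N : (size w < N)%N ->
  \sum_(k < N) expk k (sprod w) = \sum_(k < (size w).+1) expk k (sprod w).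
Proof.
move=> wN; rewrite -!(big_mkord xpredT (fun k => expk k (sprod w))).
rewrite (@big_cat_nat _ _ _ (size w).+1) //= [X in _ + X = _]big_nat_cond [X in _ + X = _]big1 ?addr0 //.
by move=> k /andP[/andP[wk _] _]; exact: expk_small.
Qed.

Lemma coexp_compat :
  sym_compat (fun w => \sum_(k < (size w).+1) expk k (sprod w)).
Proof.
split=> [s t c x y z xz yz e|s t x y].
  rewrite (sprod_lin s t xz yz e) !size_cat /= scaler_sumr -big_split.
  by apply: eq_bigr => k _; rewrite expk_linear.
rewrite sprod_comm !size_cat /= scaler_sumr; apply: eq_bigr => k _.
by rewrite (linearZf _ _ (expk_linear k)).
Qed.

Lemma coexp_linear : linear coexp.
Proof. exact: sym_elim_linear coexp_compat. Qed.

Lemma coexp_sprod w N : (size w < N)%N ->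
  coexp (sprod w) = \sum_(k < N) expk k (sprod w).
Proof. by move=> wN; rewrite expk_sum_wide //; exact: sym_elimE coexp_compat _. Qed.

Lemma comul_coexp w : comul (coexp (sprod w))
  = shsum w (fun u v => tensor (coexp (sprod u)) (coexp (sprod v))).
Proof.
pose M := (size w).+1; rewrite (coexp_sprod (ltnSn _)) -/M.
rewrite (linear_sum1 _ _ (@comul_linear K V)).
under eq_bigr => k _ do rewrite comul_expk.
apply: etrans; first exact: (sum_triangle (fun j l => A w j l)).
(* The triangle of indices is filled up to a square: for i + l greater than the length of w, one of
   the two powers exceeds the length of its subword. *)
transitivity (\sum_(i < M) \sum_(l < M) A w i l).
  apply: eq_bigr => i _.
  rewrite -!(big_mkord xpredT (fun l => A w i l)).
  rewrite [RHS](@big_cat_nat _ _ _ (M - i)%N) ?leq_subr //=.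
  rewrite [X in _ = _ + X]big_nat_cond [X in _ = _ + X]big1 ?addr0 //.
  move=> l /andP[/andP[il _] _]; rewrite -[RHS](shsum0 _ w).
  apply: eq_shsum => u v _ s.
  have [ui|iu] := ltnP (size u) i.
    by rewrite expk_small // tensor0l.
  rewrite [expk l _]expk_small ?tensor0r //.
  rewrite -(ltn_add2l (size u)) s; apply: leq_trans (leq_add iu (leqnn l)).
  by rewrite -leq_subLR.
transitivity (shsum w (fun u v =>
    \sum_(i < M) \sum_(l < M) tensor (expk i (sprod u)) (expk l (sprod v)))).
  by rewrite shsum_sum; apply: eq_bigr => i _; rewrite shsum_sum.
apply: eq_shsum => u v _ s.
rewrite !(@coexp_sprod _ M) ?/M -?s ?ltnS ?leq_addl ?leq_addr //.
rewrite (linear_sum1 _ _ (tensorPl _)); apply: eq_bigr => i _.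
by rewrite (linear_sum1 _ _ (tensorPr _)).
Qed.

Lemma coexp1 : coexp (sprod [::]) = sprod [::].
Proof.
by rewrite (@coexp_sprod [::] 1%N) // big_ord1 /= counitE eqxx scale1r.
Qed.

Lemma counit_expkS k w : counit (expk k.+1 (sprod w)) = 0.
Proof.
rewrite expk_sprodS (linearZf _ _ (@counit_linear K V)).
rewrite (linear_shsum _ _ (@counit_linear K V)) -[RHS](scaler0 _ (k.+1%:R^-1)).
congr (_ *: _); rewrite -[RHS](shsum0 K^o w); apply: eq_shsum => u v _ _.
exact: counit_smul.
Qed.

Lemma counit_expk0 w : counit (expk 0 (sprod w)) = counit (sprod w).
Proof.
rewrite /= (linearZf _ _ (@counit_linear K V)) [counit (sprod [::])]counitE.
exact: mulr1.
Qed.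

Lemma taylor_coexp w : taylor coexp w = phi (sprod w).
Proof.
rewrite /taylor (@coexp_sprod w _ (leqnSn (size w).+1)).
rewrite (linear_sum1 _ _ (@spr_linear K V)) !big_ord_recl /=.
rewrite (linearZf _ _ (@spr_linear K V)) sprE scaler0 add0r.
rewrite [X in _ + X]big1 ?addr0 => [|k _].
  rewrite invr1 scale1r (conv_sprod phi_linear phi_deg w (expk_linear 0)).
  rewrite (linear_shsum _ _ (@spr_linear K V)).
  rewrite -[RHS](shsum_nilr w (fun u => phi (sprod u))).
  apply: eq_shsum => u v _ _; rewrite spr_smul counit_expk0 counitE hval_phiw //.
  by case: v => [|? ?]; rewrite ?scale1r ?scale0r.
rewrite -[bump 0 _]/(k.+1) -/(expk k.+2 (sprod w)) expk_sprodS.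
rewrite (linearZf _ _ (@spr_linear K V)) (linear_shsum _ _ (@spr_linear K V)).
rewrite (_ : shsum _ _ = 0) ?scaler0 // -[RHS](shsum0 V w).
by apply: eq_shsum => u v _ _; rewrite spr_smul counit_expkS scale0r.
Qed.

Lemma coexp_coalg : coalg_morphism coexp.
Proof.
split=> [w|a|a|]; last exact: coexp1.
- rewrite (coexp_sprod (ltnSn _)); apply: sym_deg_sum => k; exact: expk_deg.
- move: a; apply: sym_ext.
  + by apply: linear_compf; [exact: comul_linear|exact: coexp_linear].
  + apply: linear_compf; last exact: comul_linear.
    by apply: telim_linear; apply: bilinear_tensor; exact: coexp_linear.
  move=> w; rewrite comul_coexp; apply: esym.
  apply: (telim_comul w (f := fun x y => tensor (coexp x) (coexp y))).
  by apply: bilinear_tensor; exact: coexp_linear.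
move: a; apply: sym_ext.
- by apply: linear_compf; [exact: counit_linear|exact: coexp_linear].
- exact: counit_linear.
move=> w; rewrite (coexp_sprod (ltnSn _)) (linear_sum1 _ _ (@counit_linear K V)).
rewrite big_ord_recl counit_expk0 big1 ?addr0 // => k _.
exact: counit_expkS.
Qed.

End Exponential.

Section QuadraticTarget.
Variables (K : fieldType) (U V : gspace K).
Implicit Types (u v w : seq (homog U)).
Hypothesis K0 : forall n, n.+1%:R != 0 :> K.

(* For a coalgebra morphism F, the component of F w in S^1 + S^2 is
   F_1 + (F_1 * F_1) / 2. *)
Lemma quadratic_coalg (d : Sym V -> V) (F : Sym U -> Sym V) w :
  linear d -> (forall u : seq (homog V), size u != 1%N -> size u != 2%N -> d (sprod u) = 0) ->
  coalg_morphism F -> linear F ->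
  d (F (sprod w)) = d (lsm (taylor F w) (sprod [::]))
    + 2^-1 *: shsum w (fun u v => d (lsm (taylor F u) (lsm (taylor F v) (sprod [::])))).
Proof.
move=> dl d12 Fc Fl.
pose L (a b : V) : Sym V := lsm a (lsm b (sprod [::])).
have Lb : bilinear_map (fun x y : Sym V => L (spr x) (spr y)).
  apply: (bilinear_comp2 (f := L)); try exact: spr_linear.
  split=> [b|a]; first exact: lsm_linearl.
  by apply: (linear_compf (f := lsm a)); [exact: lsm_linear|exact: lsm_linearl].
(* The formula is first proved for d on [Sym V], word by word; compatibility of [F] with the
   comultiplication then transports it to w. *)
have ld : linear (fun b => d (lsm (spr b) (sprod [::]))
    + 2^-1 *: d (telim (fun x y => L (spr x) (spr y)) (comul b))).
  apply: linear_addf.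
    apply: (linear_compf (f := d)) => //.
    by apply: (linear_compf (f := fun v : V => lsm v (sprod [::]))); [exact: lsm_linearl|exact: spr_linear].
  apply: linear_scalef; apply: (linear_compf (f := d)) => //.
  by apply: linear_compf; [exact: telim_linear Lb|exact: comul_linear].
rewrite [LHS](sym_ext dl ld); last first.
  move=> u; rewrite (telim_comul u Lb) sprE.
  have K2 : (2 : K) != 0 by exact: (K0 1).
  case: u => [|x [|y [|z u]]].
  - by rewrite d12 // shsum_nil sprE /L !lsm0 (linear0f dl) scaler0 addr0.
  - rewrite lsm_hval smulE shsum1 !sprE /L !lsm0.
    by rewrite (linear0f (@lsm_linear _ _ _)) addr0 (linear0f dl) scaler0 addr0.
  (* The two proper unshuffles of a two-letter word have the same product up to the Koszul sign in
     the sum, so half of their sum is the word itself. *)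
  - rewrite lsm0 -[LHS]add0r; apply: f_equal2; first exact: (esym (linear0f dl)).
    rewrite shsum2.
    rewrite !sprE /L.
    rewrite !lsm0.
    rewrite ?addr0 ?add0r.
    rewrite !lsm_hval.
    rewrite !smulE.
    rewrite (sprod_comm [::] [::] y x).
    rewrite scalerA [_ * hdeg y]mulrC sg_sq scale1r.
    rewrite -mulr2n.
    rewrite -scaler_nat.
    by rewrite (linearZf _ _ dl) scalerA mulVf // scale1r.
  rewrite d12 // lsm0 (linear0f dl) add0r (_ : shsum _ _ = 0).
    by rewrite (linear0f dl) scaler0.
  rewrite -[RHS](shsum0 _ [:: x, y, z & u]); apply: eq_shsum => u1 u2 _.
  rewrite !sprE /L; case: u1 => [|? [|? ?]]; rewrite ?lsm0 //.
  by case: u2 => [|? [|? ?]] //; rewrite lsm0 (linear0f (@lsm_linear _ _ _)).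
congr (_ + _ *: _).
rewrite (comul_coalg w Fc Fl) (linear_shsum _ _ (telim_linear Lb)).
rewrite (linear_shsum _ _ dl); apply: eq_shsum => u v _ _.
by rewrite telimE.
Qed.
End QuadraticTarget.

Section ShortWords.
Variables (K : fieldType) (V : gspace K) (W : lmodType K).
Implicit Types (x y z t : homog V) (w : seq (homog V)).
Local Notation sg n := ((-1) ^ (n) : K).

Lemma shsum4_22 x y z t (T : seq (homog V) -> seq (homog V) -> W) :
  (forall u v, size u != 2 -> T u v = 0) ->
  shsum [:: x; y; z; t] T =
    T [:: x; y] [:: z; t] + sg (hdeg y * hdeg z) *: T [:: x; z] [:: y; t]
    + sg (hdeg z * hdeg t) *: (sg (hdeg y * hdeg t) *: T [:: x; t] [:: y; z])
    + sg (hdeg x * (hdeg y + hdeg z)) *: T [:: y; z] [:: x; t]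
    + sg (hdeg z * hdeg t) *: (sg (hdeg x * (hdeg y + hdeg t)) *: T [:: y; t] [:: x; z])
    + sg (hdeg y * (hdeg z + hdeg t)) *: (sg (hdeg x * (hdeg z + hdeg t)) *: T [:: z; t] [:: x; y]).
Proof.
move=> T0; rewrite shsum_cons !shsum3 /= !wdeg_cons wdeg_nil !addr0.
rewrite !(T0 [:: x; _; _; _], T0 [:: x; _; _], T0 [:: x], T0 [:: _; _; _], T0 [:: _], T0 [::]) //.
by rewrite !(scaler0, addr0, add0r) !addrA.
Qed.

Lemma shsum4_31 x y z t (T : seq (homog V) -> seq (homog V) -> W) :
  (forall u v, size u != 3 -> T u v = 0) ->
  shsum [:: x; y; z; t] T =
    T [:: x; y; z] [:: t] + sg (hdeg z * hdeg t) *: T [:: x; y; t] [:: z]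
    + sg (hdeg y * (hdeg z + hdeg t)) *: T [:: x; z; t] [:: y]
    + sg (hdeg x * (hdeg y + (hdeg z + hdeg t))) *: T [:: y; z; t] [:: x].
Proof.
move=> T0; rewrite shsum_cons !shsum3 /= !wdeg_cons wdeg_nil !addr0.
rewrite !(T0 [:: x; _; _; _], T0 [:: x; _], T0 [:: x], T0 [:: _; _], T0 [:: _], T0 [::]) //.
by rewrite !(scaler0, addr0, add0r) !addrA.
Qed.

Definition word12 (f1 : homog V -> W) (f2 : homog V -> homog V -> W) w : W :=
  match w with [:: x] => f1 x | [:: x; y] => f2 x y | _ => 0 end.

Definition word3 (f3 : homog V -> homog V -> homog V -> W) w : W :=
  if w is [:: x; y; z] then f3 x y z else 0.

Definition lin_in (f : homog V -> W) :=
  forall a x y z, hdeg x = hdeg z -> hdeg y = hdeg z ->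
    hval z = a *: hval x + hval y -> f z = a *: f x + f y.

Lemma word12_compat f1 f2 : lin_in f1 ->
  (forall y, lin_in (f2 ^~ y)) ->
  (forall x y, f2 x y = sg (hdeg x * hdeg y) *: f2 y x) ->
  sym_compat (word12 f1 f2).
Proof.
move=> l1 l2 c2; split=> [s t a x y z xz yz e|s t x y].
  case: s t => [|p [|? [|? ?]]] [|r [|? [|? ?]]] //=; rewrite ?scaler0 ?addr0 //.
  - exact: l1.
  - exact: (l2 r).
  by rewrite c2 [f2 p x]c2 [f2 p y]c2 (l2 p a x y z) // xz yz scalerDr !scalerA mulrC.
by case: s t => [|? [|? [|? ?]]] [|? ?] //=; rewrite ?scaler0.
Qed.

(** Linearity in the first letter suffices: the two adjacent transpositions carry it to the other
    letters. *)
Lemma word3_compat f3 :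
  (forall y z, lin_in (fun x => f3 x y z)) ->
  (forall x y z, f3 x y z = sg (hdeg x * hdeg y) *: f3 y x z) ->
  (forall x y z, f3 x y z = sg (hdeg y * hdeg z) *: f3 x z y) ->
  sym_compat (word3 f3).
Proof.
move=> l c12 c23; split=> [s t a x y z xz yz e|s t x y].
  case: s t => [|p [|r [|? [|? ?]]]] [|m [|n [|? [|? ?]]]] //=; rewrite ?scaler0 ?addr0 //.
  - exact: (l m n).
  - rewrite c12 [f3 p x m]c12 [f3 p y m]c12 (l p m a x y z) //.
    by rewrite xz yz scalerDr !scalerA mulrC.
  rewrite c23 [f3 p r x]c23 [f3 p r y]c23 c12 [f3 p x r]c12 [f3 p y r]c12.
  rewrite (l p r a x y z) // xz yz !scalerDr !scalerA.
  by congr (_ *: _ + _); rewrite mulrC mulrA mulrAC -mulrA mulrC.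
by case: s t => [|? [|? [|? [|? ?]]]] [|? [|? ?]] //=; rewrite ?scaler0.
Qed.

End ShortWords.

Section TaylorStructure.
Variables (K : fieldType) (V : gspace K) (t : seq (homog V) -> V).
Implicit Types (w : seq (homog V)).
Hypothesis K0 : forall n, n.+1%:R != 0 :> K.
Hypothesis tc : sym_compat t.
Hypothesis t_deg : forall w, gpr (wdeg w + 1) (t w) = t w.

Definition tmap : Sym V -> V := pelim t.

Lemma tmap_sprod w : tmap (sprod w) = t w. Proof. exact: sym_elimE. Qed.
Lemma tmap_linear : linear tmap. Proof. exact: sym_elim_linear. Qed.
Lemma tmap_deg w : gpr (wdeg w + 1) (tmap (sprod w)) = tmap (sprod w).
Proof. by rewrite tmap_sprod. Qed.

Definition tcoder : Sym V -> Sym V := coder tmap.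

Lemma tcoder_linear : linear tcoder.
Proof. exact: coder_linear tmap_linear. Qed.
Lemma tcoder_coderivation : coderivation 1 tcoder.
Proof. exact: coder_coderivation tmap_linear tmap_deg. Qed.
Lemma taylor_tcoder w : taylor tcoder w = t w.
Proof. by rewrite (taylor_coder tmap_linear tmap_deg) tmap_sprod. Qed.

Definition thom w : homog V := phiw 1 tmap w.
Lemma hdeg_thom w : hdeg (thom w) = wdeg w + 1. Proof. by []. Qed.
Lemma hval_thom w : hval (thom w) = t w.
Proof. by rewrite hval_phiw ?tmap_sprod //; exact: tmap_deg. Qed.

Lemma tcoder_sprod w :
  tcoder (sprod w) = shsum w (fun u v => sprod (thom u :: v)).
Proof.
rewrite /tcoder (coder_sprod tmap_linear tmap_deg); apply: eq_shsum => u v _ _.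
exact: smulE.
Qed.

Lemma tcoder_unit : t [::] = 0 -> tcoder (sprod [::]) = 0.
Proof.
move=> t0; rewrite tcoder_sprod shsum_nil; apply: (@sprod_zero _ _ [::]).
by rewrite hval_thom.
Qed.

Lemma comp_tcoder (W : lmodType K) (f : Sym V -> W) w : linear f ->
  f (tcoder (sprod w)) = shsum w (fun u v => f (sprod (thom u :: v))).
Proof. by move=> fl; rewrite tcoder_sprod (linear_shsum _ _ fl). Qed.

(** The second hypothesis is the family of generalized Jacobi identities: it is the component in [V]
    of the square of [tcoder]. *)
Lemma tcoder_Linfty : t [::] = 0 ->
  (forall w, shsum w (fun u v => t (thom u :: v)) = 0) ->
  Linfty_structure tcoder.
Proof.
move=> t0 tt; split; [exact: tcoder_coderivation| |exact: tcoder_unit].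
apply: (coderivation_sq_eq0 K0 tcoder_coderivation tcoder_linear) => w a ea.
rewrite -[a]spr_lsm -ea (comp_tcoder w (f := fun a => spr (tcoder a))); last first.
  by apply: linear_compf; [exact: spr_linear|exact: tcoder_linear].
by rewrite -[RHS](tt w); apply: eq_shsum => u v _ _; exact: taylor_tcoder.
Qed.

End TaylorStructure.

(** * Forms in coordinates *)

Section FormCoordinates.
Import ssrcomplements mpoly.
Variable K : fieldType.
Local Notation Sg := {mpoly K[3]}.
Local Notation CE := {ffun {set 'I_3} -> Sg}.

Definition o0 : 'I_3 := @Ordinal 3 0 isT.
Definition o1 : 'I_3 := @Ordinal 3 1 isT.
Definition o2 : 'I_3 := @Ordinal 3 2 isT.

Lemma sum3 (V : nmodType) (F : 'I_3 -> V) : \sum_i F i = F o0 + F o1 + F o2.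
Proof.
rewrite !big_ord_recl big_ord0 addr0 addrA.
by congr (F _ + F _ + F _); apply: val_inj.
Qed.

(** With subsets encoded by three booleans, inclusions, differences, cardinalities and inversion
    counts become computations. *)
Definition bset (a b c : bool) : {set 'I_3} :=
  [set i : 'I_3 | nth false [:: a; b; c] i].

Lemma in_bset a b c i : (i \in bset a b c) = nth false [:: a; b; c] i.
Proof. by rewrite inE. Qed.

Lemma ord3P (P : 'I_3 -> Prop) : P o0 -> P o1 -> P o2 -> forall i, P i.
Proof.
by move=> P0 P1 P2 [[|[|[|//]]] i]; [move: P0|move: P1|move: P2];
  congr P; apply: val_inj.
Qed.

Lemma bsetK (I : {set 'I_3}) : bset (o0 \in I) (o1 \in I) (o2 \in I) = I.
Proof. by apply/setP; apply: ord3P; rewrite in_bset. Qed.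

Lemma set3_ind (P : {set 'I_3} -> Prop) :
  (forall a b c, P (bset a b c)) -> forall I, P I.
Proof. by move=> Pb I; rewrite -[I]bsetK. Qed.

Lemma sum_set3 (V : nmodType) (P : pred {set 'I_3}) (F : {set 'I_3} -> V) :
  \sum_(I | P I) F I =
  \sum_(a : bool) \sum_(b : bool) \sum_(c : bool)
     if P (bset a b c) then F (bset a b c) else 0.
Proof.
rewrite big_mkcond (reindex (fun t : bool * bool * bool => bset t.1.1 t.1.2 t.2)) /=.
  by rewrite pair_big pair_big; apply: eq_bigr => -[[a b] c] _.
exists (fun I : {set 'I_3} => (o0 \in I, o1 \in I, o2 \in I)) => [[[a b] c] _|I _] /=.
  by rewrite !in_bset.
exact: bsetK.
Qed.

Lemma subset_bset a b c a' b' c' :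
  (bset a b c \subset bset a' b' c') = [&& a ==> a', b ==> b' & c ==> c'].
Proof.
apply/subsetP/and3P => [s|[sa sb sc]].
  by split; apply/implyP => h;
    [move: (s o0)|move: (s o1)|move: (s o2)]; rewrite !in_bset /=; apply.
by apply: ord3P; rewrite !in_bset /=; exact/implyP.
Qed.

Lemma setD_bset a b c a' b' c' :
  bset a b c :\: bset a' b' c' = bset (a && ~~ a') (b && ~~ b') (c && ~~ c').
Proof. by apply/setP; apply: ord3P; rewrite inE !in_bset /= andbC. Qed.

Lemma card_bset a b c : #|bset a b c| = (a + b + c)%N.
Proof.
rewrite -sum1_card big_mkcond !big_ord_recl big_ord0 !in_bset /= addn0.
by case: a b c => [] [] [].
Qed.

Lemma inv_count_bset a b c a' b' c' :
  inv_count (bset a b c) (bset a' b' c')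
    = ((b && a') + (c && a') + (c && b'))%N.
Proof.
rewrite /inv_count -sum1_card big_mkcond.
rewrite (eq_bigr (fun p : 'I_3 * 'I_3 =>
   nat_of_bool [&& p.1 \in bset a b c, p.2 \in bset a' b' c' & (p.2 < p.1)%N])); last first.
  by move=> p _; rewrite inE; case: ifP.
rewrite -(pair_big xpredT xpredT (fun i j : 'I_3 =>
   nat_of_bool [&& i \in bset a b c, j \in bset a' b' c' & (j < i)%N])) /=.
rewrite !big_ord_recl !big_ord0 !in_bset /= !andbF !andbT ?(add0n, addn0) ?addnA.
by rewrite ?andbT ?andbF.
Qed.

(* [b1] is the coefficient of eps^2 /\ eps^0, hence the sign. *)
Definition mk8 (f a0 a1 a2 b0 b1 b2 t : Sg) : CE :=
  [ffun I : {set 'I_3} => match o0 \in I, o1 \in I, o2 \in I with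
    | false, false, false => f
    | true, false, false => a0 | false, true, false => a1 | false, false, true => a2
    | false, true, true => b0 | true, false, true => - b1 | true, true, false => b2
    | true, true, true => t end].

Lemma mk8E f a0 a1 a2 b0 b1 b2 t a b c : mk8 f a0 a1 a2 b0 b1 b2 t (bset a b c) =
  match a, b, c with
    | false, false, false => f
    | true, false, false => a0 | false, true, false => a1 | false, false, true => a2
    | false, true, true => b0 | true, false, true => - b1 | true, true, false => b2
    | true, true, true => t end.
Proof. by rewrite ffunE !in_bset. Qed.

Lemma mk8_exists (F : CE) : exists f a0 a1 a2 b0 b1 b2 t, F = mk8 f a0 a1 a2 b0 b1 b2 t.
Proof.
exists (F (bset false false false)), (F (bset true false false)),
 (F (bset false true false)), (F (bset false false true)),
 (F (bset false true true)), (- F (bset true false true)),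
 (F (bset true true false)), (F (bset true true true)).
apply/ffunP; apply: set3_ind => a b c; rewrite mk8E.
by case: a b c => [] [] []; rewrite ?opprK.
Qed.

Ltac ce_ext := apply/ffunP; apply: set3_ind; case; case; case.

Lemma mk8_inj f a0 a1 a2 b0 b1 b2 t f' a0' a1' a2' b0' b1' b2' t' :
  mk8 f a0 a1 a2 b0 b1 b2 t = mk8 f' a0' a1' a2' b0' b1' b2' t' ->
  [/\ f = f', [/\ a0 = a0', a1 = a1' & a2 = a2'],
      [/\ b0 = b0', b1 = b1' & b2 = b2'] & t = t'].
Proof.
move=> /ffunP e.
have := e (bset false false false); have := e (bset true false false).
have := e (bset false true false); have := e (bset false false true).
have := e (bset false true true); have := e (bset true false true).
have := e (bset true true false); have := e (bset true true true).
by rewrite !mk8E => -> -> /oppr_inj -> -> -> -> -> ->.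
Qed.

Lemma mk8D f a0 a1 a2 b0 b1 b2 t f' a0' a1' a2' b0' b1' b2' t' :
  mk8 f a0 a1 a2 b0 b1 b2 t + mk8 f' a0' a1' a2' b0' b1' b2' t' =
  mk8 (f + f') (a0 + a0') (a1 + a1') (a2 + a2')
      (b0 + b0') (b1 + b1') (b2 + b2') (t + t').
Proof. by ce_ext; rewrite ffunE !mk8E ?opprD. Qed.

Lemma mk8Z c f a0 a1 a2 b0 b1 b2 t :
  c *: mk8 f a0 a1 a2 b0 b1 b2 t =
  mk8 (c *: f) (c *: a0) (c *: a1) (c *: a2) (c *: b0) (c *: b1) (c *: b2) (c *: t).
Proof. by ce_ext; rewrite ffunE !mk8E ?scalerN. Qed.

Lemma mk8_0 : (0 : CE) = mk8 0 0 0 0 0 0 0 0.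
Proof. by ce_ext; rewrite ffunE !mk8E ?oppr0. Qed.

Lemma form_part_mk8 (k : nat) f a0 a1 a2 b0 b1 b2 t :
  form_part k%:Z (mk8 f a0 a1 a2 b0 b1 b2 t) =
  match k with
  | 0%N => mk8 f 0 0 0 0 0 0 0 | 1%N => mk8 0 a0 a1 a2 0 0 0 0
  | 2 => mk8 0 0 0 0 b0 b1 b2 0 | 3 => mk8 0 0 0 0 0 0 0 t
  | _ => 0 end.
Proof.
by case: k => [|[|[|[|k]]]]; ce_ext; rewrite !ffunE /formdeg card_bset ?in_bset /= ?oppr0.
Qed.

Lemma smulf_mk8 g f a0 a1 a2 b0 b1 b2 t :
  smulf g (mk8 f a0 a1 a2 b0 b1 b2 t) =
  mk8 (g * f) (g * a0) (g * a1) (g * a2) (g * b0) (g * b1) (g * b2) (g * t).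
Proof. by ce_ext; rewrite ffunE !mk8E ?mulrN. Qed.

Lemma cderiv_mk8 i f a0 a1 a2 b0 b1 b2 t :
  cderiv i (mk8 f a0 a1 a2 b0 b1 b2 t) =
  mk8 f^`M(i) a0^`M(i) a1^`M(i) a2^`M(i) b0^`M(i) b1^`M(i) b2^`M(i) t^`M(i).
Proof. by ce_ext; rewrite ffunE !mk8E ?mderivN. Qed.

Lemma wedge_mk8 f a0 a1 a2 b0 b1 b2 t f' a0' a1' a2' b0' b1' b2' t' :
  wedge (mk8 f a0 a1 a2 b0 b1 b2 t) (mk8 f' a0' a1' a2' b0' b1' b2' t') =
  mk8 (f * f') (f * a0' + a0 * f') (f * a1' + a1 * f') (f * a2' + a2 * f')
    (f * b0' + b0 * f' + (a1 * a2' - a2 * a1'))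
    (f * b1' + b1 * f' + (a2 * a0' - a0 * a2'))
    (f * b2' + b2 * f' + (a0 * a1' - a1 * a0'))
    (f * t' + t * f' + (a0 * b0' + a1 * b1' + a2 * b2')
      + (b0 * a0' + b1 * a1' + b2 * a2')).
Proof.
ce_ext; rewrite ffunE sum_set3 !big_bool /= !subset_bset /= !setD_bset /=
  !inv_count_bset /= !mk8E ?expr0 ?expr1 ?sqrrN; ring.
Qed.

Lemma setU1_bset i a b c : i |: bset a b c =
  bset ((i == o0) || a) ((i == o1) || b) ((i == o2) || c).
Proof.
by apply/setP; apply: ord3P; rewrite !inE /= ![_ == i]eq_sym.
Qed.

Lemma contr_count i a b c : #|[set j in bset a b c | (i < j)%N]| =
  ((i < 0)%N && a + ((i < 1)%N && b) + ((i < 2)%N && c))%N.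
Proof.
rewrite -sum1_card big_mkcond !big_ord_recl big_ord0 !inE /= addn0 addnA.
by rewrite ![_ && (i < _)%N]andbC; case: a b c (i < 1)%N (i < 2)%N => [] [] [] [] [].
Qed.

Lemma contr0_mk8 f a0 a1 a2 b0 b1 b2 t :
  contr o0 (mk8 f a0 a1 a2 b0 b1 b2 t) = mk8 a0 0 (- b2) b1 t 0 0 0.
Proof.
by ce_ext; rewrite ffunE in_bset contr_count setU1_bset /= !mk8E
  ?expr0 ?expr1 ?expr2 /= ?mulN1r ?opprK ?mul1r ?oppr0.
Qed.
Lemma contr1_mk8 f a0 a1 a2 b0 b1 b2 t :
  contr o1 (mk8 f a0 a1 a2 b0 b1 b2 t) = mk8 a1 b2 0 (- b0) 0 t 0 0.
Proof.
by ce_ext; rewrite ffunE in_bset contr_count setU1_bset /= !mk8E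
  ?expr0 ?expr1 ?expr2 /= ?mulN1r ?opprK ?mul1r ?oppr0.
Qed.
Lemma contr2_mk8 f a0 a1 a2 b0 b1 b2 t :
  contr o2 (mk8 f a0 a1 a2 b0 b1 b2 t) = mk8 a2 (- b1) b0 0 0 0 t 0.
Proof.
by ce_ext; rewrite ffunE in_bset contr_count setU1_bset /= !mk8E
  ?expr0 ?expr1 ?expr2 /= ?mulN1r ?opprK ?mul1r ?oppr0.
Qed.

Local Notation "'∂0' f" := (f^`M(o0)) (at level 8, f at level 8, format "'∂0' f").
Local Notation "'∂1' f" := (f^`M(o1)) (at level 8, f at level 8, format "'∂1' f").
Local Notation "'∂2' f" := (f^`M(o2)) (at level 8, f at level 8, format "'∂2' f").

(** The half of the Schouten bracket before antisymmetrization. [along] differentiates along the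
    1-form part of the first argument, read as a vector field; [div] is the divergence of the 1-form
    part of the second. *)
Lemma prelie_mk8 f a0 a1 a2 b0 b1 b2 t g c0 c1 c2 d0 d1 d2 s :
  \sum_i wedge (contr i (mk8 f a0 a1 a2 b0 b1 b2 t))
               (cderiv i (mk8 g c0 c1 c2 d0 d1 d2 s)) =
  let along f := a0 * ∂0 f + a1 * ∂1 f + a2 * ∂2 f in
  let div := ∂0 c0 + ∂1 c1 + ∂2 c2 in
  mk8 (along g)
   (along c0 + (∂1 g * b2 - ∂2 g * b1))
   (along c1 + (∂2 g * b0 - ∂0 g * b2))
   (along c2 + (∂0 g * b1 - ∂1 g * b0))
   (t * ∂0 g + along d0 + b0 * div - (b0 * ∂0 c0 + b1 * ∂0 c1 + b2 * ∂0 c2))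
   (t * ∂1 g + along d1 + b1 * div - (b0 * ∂1 c0 + b1 * ∂1 c1 + b2 * ∂1 c2))
   (t * ∂2 g + along d2 + b2 * div - (b0 * ∂2 c0 + b1 * ∂2 c1 + b2 * ∂2 c2))
   (along s + t * div
    - (b0 * (∂1 d2 - ∂2 d1) + b1 * (∂2 d0 - ∂0 d2) + b2 * (∂0 d1 - ∂1 d0))).
Proof.
rewrite sum3 contr0_mk8 contr1_mk8 contr2_mk8 !cderiv_mk8 !wedge_mk8 !mk8D /=.
congr mk8; ring.
Qed.

Lemma sum4 (V : nmodType) (F : nat -> V) :
  \sum_(k < 4) F k = F 0%N + F 1%N + F 2 + F 3.
Proof. by rewrite !big_ord_recr big_ord0 /= add0r. Qed.

Lemma sum44 (V : nmodType) (F : nat -> nat -> V) :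
  \sum_(k < 4) \sum_(l < 4) F k l =
    F 0%N 0%N + F 0%N 1%N + F 0%N 2 + F 0%N 3 + (F 1%N 0%N + F 1%N 1%N + F 1%N 2 + F 1%N 3)
    + (F 2 0%N + F 2 1%N + F 2 2 + F 2 3) + (F 3 0%N + F 3 1%N + F 3 2 + F 3 3).
Proof. by rewrite (sum4 (fun k => \sum_(l < 4) F k l)) !sum4. Qed.

(** The exponent (k - 1) (l - 1) is odd exactly when both form degrees are even; then the two halves
    are added, otherwise subtracted. *)
Lemma schouten_hom_mk8 (k l : nat) f a0 a1 a2 b0 b1 b2 t g c0 c1 c2 d0 d1 d2 s :
  schouten_hom k l (mk8 f a0 a1 a2 b0 b1 b2 t) (mk8 g c0 c1 c2 d0 d1 d2 s) =
  \sum_i wedge (contr i (mk8 f a0 a1 a2 b0 b1 b2 t))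
               (cderiv i (mk8 g c0 c1 c2 d0 d1 d2 s))
  + (if odd k || odd l then -1 else 1 : K) *:
  \sum_i wedge (contr i (mk8 g c0 c1 c2 d0 d1 d2 s))
               (cderiv i (mk8 f a0 a1 a2 b0 b1 b2 t)).
Proof.
rewrite /schouten_hom -scaleNr; congr (_ + _ *: _).
have e (n : nat) : (-1 : K) ^ (n%:Z - 1) = (-1) ^+ ~~ odd n.
  rewrite expfzDr ?oppr_eq0 ?oner_eq0 // -exprnP -(signr_odd K n).
  rewrite [X in _ * X](invrN1 K : (-1 : K) ^ (-1) = -1).
  by case: (odd n); rewrite /= ?expr0 ?expr1 ?mul1r ?mulrNN ?mulr1.
rewrite -exprz_exp e; case: (odd k) => /=; last by rewrite expr1 e; case: (odd l); rewrite ?expr0 ?expr1 ?opprK.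
by rewrite exp1rz.
Qed.

Ltac hom_part T along div curl :=
  rewrite /T !form_part_mk8 schouten_hom_mk8 !prelie_mk8 /= !mderiv0 mk8Z mk8D ?mk8_0;
  by rewrite ?scaleN1r ?scale1r /along /div /curl; congr mk8; ring.

Lemma schouten_mk8 f a0 a1 a2 b0 b1 b2 t g c0 c1 c2 d0 d1 d2 s :
  let along a0 a1 a2 f := a0 * ∂0 f + a1 * ∂1 f + a2 * ∂2 f in
  let div a0 a1 a2 := ∂0 a0 + ∂1 a1 + ∂2 a2 in
  let curl a0 a1 a2 b0 b1 b2 := b0 * (∂1 a2 - ∂2 a1) + b1 * (∂2 a0 - ∂0 a2) + b2 * (∂0 a1 - ∂1 a0) in
  schouten (mk8 f a0 a1 a2 b0 b1 b2 t : GG K) (mk8 g c0 c1 c2 d0 d1 d2 s : GG K) =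
  mk8 (along a0 a1 a2 g - along c0 c1 c2 f)
   (along a0 a1 a2 c0 - along c0 c1 c2 a0 + (∂1 g * b2 - ∂2 g * b1) + (∂1 f * d2 - ∂2 f * d1))
   (along a0 a1 a2 c1 - along c0 c1 c2 a1 + (∂2 g * b0 - ∂0 g * b2) + (∂2 f * d0 - ∂0 f * d2))
   (along a0 a1 a2 c2 - along c0 c1 c2 a2 + (∂0 g * b1 - ∂1 g * b0) + (∂0 f * d1 - ∂1 f * d0))
   (t * ∂0 g - s * ∂0 f + along a0 a1 a2 d0 - along c0 c1 c2 b0
    + b0 * div c0 c1 c2 - (b0 * ∂0 c0 + b1 * ∂0 c1 + b2 * ∂0 c2)
    - d0 * div a0 a1 a2 + (d0 * ∂0 a0 + d1 * ∂0 a1 + d2 * ∂0 a2))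
   (t * ∂1 g - s * ∂1 f + along a0 a1 a2 d1 - along c0 c1 c2 b1
    + b1 * div c0 c1 c2 - (b0 * ∂1 c0 + b1 * ∂1 c1 + b2 * ∂1 c2)
    - d1 * div a0 a1 a2 + (d0 * ∂1 a0 + d1 * ∂1 a1 + d2 * ∂1 a2))
   (t * ∂2 g - s * ∂2 f + along a0 a1 a2 d2 - along c0 c1 c2 b2
    + b2 * div c0 c1 c2 - (b0 * ∂2 c0 + b1 * ∂2 c1 + b2 * ∂2 c2)
    - d2 * div a0 a1 a2 + (d0 * ∂2 a0 + d1 * ∂2 a1 + d2 * ∂2 a2))
   (along a0 a1 a2 s - s * div a0 a1 a2 - along c0 c1 c2 t + t * div c0 c1 c2
    - curl d0 d1 d2 b0 b1 b2 - curl b0 b1 b2 d0 d1 d2) :> CE.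
Proof.
move=> along div curl; rewrite /schouten.
set F := mk8 f _ _ _ _ _ _ _; set G := mk8 g _ _ _ _ _ _ _.
(* The sign depends on both form degrees, so the sixteen homogeneous pieces are computed separately;
   [T k l] has form degree k + l - 1. *)
pose T (k l : nat) := schouten_hom k l (form_part k F) (form_part l G).
apply: etrans (sum44 T) _.
have T00 : T 0%N 0%N = 0.
  hom_part T along div curl.
have T01 : T 0%N 1%N = mk8 (- along c0 c1 c2 f) 0 0 0 0 0 0 0.
  hom_part T along div curl.
have T02 : T 0%N 2%N = mk8 0 (∂1 f * d2 - ∂2 f * d1) (∂2 f * d0 - ∂0 f * d2) (∂0 f * d1 - ∂1 f * d0) 0 0 0 0.
  hom_part T along div curl.
have T03 : T 0%N 3%N = mk8 0 0 0 0 (- (s * ∂0 f)) (- (s * ∂1 f)) (- (s * ∂2 f)) 0.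
  hom_part T along div curl.
have T10 : T 1%N 0%N = mk8 (along a0 a1 a2 g) 0 0 0 0 0 0 0.
  hom_part T along div curl.
have T11 : T 1%N 1%N = mk8 0 (along a0 a1 a2 c0 - along c0 c1 c2 a0) (along a0 a1 a2 c1 - along c0 c1 c2 a1) (along a0 a1 a2 c2 - along c0 c1 c2 a2) 0 0 0 0.
  hom_part T along div curl.
have T12 : T 1%N 2%N = mk8 0 0 0 0 (along a0 a1 a2 d0 - d0 * div a0 a1 a2 + (d0 * ∂0 a0 + d1 * ∂0 a1 + d2 * ∂0 a2)) (along a0 a1 a2 d1 - d1 * div a0 a1 a2 + (d0 * ∂1 a0 + d1 * ∂1 a1 + d2 * ∂1 a2)) (along a0 a1 a2 d2 - d2 * div a0 a1 a2 + (d0 * ∂2 a0 + d1 * ∂2 a1 + d2 * ∂2 a2)) 0.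
  hom_part T along div curl.
have T13 : T 1%N 3%N = mk8 0 0 0 0 0 0 0 (along a0 a1 a2 s - s * div a0 a1 a2).
  hom_part T along div curl.
have T20 : T 2%N 0%N = mk8 0 (∂1 g * b2 - ∂2 g * b1) (∂2 g * b0 - ∂0 g * b2) (∂0 g * b1 - ∂1 g * b0) 0 0 0 0.
  hom_part T along div curl.
have T21 : T 2%N 1%N = mk8 0 0 0 0 (- along c0 c1 c2 b0 + b0 * div c0 c1 c2 - (b0 * ∂0 c0 + b1 * ∂0 c1 + b2 * ∂0 c2)) (- along c0 c1 c2 b1 + b1 * div c0 c1 c2 - (b0 * ∂1 c0 + b1 * ∂1 c1 + b2 * ∂1 c2)) (- along c0 c1 c2 b2 + b2 * div c0 c1 c2 - (b0 * ∂2 c0 + b1 * ∂2 c1 + b2 * ∂2 c2)) 0.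
  hom_part T along div curl.
have T22 : T 2%N 2%N = mk8 0 0 0 0 0 0 0 (- curl d0 d1 d2 b0 b1 b2 - curl b0 b1 b2 d0 d1 d2).
  hom_part T along div curl.
have T23 : T 2%N 3%N = 0.
  hom_part T along div curl.
have T30 : T 3%N 0%N = mk8 0 0 0 0 (t * ∂0 g) (t * ∂1 g) (t * ∂2 g) 0.
  hom_part T along div curl.
have T31 : T 3%N 1%N = mk8 0 0 0 0 0 0 0 (t * div c0 c1 c2 - along c0 c1 c2 t).
  hom_part T along div curl.
have T32 : T 3%N 2%N = 0.
  hom_part T along div curl.
have T33 : T 3%N 3%N = 0.
  hom_part T along div curl.
rewrite T00 T01 T02 T03 T10 T11 T12 T13 T20 T21 T22 T23 T30 T31 T32 T33 !addr0 !add0r !mk8D /along /div /curl.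
congr mk8; ring.
Qed.
End FormCoordinates.

(** * The elements π, E, Ω and q in coordinates *)

Section SpecialElements.
Import ssrcomplements mpoly.
Variable K : fieldType.
Hypothesis K0 : forall n, n.+1%:R != 0 :> K.
Local Notation Sg := {mpoly K[3]}.
Local Notation x0 := ('X_o0 : Sg).
Local Notation x1 := ('X_o1 : Sg).
Local Notation x2 := ('X_o2 : Sg).

Lemma addO : (o0 + 1 = o1 :> 'I_3) * (o0 + 2 = o2 :> 'I_3) * (o1 + 1 = o2 :> 'I_3)
  * (o1 + 2 = o0 :> 'I_3) * (o2 + 1 = o0 :> 'I_3) * (o2 + 2 = o1 :> 'I_3).
Proof. by do !split; apply: val_inj. Qed.

Lemma so3_c0 j k :
  so3_c K o0 j k = (o1 == j)%:R * (o2 == k)%:R - (o2 == j)%:R * (o1 == k)%:R.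
Proof. by rewrite /so3_c !mxE !addO. Qed.
Lemma so3_c1 j k :
  so3_c K o1 j k = (o2 == j)%:R * (o0 == k)%:R - (o0 == j)%:R * (o2 == k)%:R.
Proof. by rewrite /so3_c !mxE !addO. Qed.
Lemma so3_c2 j k :
  so3_c K o2 j k = (o0 == j)%:R * (o1 == k)%:R - (o1 == j)%:R * (o0 == k)%:R.
Proof. by rewrite /so3_c !mxE !addO. Qed.

Lemma killing_e i v : killing (e_ K i) v = -2 * v 0 i.
Proof.
rewrite /killing /mxtrace sum3 !mxE !sum3 !mxE !addO.
by elim/ord3P: i => /=; rewrite ?(mulr0, mul0r, mulr1, mul1r); ring.
Qed.

Lemma bset_eq a b c a' b' c' :
  (bset a b c == bset a' b' c') = [&& a == a', b == b' & c == c'].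
Proof.
apply/eqP/and3P => [/setP e|[/eqP-> /eqP-> /eqP->] //].
by have := (e o0, e o1, e o2); rewrite !in_bset /= => -[[-> ->] ->]; rewrite !eqxx.
Qed.

Lemma epsE : (eps K o0 = mk8 0 1 0 0 0 0 0 0) * (eps K o1 = mk8 0 0 1 0 0 0 0 0)
  * (eps K o2 = mk8 0 0 0 1 0 0 0 0).
Proof.
have b i : [set i] = bset (i == o0) (i == o1) (i == o2).
  by apply/setP; apply: ord3P; rewrite !inE /= eq_sym.
by do !split; apply/ffunP; apply: set3_ind => a b' c; rewrite mk8E ffunE b
  bset_eq /=; case: a b' c => [] [] []; rewrite ?oppr0.
Qed.

Lemma eqO : ((o0 == o1) = false) * ((o0 == o2) = false) * ((o1 == o0) = false)
  * ((o1 == o2) = false) * ((o2 == o0) = false) * ((o2 == o1) = false)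
  * ((o0 == o0) = true) * ((o1 == o1) = true) * ((o2 == o2) = true).
Proof. by []. Qed.

Let simp01 := (mulr1n, mulr0n, oppr0, mulr0, mul0r, mulr1, subr0, sub0r, scale0r, addr0, add0r).

Lemma structure_form0 (T : 'I_3 -> 'I_3 -> {ffun {set 'I_3} -> Sg}) :
  \sum_j \sum_k so3_c K o0 j k *: T j k = T o1 o2 - T o2 o1.
Proof.
rewrite !sum3 !so3_c0 !eqO !simp01.
by rewrite scale1r scaleN1r.
Qed.
Lemma structure_form1 (T : 'I_3 -> 'I_3 -> {ffun {set 'I_3} -> Sg}) :
  \sum_j \sum_k so3_c K o1 j k *: T j k = T o2 o0 - T o0 o2.
Proof.
rewrite !sum3 !so3_c1 !eqO !simp01.
by rewrite scale1r scaleN1r addrC.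
Qed.
Lemma structure_form2 (T : 'I_3 -> 'I_3 -> {ffun {set 'I_3} -> Sg}) :
  \sum_j \sum_k so3_c K o2 j k *: T j k = T o0 o1 - T o1 o0.
Proof.
rewrite !sum3 !so3_c2 !eqO !simp01.
by rewrite scale1r scaleN1r.
Qed.

Lemma pi_mk8 : pi_g K = mk8 0 0 0 0 x0 x1 x2 0.
Proof.
rewrite /pi_g sum3 structure_form0 structure_form1 structure_form2.
rewrite !epsE !wedge_mk8 !smulf_mk8 -!scaleN1r !mk8Z !mk8D mk8Z.
have K2 : (2 : K) != 0 by exact: (K0 1).
have h (x : Sg) : 2^-1 *: (x + x) = x.
  by rewrite -mulr2n -scaler_nat scalerA mulVf ?scale1r.
by congr mk8; rewrite -[RHS]h; congr (_ *: _); rewrite !scaleN1r; ring.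
Qed.

Lemma Euler_mk8 : Euler K = mk8 0 x0 x1 x2 0 0 0 0.
Proof.
rewrite /Euler sum3 !epsE !smulf_mk8 !mk8D.
by rewrite !(mulr0, mulr1, addr0, add0r).
Qed.

Lemma one_mk8 : CE_one K = mk8 1 0 0 0 0 0 0 0.
Proof.
have b : set0 = bset false false false by apply/setP; apply: ord3P; rewrite !inE.
apply/ffunP; apply: set3_ind => a b' c; rewrite mk8E ffunE b bset_eq.
by case: a b' c => [] [] []; rewrite ?oppr0.
Qed.

Lemma Omega_mk8 : Omega K = mk8 0 0 0 0 0 0 0 (- 2%:R).
Proof.
have K6 : (6 : K) != 0 by exact: (K0 5).
have e i j k : killing (e_ K i) (so3_br (e_ K j) (e_ K k)) = -2 * so3_c K i j k.
  exact: killing_e.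
rewrite /Omega; under eq_bigr => i _ do under eq_bigr => j _ do
  under eq_bigr => k _ do rewrite e -scalerA.
under eq_bigr => i _ do under eq_bigr => j _ do rewrite -scaler_sumr.
under eq_bigr => i _ do rewrite -scaler_sumr.
rewrite -scaler_sumr sum3 !structure_form0 structure_form1 structure_form2.
rewrite !epsE !wedge_mk8 -!scaleN1r !mk8Z !mk8D !mk8Z.
have h (x : Sg) : x = 6^-1 *: (6%:R * x).
  by rewrite mulr_natl -scaler_nat scalerA mulVf ?scale1r.
congr mk8; rewrite [RHS]h; congr (_ *: _); rewrite !scaleN1r scaleNr scaler_nat; ring.
Qed.

Lemma q_E : q_ K = - 2^-1 *: (x0 * x0 + x1 * x1 + x2 * x2).
Proof.
rewrite /q_ (_ : killing_mx K = (-2)%:M); last first.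
  by apply/matrixP => i j; rewrite !mxE killing_e !mxE eqxx /= mulr_natr.
rewrite invmx_scalar !sum3 !mxE /= !(mulr1n, mulr0n, scale0r, addr0, add0r).
by rewrite -!scalerDr invrN.
Qed.

End SpecialElements.

(** * Angular momentum *)

Module Rotation.
Import ssrcomplements mpoly.

(** The components of ∇f × x. With this sign they satisfy the relations of the basis e_i
    ([ang_comm]) and are the components of the differential of f ([delta_mk8]). The lock lets [ring]
    treat them as atoms. *)
HB.lock Definition ang (K : fieldType) (j : 'I_3) (f : mpoly 3 K) : mpoly 3 K :=
  match nat_of_ord j with
  | 0 => f^`M(o1) * 'X_o2 - f^`M(o2) * 'X_o1
  | 1 => f^`M(o2) * 'X_o0 - f^`M(o0) * 'X_o2
  | _ => f^`M(o0) * 'X_o1 - f^`M(o1) * 'X_o0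
  end.

End Rotation.
Import Rotation.

Section AngularMomentum.
Import ssrcomplements mpoly.
Variable K : fieldType.
Hypothesis K0 : forall n, n.+1%:R != 0 :> K.
Local Notation Sg := {mpoly K[3]}.
Local Notation x0 := ('X_o0 : Sg).
Local Notation x1 := ('X_o1 : Sg).
Local Notation x2 := ('X_o2 : Sg).
Local Notation "'∂0' f" := (f^`M(o0)) (at level 8, f at level 8, format "'∂0' f").
Local Notation "'∂1' f" := (f^`M(o1)) (at level 8, f at level 8, format "'∂1' f").
Local Notation "'∂2' f" := (f^`M(o2)) (at level 8, f at level 8, format "'∂2' f").
Implicit Types (f g : Sg) (p : {poly K}).

Definition casimir f : Sg :=
  ang o0 (ang o0 f) + ang o1 (ang o1 f) + ang o2 (ang o2 f).

Definition lapl f : Sg := ∂0 (∂0 f) + ∂1 (∂1 f) + ∂2 (∂2 f).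
Definition eul f : Sg := x0 * ∂0 f + x1 * ∂1 f + x2 * ∂2 f.
Definition r2 : Sg := x0 * x0 + x1 * x1 + x2 * x2.

Lemma mderivXU (i j : 'I_3) : ('X_j : Sg)^`M(i) = (i == j)%:R.
Proof.
rewrite mderivX mnm1E eq_sym; have [->|_] := eqVneq j i; last by rewrite scale0r.
rewrite (_ : (U_(i) - U_(i))%MM = 0%MM) ?mpolyX0 ?scale1r //.
by apply/mnmP => k; rewrite mnmBE subnn mnm0E.
Qed.

Lemma eqO' : ((o0 == o1) = false) * ((o0 == o2) = false) * ((o1 == o0) = false)
  * ((o1 == o2) = false) * ((o2 == o0) = false) * ((o2 == o1) = false)
  * ((o0 == o0) = true) * ((o1 == o1) = true) * ((o2 == o2) = true).
Proof. by []. Qed.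

Lemma mderiv_sort f : (∂0 (∂1 f) = ∂1 (∂0 f)) * (∂0 (∂2 f) = ∂2 (∂0 f))
  * (∂1 (∂2 f) = ∂2 (∂1 f)).
Proof. by do !split; rewrite mderiv_comm. Qed.

Lemma mderiv1 (i : 'I_3) : (1 : Sg)^`M(i) = 0.
Proof. by rewrite -mpolyC1 mderivC. Qed.

Definition mderE := (mderiv0, mderiv1, mderivB, mderivD, mderivN, mderivM, mderivXU, mderivZ,
  eqO', mulr1n, mulr0n, mderiv_sort).

(** The classical formula L · L = r² Δ - E (E + 1), with E the Euler operator. It relates the
    Casimir operator to the degree and to the degree-lowering Δ, which makes inductions possible. *)
Lemma casimirE f : casimir f = r2 * lapl f - eul (eul f) - eul f.
Proof.
by rewrite /casimir /r2 /lapl /eul ang.unlock /= !mderE; ring.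
Qed.

Lemma ang_linear j : linear (@ang K j).
Proof.
by elim/ord3P: j => c f g; rewrite ang.unlock /= !mderE -!mul_mpolyC; ring.
Qed.

Lemma ang_comm f : [/\ ang o0 (ang o1 f) - ang o1 (ang o0 f) = ang o2 f,
  ang o1 (ang o2 f) - ang o2 (ang o1 f) = ang o0 f
  & ang o2 (ang o0 f) - ang o0 (ang o2 f) = ang o1 f].
Proof. by split; rewrite ang.unlock /= !mderE; ring. Qed.

Lemma ang_lapl j f : ang j (lapl f) = lapl (ang j f).
Proof. elim/ord3P: j; rewrite /lapl ang.unlock /= !(mderivM, mderivD, mderivN);
  by rewrite !mderivXU !eqO' ?mulr1n ?mulr0n !mderiv_sort ?mderiv1 ?mderiv0; ring. Qed.

Lemma ang_comm_casimir j f : casimir (ang j f) = ang j (casimir f).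
Proof.
have aB i := linearBf (@ang_linear i); have aD i := linearDf (@ang_linear i).
(* The commutation relations solved for every order of two factors, so that [ang j] can be moved to
   the front past two operators. *)
have C (h : Sg) : (ang o1 (ang o0 h) = ang o0 (ang o1 h) - ang o2 h)
  * (ang o2 (ang o0 h) = ang o0 (ang o2 h) + ang o1 h)
  * (ang o2 (ang o1 h) = ang o1 (ang o2 h) - ang o0 h)
  * (ang o0 (ang o1 h) = ang o1 (ang o0 h) + ang o2 h)
  * (ang o0 (ang o2 h) = ang o2 (ang o0 h) - ang o1 h)
  * (ang o1 (ang o2 h) = ang o2 (ang o1 h) + ang o0 h).
  have r1 (x y z : Sg) : x - y = z -> x = y + z by move<-; rewrite addrC subrK.
  have r2 (x y z : Sg) : x - y = z -> y = x - z by move<-; rewrite opprB addrC subrK.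
  have [e1 e2 e3] := ang_comm h.
  by do !split; [exact: r2 e1|exact: r1 e3|exact: r2 e2|exact: r1 e1|exact: r2 e3|exact: r1 e2].
rewrite /casimir; elim/ord3P: j; rewrite !aD.
- by rewrite [ang o1 (ang o0 f)]C [ang o2 (ang o0 f)]C aB aD
    [ang o1 (ang o0 _)]C [ang o2 (ang o0 _)]C [ang o2 (ang o1 f)]C; ring.
- by rewrite [ang o0 (ang o1 f)]C [ang o2 (ang o1 f)]C aB aD
    [ang o0 (ang o1 _)]C [ang o2 (ang o1 _)]C [ang o2 (ang o0 f)]C; ring.
by rewrite [ang o0 (ang o2 f)]C [ang o1 (ang o2 f)]C aB aD
  [ang o0 (ang o2 _)]C [ang o1 (ang o2 _)]C [ang o1 (ang o0 f)]C; ring.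
Qed.

Lemma CqM p q : Cq (p * q) = Cq p * Cq q. Proof. exact: rmorphM. Qed.
Lemma CqD p q : Cq (p + q) = Cq p + Cq q. Proof. exact: rmorphD. Qed.
Lemma CqN p : Cq (- p) = - Cq p. Proof. exact: rmorphN. Qed.
Lemma CqZ c p : Cq (c *: p) = c *: Cq p.
Proof. by rewrite /Cq -mul_polyC rmorphM /= horner_algC mulr_algl. Qed.
Lemma Cq0 : Cq (0 : {poly K}) = 0. Proof. exact: rmorph0. Qed.
Lemma Cq1 : Cq (1 : {poly K}) = 1. Proof. exact: rmorph1. Qed.
Lemma CqX : Cq ('X : {poly K}) = q_ K. Proof. exact: horner_algX. Qed.
Lemma CqC c : Cq (c%:P : {poly K}) = c%:MP.
Proof. by rewrite /Cq horner_algC -mul_mpolyC mulr1. Qed.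

Lemma r2E : r2 = Cq (-2 *: 'X : {poly K}).
Proof.
by rewrite CqZ CqX (q_E K) scalerA mulrNN divff // scale1r.
Qed.

Lemma mderiv_q i : (q_ K)^`M(i) = - 'X_i.
Proof.
rewrite (q_E K) mderivZ scaleNr; congr (- _).
have h (x : Sg) : 2^-1 *: (x + x) = x.
  by rewrite -mulr2n -scaler_nat scalerA mulVf ?scale1r.
rewrite -[RHS]h; congr (_ *: _).
by elim/ord3P: i; rewrite !mderE; ring.
Qed.

Lemma mderiv_Cq i p : (Cq p)^`M(i) = - (Cq p^`() * 'X_i).
Proof.
elim/poly_ind: p => [|p c IH].
  by rewrite derivC Cq0 mderiv0 mul0r oppr0.
rewrite CqD CqM CqC CqX mderivD mderivC addr0 mderivM IH mderiv_q.
by rewrite derivD derivC addr0 derivM derivX mulr1 CqD CqM CqX; ring.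
Qed.

Lemma angM j f g : ang j (f * g) = ang j f * g + f * ang j g.
Proof. by elim/ord3P: j; rewrite ang.unlock /= !mderE; ring. Qed.

Lemma ang_Cq j p : ang j (Cq p) = 0.
Proof. by elim/ord3P: j; rewrite ang.unlock /= !mderiv_Cq; ring. Qed.

Lemma ang_CqM j p f : ang j (Cq p * f) = Cq p * ang j f.
Proof. by rewrite angM ang_Cq mul0r add0r. Qed.

Lemma casimir_CqM p f : casimir (Cq p * f) = Cq p * casimir f.
Proof. by rewrite /casimir !ang_CqM !mulrDr. Qed.

Lemma casimir_linear : linear casimir.
Proof.
have l2 j : linear (fun f => ang j (ang j f)).
  by apply: linear_compf; exact: ang_linear.
by apply: linear_addf => //; apply: linear_addf.
Qed.

Lemma lapl_linear : linear lapl.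
Proof. by move=> c f g; rewrite /lapl !mderE !scalerDr; ring. Qed.

Lemma eul_linear : linear eul.
Proof. by move=> c f g; rewrite /eul !mderE -!mul_mpolyC; ring. Qed.

Lemma lapl_Cq p : lapl (Cq p) = - Cq (3%:R *: p^`() + 2%:R *: ('X * p^`()^`())).
Proof.
rewrite /lapl !mderiv_Cq !mderivN !mderivM !mderiv_Cq !mderivXU !eqO' !mulr1n.
rewrite CqD !CqZ CqM CqX (q_E K) -scalerAl scalerA [2%:R * _]mulrN divff // scaleN1r scaler_nat; ring.
Qed.

Lemma eul_Cq p : eul (Cq p) = Cq (2%:R *: ('X * p^`())).
Proof.
rewrite /eul !mderiv_Cq CqZ CqM CqX (q_E K) -scalerAl scalerA [2%:R * _]mulrN divff // scaleN1r; ring.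
Qed.

Lemma mulX_mderivX i m : 'X_i * ('X_[m] : Sg)^`M(i) = (m i)%:R *: 'X_[m].
Proof.
rewrite mderivX -scalerAr -mpolyXD; have [->|mi] := eqVneq (m i) 0%N.
  by rewrite !scale0r.
congr (_ *: 'X_[_]); rewrite addmC submK //.
by apply/mnm_lepP => l; rewrite mnm1E; case: eqP => [<-|//]; rewrite lt0n.
Qed.

Lemma eulX m : eul 'X_[m] = (mdeg m)%:R *: 'X_[m].
Proof.
rewrite /eul !mulX_mderivX -!scalerDl -!natrD; congr (_%:R *: _).
by rewrite mdegE sum3.
Qed.

(** If x_i does not occur in the monomial, the truncated exponent keeps its degree, but then the
    coefficient is 0; hence the disjunction. *)
Lemma mderivX_deg i m n : (mdeg m < n.+1)%N ->
  exists c m', [/\ ('X_[m] : Sg)^`M(i) = c *: 'X_[m'] & c = 0 \/ (mdeg m' < n)%N].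
Proof.
move=> mn; exists (m i)%:R, (m - U_(i))%MM; split; first exact: mderivX.
have [->|mi] := eqVneq (m i) 0%N; [by left|right].
have e : ((m - U_(i)) + U_(i))%MM = m.
  by rewrite submK //; apply/mnm_lepP => l; rewrite mnm1E; case: eqP => [<-|//]; rewrite lt0n.
by move: mn; rewrite -{1}e mdegD mdeg1 addn1 ltnS.
Qed.

Definition decomposable f := exists p g, f = Cq p + casimir g.

Lemma decomposableD f g : decomposable f -> decomposable g -> decomposable (f + g).
Proof.
move=> [p [f' ->]] [q [g' ->]]; exists (p + q), (f' + g').
by rewrite CqD (linearDf casimir_linear) addrACA.
Qed.
Lemma decomposableZ c f : decomposable f -> decomposable (c *: f).
Proof.
move=> [p [f' ->]]; exists (c *: p), (c *: f').
by rewrite CqZ (linearZf _ _ casimir_linear) scalerDr.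
Qed.
Lemma decomposable0 : decomposable 0.
Proof. by exists 0, 0; rewrite Cq0 (linear0f casimir_linear) addr0. Qed.

(** For a monomial of degree d > 0, d (d + 1) times it is r² Δ of it minus its Casimir image. Its
    Laplacian has smaller degree, hence is decomposable by induction, and multiplication by r², an
    element of C[q], commutes with the Casimir operator. *)
Lemma decomposableX m : decomposable 'X_[m].
Proof.
have [n] := ubnP (mdeg m); elim: n {-2}n (leqnn n) m => [|N IH] n nN m mn.
  by move: mn; case: n nN.
have [m0|m0] := eqVneq (mdeg m) 0%N.
  move/eqP: m0; rewrite mdeg_eq0 => /eqP->; exists 1, 0.
  by rewrite (linear0f casimir_linear) Cq1 addr0 mpolyX0.
have D2 i : decomposable ('X_[m]^`M(i)^`M(i)).
  have [|c [m' [-> cm]]] := @mderivX_deg i m N.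
    by apply: leq_trans mn nN.
  case: cm => [->|m'N]; first by rewrite scale0r mderiv0; exact: decomposable0.
  rewrite mderivZ; apply: decomposableZ.
  have [c' [m'' [-> cm]]] := mderivX_deg i (ltnW m'N : (mdeg m' < N.+1)%N).
  case: cm => [->|m''N]; first by rewrite scale0r; exact: decomposable0.
  by apply: decomposableZ; exact: (IH N).
have DL : decomposable (r2 * lapl 'X_[m]).
  have [p [g ->]] : decomposable (lapl 'X_[m]).
    by apply: decomposableD; first apply: decomposableD; exact: D2.
  exists (-2 *: 'X * p), (r2 * g).
  by rewrite mulrDr r2E casimir_CqM CqM.
have e : ((mdeg m) * (mdeg m).+1)%:R *: ('X_[m] : Sg) = r2 * lapl 'X_[m] - casimir 'X_[m].
  rewrite casimirE !eulX (linearZf _ _ eul_linear) eulX scalerA -natrM mulnS natrD scalerDl.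
  by rewrite opprD addrA opprD addrA opprK subrr add0r opprK addrC.
suff : decomposable (((mdeg m) * (mdeg m).+1)%:R^-1 *: (((mdeg m) * (mdeg m).+1)%:R *: 'X_[m])).
  rewrite scalerA mulVf ?scale1r //.
  by case: (mdeg m) m0 => // k _; rewrite mulSn; exact: K0.
rewrite e; apply: decomposableZ; apply: decomposableD => //.
exists 0, (-1 *: 'X_[m]).
by rewrite Cq0 add0r (linearZf _ _ casimir_linear) scaleN1r.
Qed.

Lemma poly_decomposable f : decomposable f.
Proof.
elim/mpolyind: f => [|c m f _ _ IH]; first exact: decomposable0.
by apply: decomposableD => //; apply: decomposableZ; exact: decomposableX.
Qed.

End AngularMomentum.

(** * Kernel and image of the Casimir operator *)

Section RotationInvariants.
Import ssrcomplements mpoly.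
Variable K : fieldType.
Hypothesis K0 : forall n, n.+1%:R != 0 :> K.
Local Notation Sg := {mpoly K[3]}.
Implicit Types (f g : Sg) (p : {poly K}).

Let ev0 f : K := f.@[fun=> 0].

(** Every sum L · g vanishes at the origin, which settles the constant coefficient. Since Δ commutes
    with L and sends p(q) to -(3 p' + 2 q p''), whose k-th coefficient is -(k + 1) (2 k + 3)
    p_(k+1), repeated Laplacians bring every coefficient to the constant position. *)
Lemma ang_Cq_eq0 p (g0 g1 g2 : Sg) :
  Cq p = ang o0 g0 + ang o1 g1 + ang o2 g2 -> p = 0.
Proof.
move=> e; apply/polyP => k; rewrite coef0.
elim: k p g0 g1 g2 e => [|k IH] p g0 g1 g2 e.
  have ev : ev0 (Cq p) = 0.
    rewrite e ang.unlock /= /ev0.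
    by rewrite !(mevalD, mevalN, mevalM, mevalXU) !mulr0 !oppr0 !addr0.
  move: ev; elim/poly_ind: p {e} => [|p c _]; first by rewrite coef0.
  rewrite CqD CqM CqX CqC (q_E K) /ev0 mevalD mevalM mevalZ !mevalD !mevalM !mevalXU mevalC.
  rewrite !mulr0 !addr0 coefD coefMX coefC /= add0r => <-.
  by rewrite !(mulr0, add0r).
pose lap := 3%:R *: p^`() + 2%:R *: ('X * p^`()^`()).
have := IH (- lap) (lapl g0) (lapl g1) (lapl g2).
rewrite CqN -(lapl_Cq K0) e !ang_lapl !(linearDf (@lapl_linear K)) => /(_ erefl) /eqP.
rewrite coefN oppr_eq0 coefD !coefZ coefXM !coef_deriv.
have -> : (if k == 0%N then 0 else p`_k.-1.+2 *+ k.-1.+2 *+ k.-1.+1)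
   = (k.+1 * k)%:R * p`_k.+1.
  by case: k {IH} => [|k] /=; rewrite ?muln0 ?mul0r // -mulrnA mulr_natl.
have -> : 3%:R * (p`_k.+1 *+ k.+1) + 2%:R * ((k.+1 * k)%:R * p`_k.+1)
    = (k.+1 * (2 * k).+3)%:R * p`_k.+1.
  rewrite -mulr_natl; ring.
by rewrite mulf_eq0 mulSn (negbTE (K0 _)) => /eqP.
Qed.

Lemma Cq_inj p q : Cq p = Cq q :> Sg -> p = q.
Proof.
move=> e; apply/eqP; rewrite -subr_eq0; apply/eqP.
apply: (@ang_Cq_eq0 _ 0 0 0); rewrite CqD CqN e subrr.
by rewrite !(linear0f (@ang_linear K _)) !addr0.
Qed.

(** Write the sum as p(q) plus the Casimir image of h. Then p(q) = L · (g - L h), and [ang_Cq_eq0]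
    gives p = 0. *)
Lemma ang_sum_casimir g0 g1 g2 :
  exists h, ang o0 g0 + ang o1 g1 + ang o2 g2 = casimir h.
Proof.
have [p [h e]] := poly_decomposable K0 (ang o0 g0 + ang o1 g1 + ang o2 g2).
exists h; rewrite e; suff -> : p = 0 by rewrite Cq0 add0r.
apply: (@ang_Cq_eq0 _ (g0 - ang o0 h) (g1 - ang o1 h) (g2 - ang o2 h)).
rewrite !(linearBf (@ang_linear K _)); move: e; rewrite /casimir => e.
have -> : Cq p = ang o0 g0 + ang o1 g1 + ang o2 g2
    - (ang o0 (ang o0 h) + ang o1 (ang o1 h) + ang o2 (ang o2 h)).
  by rewrite e addrK.
ring.
Qed.

Lemma lapl_nilpotent f : exists n, iter n (@lapl K) f = 0.
Proof.
have il n : linear (iter n (@lapl K)).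
  by elim: n => [|n IH] c g h //=; rewrite IH lapl_linear.
have wide n k g : (n <= k)%N -> iter n (@lapl K) g = 0 -> iter k (@lapl K) g = 0.
  by move=> /subnK <- e; rewrite iterD e (linear0f (il _)).
elim/mpolyind: f => [|c m f _ _ [n fn]]; first by exists 0%N.
suff [k mk] : exists k, iter k (@lapl K) 'X_[m] = 0.
  exists (maxn k n); rewrite il (wide k) ?leq_maxl // (wide n) ?leq_maxr //.
  by rewrite scaler0 addr0.
suff D k : (mdeg m < k)%N -> iter k (@lapl K) 'X_[m] = 0 by exists (mdeg m).+1; exact: D.
elim/ltn_ind: k m => -[|k] IH m mk //.
rewrite iterSr /lapl !(linearDf (il k)).
suff D i : iter k (@lapl K) ('X_[m]^`M(i)^`M(i)) = 0 by rewrite !D !addr0.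
have [c1 [m1 [-> cm]]] := mderivX_deg K i mk.
case: cm => [->|m1k]; first by rewrite scale0r mderiv0 (linear0f (il k)).
rewrite mderivZ; have [c2 [m2 [-> cm]]] := mderivX_deg K i (ltnW m1k : (mdeg m1 < k.+1)%N).
rewrite !(linearZf _ _ (il k)); case: cm => [->|m2k]; first by rewrite scale0r scaler0.
by rewrite (IH k) ?scaler0.
Qed.

Lemma mcoeff_eul f m : (eul f)@_m = (mdeg m)%:R * f@_m.
Proof.
elim/mpolyind: f => [|c k f _ _ IH].
  by rewrite (linear0f (@eul_linear K)) mcoeff0 mulr0.
rewrite eul_linear mcoeffD [(_ + f)@_m]mcoeffD IH eulX !mcoeffZ mcoeffX mulrDr.
congr (_ + _); have [->|_] := eqVneq k m; last by rewrite !mulr0.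
by rewrite !mulr1 mulrC.
Qed.

(** Induction on the number of Laplacians that kill f. The polynomial Δ f is again in the kernel,
    hence equals p(q), so E (E + 1) f = r² p(q) for the Euler operator E. An explicit s(q) solves
    the same equation, and the difference is killed by E (E + 1), hence constant. *)
Lemma casimir_eq0 f : casimir f = 0 -> exists p, f = Cq p.
Proof.
have [n fn] := lapl_nilpotent f; elim: n f fn => [|n IH] f fn cf.
  by exists 0; rewrite Cq0 -fn.
have cl g : casimir (lapl g) = lapl (casimir g).
  by rewrite /casimir !ang_lapl !(linearDf (@lapl_linear K)).
have [p lp] : exists p, lapl f = Cq p.
  by apply: IH; [rewrite -iterSr|rewrite cl cf (linear0f (@lapl_linear K))].
(* The power q^(k+1) is homogeneous of degree 2 (k + 1), so E (E + 1) multiplies it by the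
   denominator; the factor -2 comes from r² = -2 q. *)
pose s := \poly_(k < (size p).+1)
  (if k is k'.+1 then - 2%:R * p`_k' / (2 * k * (2 * k).+1)%:R else 0).
have sE k : s`_k.+1 = - 2%:R * p`_k / (2 * k.+1 * (2 * k.+1).+1)%:R.
  rewrite coef_poly ltnS; case: ltnP => // pk.
  by rewrite nth_default // mulr0 mul0r.
have s0 : s`_0 = 0 by rewrite coef_poly.
have eE : eul (eul f) + eul f = eul (eul (Cq s)) + eul (Cq s).
  have -> : eul (eul f) + eul f = r2 K * lapl f.
    by move/eqP: cf; rewrite casimirE -addrA -opprD subr_eq0 => /eqP.
  rewrite lp (r2E K0) -CqM !(eul_Cq K0) -CqD; congr Cq; apply/polyP => k.
  rewrite coefD !coefZ -scalerAl coefZ !coefXM; case: k => [|k] /=; first by rewrite !mulr0 addr0.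
  rewrite !(coef_deriv, coefZ, coefXM) /=.
  transitivity ((2 * k.+1 * (2 * k.+1).+1)%:R * s`_k.+1); last first.
    rewrite -[s`_k.+1 *+ _]mulr_natl -[(2%:R * _) *+ _]mulr_natl.
    rewrite -[(2 * k.+1).+1]addn1 natrM natrD !natrM.
    by move: (k.+1%:R : K) (s`_k.+1) => a b; ring.
  rewrite sE [RHS]mulrC divfK //.
  by rewrite mulnC mulSn -mulnA mulSn; exact: K0.
pose h := f - Cq s; have hE : eul (eul h) + eul h = 0.
  rewrite /h !(linearBf (@eul_linear K)); move/eqP: eE; rewrite -subr_eq0 => /eqP <-; ring.
have hc : h = (h@_0%MM)%:MP.
  apply/mpolyP => m; rewrite mcoeffC; have [->|m0] := eqVneq m 0%MM.
    by rewrite mulr1.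
  rewrite mulr0.
  have /(congr1 (mcoeff m)) := hE; rewrite mcoeffD !mcoeff_eul mcoeff0 => /eqP.
  rewrite mulrA -mulrDl mulf_eq0 -natrM -natrD => /orP[|/eqP //].
  case: (mdeg m) (mdeg_eq0 m) => [|k _]; first by rewrite eqxx (negbTE m0).
  by rewrite addnS (negbTE (K0 _)).
exists (s + (h@_0%MM)%:P); rewrite CqD CqC -hc /h; ring.
Qed.

End RotationInvariants.

(** * Cohomology of the Chevalley-Eilenberg complex *)

Section Cohomology.
Import ssrcomplements mpoly.
Variable K : fieldType.
Hypothesis K0 : forall n, n.+1%:R != 0 :> K.
Local Notation Sg := {mpoly K[3]}.
Local Notation x0 := ('X_o0 : Sg).
Local Notation x1 := ('X_o1 : Sg).
Local Notation x2 := ('X_o2 : Sg).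
Local Notation "'∂0' f" := (f^`M(o0)) (at level 8, f at level 8, format "'∂0' f").
Local Notation "'∂1' f" := (f^`M(o1)) (at level 8, f at level 8, format "'∂1' f").
Local Notation "'∂2' f" := (f^`M(o2)) (at level 8, f at level 8, format "'∂2' f").
Implicit Types (f g : Sg) (p : {poly K}).

Let K2 : (2 : K) != 0. Proof. exact: (K0 1). Qed.

Local Notation CE := {ffun {set 'I_3} -> Sg}.
Local Notation L0 := (@ang K o0).
Local Notation L1 := (@ang K o1).
Local Notation L2 := (@ang K o2).

Lemma delta_mk8 f a0 a1 a2 b0 b1 b2 t :
  delta_g (mk8 f a0 a1 a2 b0 b1 b2 t : GG K) =
  mk8 0 (L0 f) (L1 f) (L2 f) (L1 a2 - L2 a1 - a0) (L2 a0 - L0 a2 - a1) (L0 a1 - L1 a0 - a2)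
    (L0 b0 + L1 b1 + L2 b2) :> CE.
Proof.
rewrite /delta_g (pi_mk8 K0) schouten_mk8 ang.unlock /=.
by congr mk8; rewrite ?mderE; ring.
Qed.

Lemma ang_dot_x f : L0 f * x0 + L1 f * x1 + L2 f * x2 = 0.
Proof. by rewrite ang.unlock /=; ring. Qed.

(** Product rule for x · (L × V). The derivatives of the coordinates contribute 2 V · x, of which
    the term -V of the differential removes one half. *)
Lemma ang_x_dot (V0 V1 V2 : Sg) :
  x0 * (L1 V2 - L2 V1 - V0) + x1 * (L2 V0 - L0 V2 - V1) + x2 * (L0 V1 - L1 V0 - V2) =
  L0 (V1 * x2 - V2 * x1) + L1 (V2 * x0 - V0 * x2) + L2 (V0 * x1 - V1 * x0)
  + (V0 * x0 + V1 * x1 + V2 * x2).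
Proof. by rewrite ang.unlock /= !mderE; ring. Qed.

(** The analogue of curl curl = grad div - Laplacian; the subtracted [d0], [d1], [d2] absorb the
    commutators of L. *)
Lemma cross_cross (c0 c1 c2 : Sg) :
  let d0 := L1 c2 - L2 c1 in let d1 := L2 c0 - L0 c2 in let d2 := L0 c1 - L1 c0 in
  let e := L0 c0 + L1 c1 + L2 c2 in
  [/\ L1 d2 - L2 d1 - d0 = L0 e - casimir c0,
      L2 d0 - L0 d2 - d1 = L1 e - casimir c1
    & L0 d1 - L1 d0 - d2 = L2 e - casimir c2].
Proof.
have aB i := linearBf (@ang_linear K i); have aD i := linearDf (@ang_linear K i).
have r1 (x y z : Sg) : x - y = z -> x = y + z by move<-; rewrite addrC subrK.
move=> d0 d1 d2 e; rewrite /casimir /d0 /d1 /d2 /e !aB !aD.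
have [A1 A2 A3] := ang_comm c0; have [B1 B2 B3] := ang_comm c1.
have [C1 C2 C3] := ang_comm c2.
split.
- by rewrite -B1 -C3; ring.
- by rewrite -A1 -C2; ring.
by rewrite -A3 -B2; ring.
Qed.

Lemma delta_sq_form0 f : [/\ L1 (L2 f) - L2 (L1 f) - L0 f = 0,
  L2 (L0 f) - L0 (L2 f) - L1 f = 0 & L0 (L1 f) - L1 (L0 f) - L2 f = 0].
Proof. by have [-> -> ->] := ang_comm f; rewrite !subrr. Qed.

Lemma cocycle0 f : L0 f = 0 -> L1 f = 0 -> L2 f = 0 -> exists p, f = Cq p.
Proof.
move=> f0 f1 f2; apply: (casimir_eq0 K0).
by rewrite /casimir f0 f1 f2 !(linear0f (@ang_linear K _)) !addr0.
Qed.

(** A cocycle satisfies L × c = c, so by [cross_cross] the Casimir image of c is L (L · c). If L · c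
    is the Casimir image of h, then each component of c - L h lies in the kernel of the Casimir
    operator, hence in C[q], and is killed by L. But c - L h equals L × (c - L h), so it is 0. *)
Lemma cocycle1 (c0 c1 c2 : Sg) : L1 c2 - L2 c1 - c0 = 0 -> L2 c0 - L0 c2 - c1 = 0 ->
  L0 c1 - L1 c0 - c2 = 0 -> exists h, [/\ c0 = L0 h, c1 = L1 h & c2 = L2 h].
Proof.
have aB i := linearBf (@ang_linear K i); have a0 i := linear0f (@ang_linear K i).
have cB := linearBf (@casimir_linear K).
move=> e0 e1 e2; have [h hE] := ang_sum_casimir K0 c0 c1 c2; exists h.
have [] := cross_cross c0 c1 c2.
have z (x y : Sg) : x - y = 0 -> x = y by move/eqP; rewrite subr_eq0 => /eqP.
rewrite (z _ _ e0) (z _ _ e1) (z _ _ e2) e0 e1 subrr hE.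
have cL (c : Sg) i : 0 = ang i (casimir h) - casimir c -> exists p, c - ang i h = Cq p.
  move/esym/z => e; apply: (casimir_eq0 K0).
  by rewrite cB ang_comm_casimir e subrr.
move=> /cL[p0 P0] /cL[p1 P1] /cL[p2 P2].
have [h0 h1 h2] := delta_sq_form0 h.
have k (x y w u v t q0 q1 q2 : Sg) : x - y - w = 0 -> u - v - t = 0 ->
    x - u = 0 -> y - v = 0 -> w - t = 0.
  move=> E1 E2 E3 E4; have -> : w - t = (x - u) - (y - v) - ((x - y - w) - (u - v - t)) by ring.
  by rewrite E1 E2 E3 E4; ring.
have D (c : Sg) i j p : c - ang i h = Cq p -> ang j c - ang j (ang i h) = 0.
  by move=> e; rewrite -aB e (ang_Cq K0).
have K0' := D _ _ _ _ P0; have K1' := D _ _ _ _ P1; have K2' := D _ _ _ _ P2.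
split; apply: z.
- exact: (k _ _ _ _ _ _ 0 0 0 e0 h0 (K2' o1) (K1' o2)).
- exact: (k _ _ _ _ _ _ 0 0 0 e1 h1 (K0' o2) (K2' o0)).
exact: (k _ _ _ _ _ _ 0 0 0 e2 h2 (K1' o0) (K0' o1)).
Qed.

(** Each component of L × d is the Casimir image of some u_i. With [cross_cross] the Casimir
    operator kills d + (L × u - u), whose components p_i therefore lie in C[q]. As L × p = 0, the
    vector -u - p is a preimage of d. *)
Lemma cocycle2 (d0 d1 d2 : Sg) : L0 d0 + L1 d1 + L2 d2 = 0 ->
  exists u0 u1 u2, [/\ d0 = L1 u2 - L2 u1 - u0, d1 = L2 u0 - L0 u2 - u1
                     & d2 = L0 u1 - L1 u0 - u2].
Proof.
have aB i := linearBf (@ang_linear K i); have a0 i := linear0f (@ang_linear K i).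
have aD i := linearDf (@ang_linear K i).
have cD := linearDf (@casimir_linear K); have cB := linearBf (@casimir_linear K).
have aN i (f : Sg) : ang i (- f) = - ang i f.
  by rewrite -sub0r aB a0 sub0r.
move=> e; have [] := cross_cross d0 d1 d2; rewrite e !a0 !sub0r.
have [u0 U0] : exists u, L1 d2 - L2 d1 = casimir u.
  have [u U] := ang_sum_casimir K0 0 d2 (- d1); exists u.
  by rewrite -U a0 add0r aN.
have [u1 U1] : exists u, L2 d0 - L0 d2 = casimir u.
  have [u U] := ang_sum_casimir K0 (- d2) 0 d0; exists u.
  by rewrite -U a0 addr0 aN addrC.
have [u2 U2] : exists u, L0 d1 - L1 d0 = casimir u.
  have [u U] := ang_sum_casimir K0 d1 (- d0) 0; exists u.
  by rewrite -U a0 addr0 aN.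
rewrite U0 U1 U2 -!ang_comm_casimir -!cB.
have n (x y : Sg) : casimir x = - casimir y -> exists p, x + y = Cq p.
  by move=> E; apply: (casimir_eq0 K0); rewrite cD E addrC subrr.
move=> /n[p0 P0] /n[p1 P1] /n[p2 P2].
exists (- u0 - Cq p0), (- u1 - Cq p1), (- u2 - Cq p2).
rewrite !aB !aN !(ang_Cq K0) -P0 -P1 -P2; split; ring.
Qed.

Lemma cocycleP (F : GG K) : delta_g F = 0 -> exists p r (G : GG K),
  F = smulf (Cq p) (CE_one K) + smulf (Cq r) (Omega K) + delta_g G.
Proof.
have [f [a0 [a1 [a2 [b0 [b1 [b2 [t ->]]]]]]]] := mk8_exists F.
rewrite delta_mk8 mk8_0 => /mk8_inj[_ [f0 f1 f2] [e0 e1 e2] e3].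
have [p ->] := cocycle0 f0 f1 f2.
have [h [-> -> ->]] := cocycle1 e0 e1 e2.
have [u0 [u1 [u2 [-> -> ->]]]] := cocycle2 e3.
have [r [g ->]] := poly_decomposable K0 t.
(* Primitives of the parts of form degree 1, 2 and 3 are h, u and L g. The factor compensates the
   coefficient -2 of [Omega]. *)
exists p, (- 2^-1 *: r), (mk8 h u0 u1 u2 (L0 g) (L1 g) (L2 g) 0).
rewrite delta_mk8 one_mk8 (Omega_mk8 K0) !smulf_mk8 !mk8D CqZ.
have e : - 2^-1 *: Cq r * - (2%:R) = Cq r :> Sg.
  by rewrite mulrN -mulNr scaleNr opprK -scalerAl mulr_natr -scaler_nat scalerA mulVf ?scale1r.
by rewrite e !mulr0 mulr1 !add0r !addr0.
Qed.

Lemma harmonic_coboundary p r (G : GG K) :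
  smulf (Cq p) (CE_one K) + smulf (Cq r) (Omega K) = delta_g G -> p = 0 /\ r = 0.
Proof.
have [f [a0 [a1 [a2 [b0 [b1 [b2 [t ->]]]]]]]] := mk8_exists G.
rewrite delta_mk8 one_mk8 (Omega_mk8 K0) !smulf_mk8 !mk8D => /mk8_inj[P _ _ T].
split.
  apply: (Cq_inj K0); rewrite Cq0 -P; ring.
suff /eqP : -2 *: r = 0 by rewrite scaler_eq0 oppr_eq0 (negbTE K2) /= => /eqP.
apply: (ang_Cq_eq0 K0 (g0 := b0) (g1 := b1) (g2 := b2)).
by rewrite -T CqZ scaleNr scaler_nat; ring.
Qed.

(** The bracket of the exact 1-form L h with the 3-form s is the coboundary of the bracket of h with
    s. *)
Lemma form3_13 h s :
  L0 h * ∂0 s + L1 h * ∂1 s + L2 h * ∂2 s - s * (∂0 (L0 h) + ∂1 (L1 h) + ∂2 (L2 h))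
  = - (L0 (s * ∂0 h) + L1 (s * ∂1 h) + L2 (s * ∂2 h)).
Proof. by rewrite ang.unlock /= !mderE; ring. Qed.

Let curl (a0 a1 a2 b0 b1 b2 : Sg) : Sg :=
  b0 * (∂1 a2 - ∂2 a1) + b1 * (∂2 a0 - ∂0 a2) + b2 * (∂0 a1 - ∂1 a0).

(** For v = δ u and d closed, [v, d] = δ [u, d]; the witnesses are the components of [u, d]. *)
Lemma form3_22 (u0 u1 u2 d0 d1 d2 : Sg) : L0 d0 + L1 d1 + L2 d2 = 0 ->
  let v0 := L1 u2 - L2 u1 - u0 in let v1 := L2 u0 - L0 u2 - u1 in
  let v2 := L0 u1 - L1 u0 - u2 in
  exists w0 w1 w2, - curl d0 d1 d2 v0 v1 v2 - curl v0 v1 v2 d0 d1 d2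
    = L0 w0 + L1 w1 + L2 w2.
Proof.
move=> e v0 v1 v2; pose div := ∂0 u0 + ∂1 u1 + ∂2 u2.
pose along f := u0 * ∂0 f + u1 * ∂1 f + u2 * ∂2 f.
exists (along d0 - d0 * div + (d0 * ∂0 u0 + d1 * ∂0 u1 + d2 * ∂0 u2)).
exists (along d1 - d1 * div + (d0 * ∂1 u0 + d1 * ∂1 u1 + d2 * ∂1 u2)).
exists (along d2 - d2 * div + (d0 * ∂2 u0 + d1 * ∂2 u1 + d2 * ∂2 u2)).
(* This is the vanishing term [u, δ d]. Subtracting it in expanded form gives an identity valid for
   all d. *)
have z : along (L0 d0 + L1 d1 + L2 d2) - (L0 d0 + L1 d1 + L2 d2) * div = 0.
  by rewrite e /along !mderiv0 !mulr0 mul0r !addr0 subr0.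
rewrite -[RHS]subr0 -[X in _ = _ - X]z.
rewrite /curl /along /div /v0 /v1 /v2 ang.unlock /= !(mderivM, mderivD, mderivN).
rewrite !mderivXU !eqO' ?mulr1n ?mulr0n !mderiv_sort ?mderiv1 ?mderiv0; ring.
Qed.

(** By [cocycleP] a closed bracket is P(q) 1 + r(q) Ω up to a coboundary. Its function part is a
    combination of x · L k and x · L h, hence 0; its 3-form part lies in the image of L · by
    [form3_13] and [form3_22], which forces r = 0. *)
Lemma schouten_cocycles (F F' : GG K) : delta_g F = 0 -> delta_g F' = 0 ->
  delta_g (schouten F F') = 0 -> exists G, schouten F F' = delta_g G.
Proof.
have [f [a0 [a1 [a2 [b0 [b1 [b2 [t ->]]]]]]]] := mk8_exists F.
have [g [c0 [c1 [c2 [d0 [d1 [d2 [s ->]]]]]]]] := mk8_exists F'.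
rewrite !delta_mk8 mk8_0.
move=> /mk8_inj[_ [f0 f1 f2] [e0 e1 e2] e3] /mk8_inj[_ [g0 g1 g2] [h0 h1 h2] h3].
have [p ->] := cocycle0 f0 f1 f2; have [q ->] := cocycle0 g0 g1 g2.
have [h [-> -> ->]] := cocycle1 e0 e1 e2; have [k [-> -> ->]] := cocycle1 h0 h1 h2.
have [u0 [u1 [u2 [-> -> ->]]]] := cocycle2 e3.
rewrite -mk8_0 => /cocycleP[P [r [G e]]]; exists G; rewrite e; move: e.
have [f' [a0' [a1' [a2' [b0' [b1' [b2' [t' ->]]]]]]]] := mk8_exists G.
rewrite schouten_mk8 delta_mk8 one_mk8 (Omega_mk8 K0) !smulf_mk8 !mk8D.
move=> /mk8_inj[E _ _ T].
have P0 : P = 0.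
  apply: (Cq_inj K0); rewrite Cq0.
  transitivity (Cq P * 1 + Cq r * 0 + 0 : Sg); first by rewrite mulr1 mulr0 !addr0.
  rewrite -E !(mderiv_Cq K0).
  transitivity (Cq p^`() * (L0 k * x0 + L1 k * x1 + L2 k * x2)
     - Cq q^`() * (L0 h * x0 + L1 h * x1 + L2 h * x2)); first by ring.
  by rewrite !ang_dot_x !mulr0 subr0.
have r0 : r = 0.
  suff /eqP : -2 *: r = 0 by rewrite scaler_eq0 oppr_eq0 (negbTE K2) /= => /eqP.
  have [w0 [w1 [w2 W]]] := form3_22 u0 u1 u2 h3.
  apply: (ang_Cq_eq0 K0 (g0 := w0 - s * h^`M(o0) + t * k^`M(o0) - b0')
    (g1 := w1 - s * h^`M(o1) + t * k^`M(o1) - b1')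
    (g2 := w2 - s * h^`M(o2) + t * k^`M(o2) - b2')).
  have aB i := linearBf (@ang_linear K i); have aD i := linearDf (@ang_linear K i).
  rewrite !(aB, aD).
  transitivity (Cq P * 0 + Cq r * - 2%:R + (L0 b0' + L1 b1' + L2 b2')
     - (L0 b0' + L1 b1' + L2 b2')).
    by rewrite CqZ scaleNr scaler_nat; ring.
  rewrite -T.
  pose D (a f : Sg) := L0 a * ∂0 f + L1 a * ∂1 f + L2 a * ∂2 f
     - f * (∂0 (L0 a) + ∂1 (L1 a) + ∂2 (L2 a)).
  transitivity (D h s - D k t + (L0 w0 + L1 w1 + L2 w2) - (L0 b0' + L1 b1' + L2 b2')).
    by rewrite /D -W /curl; ring.
  by rewrite /D !form3_13; ring.
by rewrite P0 r0 Cq0 !mul0r !add0r.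
Qed.

End Cohomology.

(** * Differential and bracket on the reduced elements *)

Section Coordinates.
Import ssrcomplements mpoly.
Variable K : fieldType.
Hypothesis K0 : forall n, n.+1%:R != 0 :> K.
Local Notation Sg := {mpoly K[3]}.
Local Notation x0 := ('X_o0 : Sg).
Local Notation x1 := ('X_o1 : Sg).
Local Notation x2 := ('X_o2 : Sg).
Implicit Types (f g : Sg).

Let K2 : (2 : K) != 0. Proof. exact: (K0 1). Qed.

Local Notation CE := {ffun {set 'I_3} -> Sg}.

Lemma form_part_int k f a0 a1 a2 b0 b1 b2 t :
  form_part k (mk8 f a0 a1 a2 b0 b1 b2 t) =
  mk8 (if 0%:Z == k then f else 0)
    (if 1%:Z == k then a0 else 0) (if 1%:Z == k then a1 else 0) (if 1%:Z == k then a2 else 0)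
    (if 2%:Z == k then b0 else 0) (if 2%:Z == k then b1 else 0) (if 2%:Z == k then b2 else 0)
    (if 3%:Z == k then t else 0) :> CE.
Proof.
apply/ffunP; apply: set3_ind => a b c; rewrite ffunE /formdeg card_bset !mk8E.
by case: a b c => [] [] [] //=; case: ifP => // _; rewrite oppr0.
Qed.

Lemma delta_linear : linear (@delta_g K : GG K -> GG K).
Proof.
move=> c F G.
have [f [a0 [a1 [a2 [b0 [b1 [b2 [t ->]]]]]]]] := mk8_exists F.
have [g [c0 [c1 [c2 [d0 [d1 [d2 [s ->]]]]]]]] := mk8_exists G.
have aL i := @ang_linear K i.
transitivity (delta_g (c *: (mk8 f a0 a1 a2 b0 b1 b2 t : CE) + mk8 g c0 c1 c2 d0 d1 d2 s)) => //.
transitivity (c *: (delta_g (mk8 f a0 a1 a2 b0 b1 b2 t) : CE) + delta_g (mk8 g c0 c1 c2 d0 d1 d2 s)) => //.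
rewrite mk8Z mk8D !(delta_mk8 K0) mk8Z mk8D !aL.
by congr mk8; rewrite -!mul_mpolyC; ring.
Qed.

Lemma form_part_delta k (F : GG K) :
  form_part (k + 1) (delta_g F) = delta_g (form_part k F : GG K) :> CE.
Proof.
have [f [a0 [a1 [a2 [b0 [b1 [b2 [t ->]]]]]]]] := mk8_exists F.
have e (n : nat) : (n.+1%:Z == k + 1) = (n%:Z == k) by rewrite -addn1 PoszD (inj_eq (addIr _)).
rewrite (delta_mk8 K0) !form_part_int (delta_mk8 K0) !e.
have a0' i := linear0f (@ang_linear K i).
by congr mk8; rewrite ?if_same //; case: ifP => // _; rewrite !a0' ?subr0 ?addr0.
Qed.

(* a 1 + b E + c pi + e Omega; the factor - 2 is the value of Omega on the basis. *)
Definition rdel (a b c e : {poly K}) : CE :=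
  mk8 (Cq a) (Cq b * x0) (Cq b * x1) (Cq b * x2)
    (Cq c * x0) (Cq c * x1) (Cq c * x2) (Cq e * - 2%:R).

Lemma rdelE a b c e : rdel a b c e =
  smulf (Cq a) (CE_one K) + smulf (Cq b) (Euler K) + smulf (Cq c) (pi_g K)
  + smulf (Cq e) (Omega K).
Proof.
rewrite one_mk8 Euler_mk8 (pi_mk8 K0) (Omega_mk8 K0) !smulf_mk8 !mk8D /rdel.
by rewrite !mulr0 !addr0 !add0r mulr1.
Qed.

Lemma rdel_linear s a b c e a' b' c' e' :
  rdel (s *: a + a') (s *: b + b') (s *: c + c') (s *: e + e')
  = s *: rdel a b c e + rdel a' b' c' e'.
Proof.
by rewrite /rdel mk8Z mk8D !CqD !CqZ; congr mk8; rewrite -!mul_mpolyC; ring.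
Qed.

Lemma rdel_inj a b c e a' b' c' e' : rdel a b c e = rdel a' b' c' e' ->
  [/\ a = a', b = b', c = c' & e = e'].
Proof.
have x0n : x0 != 0.
  apply/eqP => z; have := mderivXU K o0 o0.
  by rewrite z mderiv0 eqO' => /esym/eqP; rewrite oner_eq0.
move=> /mk8_inj[A [B _ _] [C _ _] E]; split; apply: (Cq_inj K0) => //.
- exact: (mulIf x0n B).
- exact: (mulIf x0n C).
apply: (mulIf _ E); rewrite oppr_eq0 -mpolyC_nat mpolyC_eq0; exact: K2.
Qed.

Lemma delta_rdel a b c e : delta_g (rdel a b c e : GG K) = rdel 0 0 b 0.
Proof.
rewrite /rdel (delta_mk8 K0) !(angM, ang_Cq K0) Cq0 !mul0r !add0r ang.unlock /= !mderE.
by congr mk8; ring.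
Qed.

(** Here [r] is r² as a polynomial in q, since E maps f(q) to -r² f'(q). The doubled terms come from
    the coefficient -2 of [Omega], the tripled ones from the divergence 3 of the Euler field. *)
Lemma schouten_rdel a b c e (f g h k : {poly K}) : let r := -2 *: 'X in
  schouten (rdel a b c e : GG K) (rdel f g h k : GG K) =
  rdel (r * (a^`() * g - b * f^`()))
   (r * (b^`() * g - b * g^`()))
   (f^`() * e + f^`() * e - (a^`() * k + a^`() * k) - r * b * h^`() - b * h + r * g * c^`() + g * c)
   (- (b * k + b * k + b * k) + r * b^`() * k - r * b * k^`()
    + (g * e + g * e + g * e) - r * g^`() * e + r * g * e^`()) :> CE.
Proof.
move=> r; rewrite /rdel !(CqD, CqN, CqM) -!(r2E K0) /r2.
have D p i := mderiv_Cq K0 i p; have n2 i : (2%:R : Sg)^`M(i) = 0 by rewrite -mpolyC_nat mderivC.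
(* Comparing two elements Cq p unfolds the evaluation of polynomials. *)
move: (D a) (D b) (D c) (D e) (D f) (D g) (D h) (D k).
move: (Cq a) (Cq b) (Cq c) (Cq e) (Cq f) (Cq g) (Cq h) (Cq k).
move: (Cq a^`()) (Cq b^`()) (Cq c^`()) (Cq e^`()) (Cq f^`()) (Cq g^`()) (Cq h^`()) (Cq k^`()).
move=> A' B' C' E' F' G' H' L' A B C E F G H L dA dB dC dE dF dG dH dL.
rewrite schouten_mk8 !(mderivM, mderivN) !(dA, dB, dC, dE, dF, dG, dH, dL) !n2 !mderivXU.
by rewrite !eqO' ?mulr1n ?mulr0n; congr mk8; ring.
Qed.

Lemma form_part_rdel k a b c e : form_part k (rdel a b c e) =
  rdel (if 0%:Z == k then a else 0) (if 1%:Z == k then b else 0)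
       (if 2%:Z == k then c else 0) (if 3%:Z == k then e else 0).
Proof.
rewrite /rdel form_part_int; congr mk8; case: ifP => //; rewrite ?Cq0 ?mul0r //.
Qed.

End Coordinates.

(** * The obstruction to formality *)

Section Obstruction.
Import ssrcomplements mpoly.
Variable K : fieldType.
Hypothesis K0 : forall n, n.+1%:R != 0 :> K.
Local Notation Sg := {mpoly K[3]}.
Local Notation x0 := ('X_o0 : Sg).
Local Notation x1 := ('X_o1 : Sg).
Local Notation x2 := ('X_o2 : Sg).
Local Notation CE := {ffun {set 'I_3} -> Sg}.

Lemma form_part1 (F : CE) : form_part 1 F = F -> exists a0 a1 a2, F = mk8 0 a0 a1 a2 0 0 0 0.
Proof.
have [f [a0 [a1 [a2 [b0 [b1 [b2 [t ->]]]]]]]] := mk8_exists F.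
by rewrite form_part_int => <-; exists a0, a1, a2.
Qed.

Lemma form_part2 (F : CE) : form_part 2 F = F -> exists b0 b1 b2, F = mk8 0 0 0 0 b0 b1 b2 0.
Proof.
have [f [a0 [a1 [a2 [b0 [b1 [b2 [t ->]]]]]]]] := mk8_exists F.
by rewrite form_part_int => <-; exists b0, b1, b2.
Qed.

Lemma form_part_neg (F : CE) (k : int) : k < 0 -> form_part k F = 0.
Proof. by move=> k0; apply/ffunP => I; rewrite !ffunE /formdeg; case: k k0. Qed.

Lemma schouten0r (F : GG K) : schouten F 0 = 0.
Proof.
have [f [a0 [a1 [a2 [b0 [b1 [b2 [t ->]]]]]]]] := mk8_exists F.
suff : schouten (mk8 f a0 a1 a2 b0 b1 b2 t : GG K) (mk8 0 0 0 0 0 0 0 0 : GG K)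
  = mk8 0 0 0 0 0 0 0 0 :> CE by rewrite -mk8_0.
by rewrite schouten_mk8; congr mk8; rewrite !mderiv0; ring.
Qed.

Lemma schouten0l (F : GG K) : schouten (0 : GG K) F = 0.
Proof.
have [f [a0 [a1 [a2 [b0 [b1 [b2 [t ->]]]]]]]] := mk8_exists F.
suff : schouten (mk8 0 0 0 0 0 0 0 0 : GG K) (mk8 f a0 a1 a2 b0 b1 b2 t : GG K)
  = mk8 0 0 0 0 0 0 0 0 :> CE by rewrite -mk8_0.
by rewrite schouten_mk8; congr mk8; rewrite !mderiv0; ring.
Qed.

Lemma mk8B (f a0 a1 a2 b0 b1 b2 t f' a0' a1' a2' b0' b1' b2' t' : Sg) :
  mk8 f a0 a1 a2 b0 b1 b2 t - mk8 f' a0' a1' a2' b0' b1' b2' t' =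
  mk8 (f - f') (a0 - a0') (a1 - a1') (a2 - a2')
      (b0 - b0') (b1 - b1') (b2 - b2') (t - t') :> CE.
Proof. by rewrite -scaleN1r mk8Z mk8D !scaleN1r. Qed.

Lemma form3_function (s g : Sg) :
  schouten (mk8 0 0 0 0 0 0 0 s : GG K) (mk8 g 0 0 0 0 0 0 0 : GG K)
  = mk8 0 0 0 0 (s * g^`M(o0)) (s * g^`M(o1)) (s * g^`M(o2)) 0 :> CE.
Proof. by rewrite schouten_mk8; congr mk8; rewrite !mderiv0; ring. Qed.

Lemma function_form3 (s g : Sg) :
  schouten (mk8 g 0 0 0 0 0 0 0 : GG K) (mk8 0 0 0 0 0 0 0 s : GG K)
  = mk8 0 0 0 0 (- (s * g^`M(o0))) (- (s * g^`M(o1))) (- (s * g^`M(o2))) 0 :> CE.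
Proof. by rewrite schouten_mk8; congr mk8; rewrite !mderiv0; ring. Qed.

Lemma form1_function (a0 a1 a2 g : Sg) :
  schouten (mk8 0 a0 a1 a2 0 0 0 0 : GG K) (mk8 g 0 0 0 0 0 0 0 : GG K)
  = mk8 (a0 * g^`M(o0) + a1 * g^`M(o1) + a2 * g^`M(o2)) 0 0 0 0 0 0 0 :> CE.
Proof. by rewrite schouten_mk8; congr mk8; rewrite !mderiv0; ring. Qed.

Lemma function_form1 (a0 a1 a2 g : Sg) :
  schouten (mk8 g 0 0 0 0 0 0 0 : GG K) (mk8 0 a0 a1 a2 0 0 0 0 : GG K)
  = mk8 (- (a0 * g^`M(o0) + a1 * g^`M(o1) + a2 * g^`M(o2))) 0 0 0 0 0 0 0 :> CE.
Proof. by rewrite schouten_mk8; congr mk8; rewrite !mderiv0; ring. Qed.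

Lemma no_extension (V W : GG K) (q := rdel 'X 0 0 0 : GG K)
    (F := (rdel 0 0 0 1 : GG K) - delta_g W) :
  form_part 1 V = V :> CE -> form_part 2 W = W :> CE ->
  delta_g V + 2^-1 *: (schouten F q - schouten q F) = 0 ->
  schouten V q - schouten q V = 0 -> False.
Proof.
move=> /form_part1[a0 [a1 [a2 eV]]] /form_part2[w0 [w1 [w2 eW]]].
have aL j := @ang_linear K j.
pose s : Sg := - 2%:R - (ang o0 w0 + ang o1 w1 + ang o2 w2).
have a0' j : ang j 0 = 0 := linear0f (aL j).
have eF : F = (mk8 0 0 0 0 0 0 0 s : GG K).
  rewrite /F eW (delta_mk8 K0) !a0'.
  suff : (rdel 0 0 0 1 : CE) - mk8 0 0 0 0 (0 - 0 - 0) (0 - 0 - 0) (0 - 0 - 0)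
      (ang o0 w0 + ang o1 w1 + ang o2 w2) = mk8 0 0 0 0 0 0 0 s by [].
  rewrite -scaleN1r mk8Z mk8D /rdel !Cq0 Cq1 /s.
  by rewrite !subr0 !(mul0r, scaler0, addr0) mul1r scaleN1r.
have eq : q = (mk8 (Cq 'X) 0 0 0 0 0 0 0 : GG K) by rewrite /q /rdel !Cq0 !mul0r.
have K2 : (2 : K) != 0 by exact: (K0 1).
have dq i : (Cq ('X : {poly K}))^`M(i) = - 'X_i by rewrite CqX mderiv_q.
rewrite eF eq eV (delta_mk8 K0) form3_function function_form3 form1_function function_form1 !dq => H1 H2.
have {}H2 : a0 * x0 + a1 * x1 + a2 * x2 = 0.
  move: H2; set p := a0 * _ + _ + _ => H2.
  have {}H2 : (mk8 p 0 0 0 0 0 0 0 : CE) - mk8 (- p) 0 0 0 0 0 0 0 = 0 := H2.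
  move: H2; rewrite mk8B mk8_0 => /mk8_inj[e _ _ _].
  apply: (@scalerI _ _ (- 2)); first by rewrite oppr_eq0.
  by rewrite scaler0 -e /p -!mul_mpolyC mpolyCN mpolyC_nat; ring.
have half (y d : Sg) : d + 2^-1 *: (y - - y) = 0 -> d = - y.
  by rewrite opprK -mulr2n -scaler_nat scalerA mulVf // scale1r => /eqP; rewrite addr_eq0 => /eqP.
move: H1; set d0 := ang o1 a2 - _ - _; set d1 := ang o2 a0 - _ - _; set d2 := ang o0 a1 - _ - _ => H1.
have {}H1 : (mk8 0 (ang o0 0) (ang o1 0) (ang o2 0) d0 d1 d2 (ang o0 0 + ang o1 0 + ang o2 0) : CE)
   + 2^-1 *: ((mk8 0 0 0 0 (s * - 'X_o0) (s * - 'X_o1) (s * - 'X_o2) 0 : CE) -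
   mk8 0 0 0 0 (- (s * - 'X_o0)) (- (s * - 'X_o1)) (- (s * - 'X_o2)) 0) = 0 := H1.
move: H1; rewrite mk8B mk8Z mk8D mk8_0 => /mk8_inj[_ _ [/half e0 /half e1 /half e2] _].
have xd : x0 * d0 + x1 * d1 + x2 * d2 = s * r2 K by rewrite e0 e1 e2 /r2; ring.
move: xd; rewrite ang_x_dot H2 addr0 => xd.
have r2L j g : ang j (r2 K * g) = r2 K * ang j g by rewrite (r2E K0) (ang_CqM K0).
move: xd; move: (a1 * x2 - a2 * x1) (a2 * x0 - a0 * x2) (a0 * x1 - a1 * x0) => g0 g1 g2 xd.
(* The polynomial 4 q is -2 r². The term r² (L · W) moves inside because L is linear over C[q]. *)
have : Cq (4 *: 'X : {poly K}) = ang o0 (g0 + r2 K * w0)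
    + ang o1 (g1 + r2 K * w1) + ang o2 (g2 + r2 K * w2).
  rewrite !(linearDf (aL _)) !r2L.
  transitivity (s * r2 K + r2 K * (ang o0 w0 + ang o1 w1 + ang o2 w2)); last by rewrite -xd; ring.
  transitivity (- 2%:R * r2 K); last by rewrite /s; ring.
  rewrite (r2E K0) !CqZ -!mul_mpolyC mpolyCN !mpolyC_nat; ring.
move/(ang_Cq_eq0 K0)/eqP; rewrite scaler_eq0 polyX_eq0 orbF => e.
by move: (K0 3); rewrite e.
Qed.

End Obstruction.

(** * The reduced complex *)

Section SubQuotientFacts.
Variables (K : fieldType) (V : gspace K) (P : V -> Prop).

Lemma gsub_val_inj : injective (@gsub_val K V P). Proof. exact: val_inj. Qed.

Lemma gsub_val_linear : linear (@gsub_val K V P). Proof. by []. Qed.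

Lemma gsub_ofK x : in_span (homog_part P) x -> gsub_val (gsub_of P x) = x.
Proof. by move=> Px; rewrite /gsub_val /gsub_of insubdK //; apply/spanP. Qed.

Lemma gsub_valK (u : gsub P) : gsub_of P (gsub_val u) = u.
Proof. exact: valKd. Qed.

Lemma gsub_of0 x : ~ in_span (homog_part P) x -> gsub_of P x = 0.
Proof.
by move=> Px; rewrite /gsub_of /insubd insubN //; apply/negP => /spanP.
Qed.

Lemma gpr_gsub i (u : gsub P) : gsub_val (gpr i u) = gpr i (gsub_val u).
Proof. by []. Qed.

Lemma in_span_val (u : gsub P) : in_span (homog_part P) (gsub_val u).
Proof. exact/spanP/(valP u). Qed.

End SubQuotientFacts.

Lemma in_span_sum (K : fieldType) (V : lmodType K) (P : V -> Prop) (I : Type) (r : seq I) (F : I -> V) :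
  (forall i, in_span P (F i)) -> in_span P (\sum_(i <- r) F i).
Proof.
move=> PF; elim: r => [|i r IH]; first by rewrite big_nil; exact: span0.
by rewrite big_cons; apply: spanD.
Qed.

Section Reduced.
Import ssrcomplements mpoly.
Variable K : fieldType.
Hypothesis K0 : forall n, n.+1%:R != 0 :> K.
Local Notation GR := (GG_red K).
Implicit Types (a b c e f g h k : {poly K}) (x : GR).

Lemma red_span (F : GG K) :
  in_span (homog_part (@red_gen K)) F <-> exists a b c e, F = rdel a b c e.
Proof.
split=> [|[a [b [c [e ->]]]]].
  elim=> [|s X Y [[f Xf] _] _ [a [b [c [e ->]]]]].
    exists 0, 0, 0, 0; rewrite -[LHS](subrr (rdel 0 0 0 0)).
    by rewrite addrC -scaleN1r -rdel_linear !scaler0 !addr0.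
  have Z : rdel 0 0 0 0 = 0 :> {ffun {set 'I_3} -> mpoly 3 K}.
    by rewrite /rdel Cq0 !mul0r mk8_0.
  have [X1|X1|X1|X1] := Xf; rewrite X1.
  - exists (s *: f + a), (s *: 0 + b), (s *: 0 + c), (s *: 0 + e).
    rewrite rdel_linear; congr (_ *: _ + _).
    by rewrite one_mk8 smulf_mk8 /rdel Cq0 !mul0r !mulr0 mulr1.
  - exists (s *: 0 + a), (s *: f + b), (s *: 0 + c), (s *: 0 + e).
    rewrite rdel_linear; congr (_ *: _ + _).
    by rewrite Euler_mk8 smulf_mk8 /rdel Cq0 !mul0r !mulr0.
  - exists (s *: 0 + a), (s *: 0 + b), (s *: f + c), (s *: 0 + e).
    rewrite rdel_linear; congr (_ *: _ + _).
    by rewrite (pi_mk8 K0) smulf_mk8 /rdel Cq0 !mul0r !mulr0.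
  exists (s *: 0 + a), (s *: 0 + b), (s *: 0 + c), (s *: f + e).
  rewrite rdel_linear; congr (_ *: _ + _).
  by rewrite (Omega_mk8 K0) smulf_mk8 /rdel Cq0 !mul0r !mulr0.
rewrite (rdelE K0).
have hp (X : GG K) i : red_gen X -> form_part (i + 1) X = X -> in_span (homog_part (@red_gen K)) X.
  by move=> rX iX; apply: span_gen; split=> //; exists i.
apply: spanD; first apply: spanD; first apply: spanD.
- apply: (hp _ (-1)); first by exists a; constructor 1.
  by rewrite one_mk8 smulf_mk8 form_part_int /= !mulr0.
- apply: (hp _ 0); first by exists b; constructor 2.
  by rewrite Euler_mk8 smulf_mk8 form_part_int /= !mulr0.
- apply: (hp _ 1); first by exists c; constructor 3.
  by rewrite (pi_mk8 K0) smulf_mk8 form_part_int /= !mulr0.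
- apply: (hp _ 2); first by exists e; constructor 4.
  by rewrite (Omega_mk8 K0) smulf_mk8 form_part_int /= !mulr0.
Qed.

Definition rd a b c e : GR := gsub_of (@red_gen K) (rdel a b c e).

Lemma rd_val a b c e : gsub_val (rd a b c e) = rdel a b c e.
Proof. by apply: gsub_ofK; apply/red_span; exists a, b, c, e. Qed.

Lemma rd_inj a b c e a' b' c' e' : rd a b c e = rd a' b' c' e' ->
  [/\ a = a', b = b', c = c' & e = e'].
Proof. by move=> /(congr1 (@gsub_val _ _ _)); rewrite !rd_val => /(rdel_inj K0). Qed.

Lemma rd_exists x : exists t : {poly K} * {poly K} * {poly K} * {poly K},
  x = rd t.1.1.1 t.1.1.2 t.1.2 t.2.
Proof.
have /red_span[a [b [c [e xE]]]] := in_span_val x.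
by exists (a, b, c, e); apply: gsub_val_inj; rewrite rd_val.
Qed.

(** Coordinates picked by choice; [rd_inj] makes them unique. *)
Definition rc0 x := (sval (cid (rd_exists x))).1.1.1.
Definition rc1 x := (sval (cid (rd_exists x))).1.1.2.
Definition rc2 x := (sval (cid (rd_exists x))).1.2.
Definition rc3 x := (sval (cid (rd_exists x))).2.

Lemma rcK x : rd (rc0 x) (rc1 x) (rc2 x) (rc3 x) = x.
Proof. by rewrite /rc0 /rc1 /rc2 /rc3; case: (cid _) => t /= <-. Qed.

Lemma rd_linear s a b c e a' b' c' e' :
  rd (s *: a + a') (s *: b + b') (s *: c + c') (s *: e + e')
  = s *: rd a b c e + rd a' b' c' e'.
Proof.
by apply: gsub_val_inj; rewrite rd_val rdel_linear gsub_val_linear !rd_val.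
Qed.

Lemma rd0 : rd 0 0 0 0 = 0.
Proof.
by have := rd_linear (-1) 0 0 0 0 0 0 0 0; rewrite !scaler0 !addr0 scaleN1r addNr.
Qed.

Lemma gpr_rd i a b c e : gpr i (rd a b c e) =
  rd (if i == -1 then a else 0) (if i == 0 then b else 0)
     (if i == 1 then c else 0) (if i == 2 then e else 0).
Proof.
apply: gsub_val_inj; rewrite gpr_gsub !rd_val.
apply: etrans (form_part_rdel (i + 1) a b c e) _.
have t (m : int) : (m + 1 == i + 1) = (i == m) by rewrite (inj_eq (addIr _)) eq_sym.
by rewrite -(t (-1)) -(t 0) -(t 1) -(t 2).
Qed.

Lemma delta_red_rd a b c e : delta_red (rd a b c e) = rd 0 0 b 0.
Proof. by rewrite /delta_red rd_val (delta_rdel K0). Qed.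

Lemma schouten_red_rd a b c e f g h k : let r := -2 *: 'X in
  schouten_red (rd a b c e) (rd f g h k) =
  rd (r * (a^`() * g - b * f^`()))
   (r * (b^`() * g - b * g^`()))
   (f^`() * e + f^`() * e - (a^`() * k + a^`() * k) - r * b * h^`() - b * h + r * g * c^`() + g * c)
   (- (b * k + b * k + b * k) + r * b^`() * k - r * b * k^`()
    + (g * e + g * e + g * e) - r * g^`() * e + r * g * e^`()).
Proof. by rewrite /schouten_red !rd_val (schouten_rdel K0). Qed.

End Reduced.

(** * Coordinates on the cohomology *)

Section CohomologyCoordinates.
Import ssrcomplements mpoly.
Variable K : fieldType.
Hypothesis K0 : forall n, n.+1%:R != 0 :> K.
Implicit Types (p r : {poly K}) (F G : GG K) (y : HH K).
Local Notation closed := (fun x : GG K => delta_g x = 0).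

(** The differential raises the form degree by one, so the components of a closed element are
    closed, and restricting to homogeneous generators loses nothing. *)
Lemma closed_span F : in_span (homog_part closed) F <-> delta_g F = 0.
Proof.
split=> [|dF].
  elim=> [|s X Y [X0 _] _ Y0]; first exact: (linear0f (delta_linear K0)).
  by rewrite (delta_linear K0) X0 Y0 scaler0 addr0.
have [s us ->] := gpr_sum F; apply: in_span_sum => i; apply: span_gen; split.
  transitivity (form_part (i + 1 + 1) (delta_g F) : GG K).
    by symmetry; exact: (form_part_delta K0 (i + 1) F).
  by rewrite dF; exact: (linear0f (@form_part_linear K _)).
by exists i; rewrite gprI eqxx.
Qed.

Lemma exact_span (z : cocycles (@delta_g K)) :
  in_span (homog_part (fun z : cocycles (@delta_g K) => exists x, gsub_val z = delta_g x)) z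
  <-> exists x, gsub_val z = delta_g x.
Proof.
split=> [|[X zX]].
  elim=> [|s x y [[X xX] _] _ [Y yY]].
    by exists 0; rewrite (linear0f (delta_linear K0)).
  by exists (s *: X + Y); rewrite gsub_val_linear xX yY (delta_linear K0).
have [s us zs] := gpr_sum z; rewrite zs; apply: in_span_sum => i; apply: span_gen.
split; last by exists i; rewrite gprI eqxx.
exists (form_part i X : GG K); rewrite gpr_gsub zX.
exact: (form_part_delta K0 i X).
Qed.

Lemma hcls_eqP F G : delta_g F = 0 -> delta_g G = 0 ->
  hcls F = hcls G <-> exists X, F - G = delta_g X.
Proof.
move=> dF dG; rewrite /hcls /cls qpiP exact_span.
have -> : gsub_val (gsub_of closed F - gsub_of closed G) = F - G.
  transitivity (gsub_val (gsub_of closed F) - gsub_val (gsub_of closed G)) => //.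
  by rewrite !gsub_ofK //; exact/closed_span.
by [].
Qed.

Lemma closed_ofK F : delta_g F = 0 -> gsub_val (gsub_of closed F) = F.
Proof. by move=> dF; apply: gsub_ofK; apply/closed_span. Qed.

Lemma hcls_linear s F G : delta_g F = 0 -> delta_g G = 0 ->
  hcls (s *: F + G) = s *: hcls F + hcls G.
Proof.
move=> dF dG; rewrite /hcls /cls -linearP; congr qpi; apply: gsub_val_inj.
rewrite gsub_val_linear (closed_ofK dF) (closed_ofK dG); apply: closed_ofK.
by rewrite (delta_linear K0) dF dG scaler0 addr0.
Qed.

Lemma delta_harm p c r : delta_g (rdel p 0 c r : GG K) = 0.
Proof. by rewrite (delta_rdel K0) /rdel Cq0 !mul0r mk8_0. Qed.

Definition hh p r : HH K := hcls (rdel p 0 0 r : GG K).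

Lemma harmE p r : rdel p 0 0 r = smulf (Cq p) (CE_one K) + smulf (Cq r) (Omega K).
Proof.
rewrite (rdelE K0); congr (_ + _); rewrite (pi_mk8 K0) Euler_mk8 !smulf_mk8 Cq0 !mul0r.
by rewrite -mk8_0 !addr0.
Qed.

Lemma hh_inj p r p' r' : hh p r = hh p' r' -> p = p' /\ r = r'.
Proof.
move/hcls_eqP; case; [exact: delta_harm|exact: delta_harm|move=> X].
have -> : (rdel p 0 0 r : GG K) - rdel p' 0 0 r' = rdel (p - p') 0 0 (r - r') :> GG K.
  have := rdel_linear (-1) p' 0 0 r' p 0 0 r; rewrite !scaler0 !addr0 !scaleN1r => e.
  by rewrite addrC [p - _]addrC [r - _]addrC e.
rewrite harmE => /(harmonic_coboundary K0)[/eqP+ /eqP].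
by rewrite !subr_eq0 => /eqP -> /eqP ->.
Qed.

(** The term c π is the coboundary of c E. *)
Lemma hcls_rdel p c r : hcls (rdel p 0 c r : GG K) = hh p r.
Proof.
apply/hcls_eqP; [exact: delta_harm|exact: delta_harm|].
exists (rdel 0 c 0 0 : GG K); rewrite (delta_rdel K0).
have := rdel_linear (-1) p 0 0 r p 0 c r; rewrite !scaler0 !scaleN1r !addNr !add0r => ->.
by rewrite addrC.
Qed.

Lemma hh_exists y : exists t : {poly K} * {poly K}, y = hh t.1 t.2.
Proof.
rewrite -[y]qreprK.
have yz := gsub_valK (qrepr y : cocycles (@delta_g K)).
have dz : delta_g (gsub_val (qrepr y : cocycles (@delta_g K))) = 0.
  by apply/closed_span; exact: in_span_val.
have [p [r [X e]]] := cocycleP K0 dz.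
exists (p, r); transitivity (hcls (gsub_val (qrepr y : cocycles (@delta_g K)))).
  by rewrite /hcls /cls yz.
apply: (proj2 (hcls_eqP dz (delta_harm p 0 r))).
by exists X; rewrite e harmE addrC addKr.
Qed.

Definition hc0 y := (sval (cid (hh_exists y))).1.
Definition hc1 y := (sval (cid (hh_exists y))).2.

Lemma hcK y : hh (hc0 y) (hc1 y) = y.
Proof. exact: esym (svalP (cid (hh_exists y))). Qed.

Lemma hcE p r : (hc0 (hh p r) = p) * (hc1 (hh p r) = r).
Proof. by have [-> ->] := hh_inj (hcK (hh p r)). Qed.

Lemma hh_linear s p r p' r' : hh (s *: p + p') (s *: r + r') = s *: hh p r + hh p' r'.
Proof.
have := rdel_linear s p 0 0 r p' 0 0 r'; rewrite !scaler0 !addr0 /hh => ->.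
by apply: hcls_linear; exact: delta_harm.
Qed.

Lemma hh0 : hh 0 0 = 0.
Proof. by have := hh_linear (-1) 0 0 0 0; rewrite !scaler0 !addr0 scaleN1r addNr. Qed.

Lemma hc_linear : linear hc0 /\ linear hc1.
Proof. by split=> s x y; rewrite -{1}[x]hcK -{1}[y]hcK -hh_linear hcE. Qed.

Lemma gpr_hh i p r : gpr i (hh p r) =
  hh (if i == -1 then p else 0) (if i == 2 then r else 0).
Proof.
apply: etrans (gquot_prE _ _ _) _; rewrite /hh /hcls /cls; congr qpi.
apply: gsub_val_inj; rewrite gpr_gsub !gsub_ofK; try exact/closed_span/delta_harm.
apply: etrans (form_part_rdel (i + 1) p 0 0 r) _.
have t (m : int) : (m + 1 == i + 1) = (i == m) by rewrite (inj_eq (addIr _)) eq_sym.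
by rewrite -(t (-1)) -(t 2) !if_same.
Qed.

Lemma delta_crepr y : delta_g (crepr y) = 0.
Proof. by apply/closed_span; exact: in_span_val. Qed.

(** For a closed bracket this is [schouten_cocycles]; outside the cocycles [cls] takes its default
    value 0. *)
Lemma cohom_br0 y y' : cohom_br (@schouten K) y y' = 0 :> HH K.
Proof.
rewrite /cohom_br; have [d0|d0] := pselect (delta_g (schouten (crepr y) (crepr y')) = 0).
  have z0 : delta_g (0 : GG K) = 0 by exact: (linear0f (delta_linear K0)).
  transitivity (hcls (0 : GG K)).
    apply/hcls_eqP => //.
    have [X ->] := schouten_cocycles K0 (delta_crepr y) (delta_crepr y') d0.
    by exists X; rewrite subr0.
  rewrite /hcls /cls -[RHS](linear0 (qpi _)); congr qpi; apply: gsub_val_inj.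
  by rewrite gsub_ofK //; apply/closed_span.
rewrite /cls gsub_of0 ?linear0 //.
by move/closed_span.
Qed.

End CohomologyCoordinates.

Section Parity.
Variable K : fieldType.
Hypothesis K0 : forall n, n.+1%:R != 0 :> K.
Local Notation sg n := ((-1) ^ (n) : K).

Lemma N1neq1 : (-1 == 1 :> K) = false.
Proof.
apply/negbTE; rewrite eq_sym -subr_eq0 opprK; exact: (K0 1).
Qed.

Lemma if11 (T : Type) (p q : T) : (if (1 : K) == 1 then p else q) = p.
Proof. by rewrite eqxx. Qed.

Lemma ifN1 (T : Type) (p q : T) : (if (-1 : K) == 1 then p else q) = q.
Proof. by rewrite N1neq1. Qed.

Lemma sg_cases n : sg n = 1 \/ sg n = -1.
Proof.
have /eqP := sg_sq K n; rewrite -expr2 sqrf_eq1 => /orP[] /eqP ->; by [left|right].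
Qed.

(** The degrees are the form degrees minus 2, one for each shift. The conclusion is a disjunction
    because 0 has every degree. *)
Lemma red_homog (x : homog (gshift (GG_red K))) (v := hval x : GG_red K) :
  [/\ rc0 K0 v = 0 \/ hdeg x = -2, rc1 K0 v = 0 \/ hdeg x = -1,
      rc2 K0 v = 0 \/ hdeg x = 0 & rc3 K0 v = 0 \/ hdeg x = 1].
Proof.
have : gpr (hdeg x + 1) v = v by exact: homogP x.
have h m n : m = n + 1 -> (hdeg x + 1 == m) = (hdeg x == n).
  by move=> ->; rewrite (inj_eq (addIr _)).
rewrite -{1 2}(rcK K0 v) (gpr_rd K0) => /(rd_inj K0)[].
rewrite (h (-1) (-2)) // (h 0 (-1)) // (h 1 0) // (h 2 1) //.
move=> e0 e1 e2 e3; split.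
- by move: e0; case: eqP => [d _|_ <-]; [right|left].
- by move: e1; case: eqP => [d _|_ <-]; [right|left].
- by move: e2; case: eqP => [d _|_ <-]; [right|left].
by move: e3; case: eqP => [d _|_ <-]; [right|left].
Qed.

Lemma coh_homog (x : homog (gshift (HH K))) (v := hval x : HH K) :
  [/\ hc0 K0 v = 0 \/ hdeg x = -2 & hc1 K0 v = 0 \/ hdeg x = 1].
Proof.
have : gpr (hdeg x + 1) v = v by exact: homogP x.
have h m n : m = n + 1 -> (hdeg x + 1 == m) = (hdeg x == n).
  by move=> ->; rewrite (inj_eq (addIr _)).
rewrite -{1 2}(hcK K0 v) (gpr_hh K0) => /(hh_inj K0)[].
rewrite (h (-1) (-2)) // (h 2 1) //.
move=> e0 e1; split.
- by move: e0; case: eqP => [d _|_ <-]; [right|left].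
by move: e1; case: eqP => [d _|_ <-]; [right|left].
Qed.

Lemma sg_odd : (sg (-1) = -1) * (sg 1 = -1) * (sg (-2) = 1) * (sg 0 = 1).
Proof.
by do !split; rewrite ?expr1z ?expr0z // ?exprN1 ?invrN1 // -[sg (-2)]/((-1) ^+ 2)^-1 sqrrN expr1n invr1.
Qed.

(** Koszul signs see degrees only through parity: after both shifts, 1 and π are even, E and Ω
    odd. *)
Variant red_parity (x : homog (gshift (GG_red K))) : Prop :=
| RedEven a c of sg (hdeg x) = 1 & hval x = rd a 0 c 0 :> GG_red K
| RedOdd b e of sg (hdeg x) = -1 & hval x = rd 0 b 0 e :> GG_red K.

Lemma red_parityP x : red_parity x.
Proof.
have [h0 h1 h2 h3] := red_homog x.
have no d s : sg (hdeg x) = s -> sg d != s -> hdeg x <> d.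
  by move=> <- + e; rewrite e eqxx.
have N : (1 == -1 :> K) = false by rewrite eq_sym N1neq1.
case: (sg_cases (hdeg x)) => s.
  case: h1 => [z1|/(no _ _ s)]; last by rewrite sg_odd N1neq1 => /(_ isT).
  case: h3 => [z3|/(no _ _ s)]; last by rewrite sg_odd N1neq1 => /(_ isT).
  by apply: (RedEven (a := rc0 K0 (hval x)) (c := rc2 K0 (hval x))) s _; rewrite -{1}(rcK K0 (hval x)) z1 z3.
case: h0 => [z0|/(no _ _ s)]; last by rewrite sg_odd N => /(_ isT).
case: h2 => [z2|/(no _ _ s)]; last by rewrite sg_odd N => /(_ isT).
by apply: (RedOdd (b := rc1 K0 (hval x)) (e := rc3 K0 (hval x))) s _; rewrite -{1}(rcK K0 (hval x)) z0 z2.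
Qed.

Variant coh_parity (x : homog (gshift (HH K))) : Prop :=
| CohEven p of sg (hdeg x) = 1 & hval x = hh p 0 :> HH K
| CohOdd r of sg (hdeg x) = -1 & hval x = hh 0 r :> HH K.

Lemma coh_parityP x : coh_parity x.
Proof.
have [h0 h1] := coh_homog x.
have no d s : sg (hdeg x) = s -> sg d != s -> hdeg x <> d.
  by move=> <- + e; rewrite e eqxx.
have N : (1 == -1 :> K) = false by rewrite eq_sym N1neq1.
case: (sg_cases (hdeg x)) => s.
  case: h1 => [z1|/(no _ _ s)]; last by rewrite sg_odd N1neq1 => /(_ isT).
  by apply: (CohEven (p := hc0 K0 (hval x))) s _; rewrite -{1}(hcK K0 (hval x)) z1.
case: h0 => [z0|/(no _ _ s)]; last by rewrite sg_odd N => /(_ isT).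
by apply: (CohOdd (r := hc1 K0 (hval x))) s _; rewrite -{1}(hcK K0 (hval x)) z0.
Qed.

End Parity.

(** * The L-infinity structure of the reduced complex *)

Section ReducedLinfty.
Variable K : fieldType.
Hypothesis K0 : forall n, n.+1%:R != 0 :> K.
Local Notation sg n := ((-1) ^ (n) : K).
Local Notation V := (gshift (GG_red K)).
Implicit Types (x y z : homog V) (u v : GG_red K) (w : seq (homog V)).

Lemma rE : -2 *: 'X = - ('X + 'X) :> {poly K}.
Proof. by rewrite scaleNr scaler_nat mulr2n. Qed.

Lemma rd_coordinates u : exists a b c e, u = rd a b c e.
Proof. by exists (rc0 K0 u), (rc1 K0 u), (rc2 K0 u), (rc3 K0 u); rewrite rcK. Qed.

Lemma delta_red_linear : linear (@delta_red K).
Proof.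
move=> s u v; have [a [b [c [e ->]]]] := rd_coordinates u; have [a' [b' [c' [e' ->]]]] := rd_coordinates v.
rewrite -rd_linear // !delta_red_rd //; apply: etrans (rd_linear K0 _ _ _ _ _ _ _ _ _).
by rewrite !scaler0 !addr0.
Qed.

Lemma schouten_red_linearl v : linear ((@schouten_red K)^~ v).
Proof.
move=> s u u'; have [a [b [c [e ->]]]] := rd_coordinates u; have [a' [b' [c' [e' ->]]]] := rd_coordinates u'.
have [f [g [h [k ->]]]] := rd_coordinates v; rewrite -rd_linear // !schouten_red_rd //.
apply: etrans (rd_linear K0 _ _ _ _ _ _ _ _ _); rewrite !(derivD, derivZ) -!mul_polyC; congr rd; ring.
Qed.

Lemma schouten_red_linearr u : linear (@schouten_red K u).
Proof.
move=> s v v'; have [a [b [c [e ->]]]] := rd_coordinates v; have [a' [b' [c' [e' ->]]]] := rd_coordinates v'.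
have [f [g [h [k ->]]]] := rd_coordinates u; rewrite -rd_linear // !schouten_red_rd //.
apply: etrans (rd_linear K0 _ _ _ _ _ _ _ _ _); rewrite !(derivD, derivZ) -!mul_polyC; congr rd; ring.
Qed.

Lemma rdN a b c e : - rd a b c e = rd (- a) (- b) (- c) (- e) :> GG_red K.
Proof.
have := rd_linear K0 (-1) a b c e 0 0 0 0.
by rewrite !scaleN1r !addr0 => ->; rewrite (rd0 K0) addr0.
Qed.

Lemma rdD a b c e a' b' c' e' : rd a b c e + rd a' b' c' e'
  = rd (a + a') (b + b') (c + c') (e + e') :> GG_red K.
Proof.
by have := rd_linear K0 1 a b c e a' b' c' e'; rewrite !scale1r => ->.
Qed.

Definition red1 x : V := delta_red (hval x : GG_red K).
(** The sign is that of [shift_map]: the suspended letter has degree [hdeg x + 1]. *)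
Definition red2 x y : V := - sg (hdeg x) *: schouten_red (hval x : GG_red K) (hval y).
Lemma rdZ s a b c e : s *: (rd a b c e : V) = (rd (s *: a) (s *: b) (s *: c) (s *: e) : V).
Proof.
have := rd_linear K0 s a b c e 0 0 0 0.
by rewrite !addr0 => ->; rewrite (rd0 K0) addr0.
Qed.

Lemma red1_rd x a b c e : hval x = rd a b c e :> GG_red K -> red1 x = (rd 0 0 b 0 : V).
Proof. by rewrite /red1 => ->; exact: delta_red_rd. Qed.

Lemma red2_rd x y a b c e f g h k :
  hval x = rd a b c e :> GG_red K -> hval y = rd f g h k :> GG_red K ->
  red2 x y =
  (rd (- sg (hdeg x) *: (- ('X + 'X) * (a^`() * g - b * f^`())))
   (- sg (hdeg x) *: (- ('X + 'X) * (b^`() * g - b * g^`())))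
   (- sg (hdeg x) *: (f^`() * e + f^`() * e - (a^`() * k + a^`() * k) - - ('X + 'X) * b * h^`() - b * h
     + - ('X + 'X) * g * c^`() + g * c))
   (- sg (hdeg x) *: (- (b * k + b * k + b * k) + - ('X + 'X) * b^`() * k - - ('X + 'X) * b * k^`()
    + (g * e + g * e + g * e) - - ('X + 'X) * g^`() * e + - ('X + 'X) * g * e^`())) : V).
Proof.
move=> xE yE; rewrite /red2 xE yE /=; apply: etrans (rdZ _ _ _ _ _).
by congr (_ *: _); apply: etrans (schouten_red_rd K0 a b c e f g h k) _; rewrite rE.
Qed.

Lemma rd_eq a b c e a' b' c' e' : a = a' -> b = b' -> c = c' -> e = e' ->
  rd a b c e = rd a' b' c' e' :> GG_red K.
Proof. by move=> -> -> -> ->. Qed.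

Definition tred : seq (homog V) -> V := word12 red1 red2.

Lemma shift_map_red w : shift_map (dgla_map (@delta_red K) (@schouten_red K)) w = tred w.
Proof.
case: w => [|x [|y [|z w]]]; rewrite /shift_map /=; try exact: scaler0.
  by rewrite mul0r addr0 expr0z; exact: scale1r.
rewrite mul1r mul0r !addr0; congr (_ *: _).
by rewrite /hdeg /= sgD expr1z mulrN1.
Qed.

Lemma tred_compat : sym_compat tred.
Proof.
apply: word12_compat.
- by move=> s x y z _ _ e; rewrite /red1 e; exact: delta_red_linear.
- move=> y s x x' z xz xz' e; rewrite /red2 e xz xz' (schouten_red_linearl _ s).
  by rewrite scalerDr !scalerA mulrC.
move=> x y; have [a c sx ex|b e sx ex] := red_parityP K0 x;
  have [f h sy ey|g k sy ey] := red_parityP K0 y;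
  rewrite (red2_rd ex ey) (red2_rd ey ex) sgM2 sx sy ?if11 ?(ifN1 K0) rdZ;
  apply: rd_eq; rewrite ?(scale1r, scaleN1r, opprK, deriv0); ring.
Qed.

Variant red_single x : Prop :=
| RS0 of hval x = 0
| RS1 a of hdeg x = -2 & hval x = rd a 0 0 0 :> GG_red K
| RS2 b of hdeg x = -1 & hval x = rd 0 b 0 0 :> GG_red K
| RS3 c of hdeg x = 0 & hval x = rd 0 0 c 0 :> GG_red K
| RS4 e of hdeg x = 1 & hval x = rd 0 0 0 e :> GG_red K.

Lemma red_singleP x : red_single x.
Proof.
have [h0 h1 h2 h3] := red_homog K0 x; have v := rcK K0 (hval x).
case: h0 => [z0|d].
  case: h1 => [z1|d].
    case: h2 => [z2|d].
      case: h3 => [z3|d]; last by apply: (RS4 d (e := rc3 K0 (hval x))); rewrite -{1}v z0 z1 z2.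
      by apply: RS0; rewrite -v z0 z1 z2 z3 rd0.
    case: h3 => [z3|d']; last by rewrite d' in d.
    by apply: (RS3 d (c := rc2 K0 (hval x))); rewrite -{1}v z0 z1 z3.
  case: h2 => [z2|d']; last by rewrite d' in d.
  case: h3 => [z3|d']; last by rewrite d' in d.
  by apply: (RS2 d (b := rc1 K0 (hval x))); rewrite -{1}v z0 z2 z3.
case: h1 => [z1|d']; last by rewrite d' in d.
case: h2 => [z2|d']; last by rewrite d' in d.
case: h3 => [z3|d']; last by rewrite d' in d.
by apply: (RS1 d (a := rc0 K0 (hval x))); rewrite -{1}v z1 z2 z3.
Qed.

Lemma tred_deg w : gpr (wdeg w + 1) (tred w) = tred w.
Proof.
have d0 : schouten_red (0 : GG_red K) = fun=> 0.
  by apply: funext => v; exact: (linear0f (schouten_red_linearl v)).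
have d0' u : schouten_red u (0 : GG_red K) = 0 := linear0f (schouten_red_linearr u).
have g0 i : @gpr K V i 0 = 0 := linear0f (@gpr_linear K V i).
case: w => [|x [|y [|z w]]]; rewrite /tred /=; [exact: g0| | |exact: g0];
  rewrite !wdeg_cons wdeg_nil !addr0.
  rewrite /red1; case: (red_singleP x) => [->|a d ->|b d ->|c d ->|e d ->];
    first by rewrite (linear0f delta_red_linear); exact: g0.
  1-4: by rewrite d (delta_red_rd K0); apply: etrans (gpr_rd K0 _ _ _ _ _) _; rewrite ?if_same.
apply: etrans (linearZf _ _ (@gpr_linear K V _)) _; congr (_ *: _).
case: (red_singleP x) => [->|a d ->|b d ->|c d ->|e d ->].
- by rewrite d0; exact: g0.
all: case: (red_singleP y) => [->|a' d' ->|b' d' ->|c' d' ->|e' d' ->]; first by rewrite d0'; exact: g0.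
all: rewrite d d' (schouten_red_rd K0); apply: etrans (gpr_rd K0 _ _ _ _ _) _; apply: rd_eq.
all: rewrite ?(deriv0, mul0r, mulr0, subr0, sub0r, addr0, oppr0, add0r).
all: by rewrite ?if_same.
Qed.

End ReducedLinfty.

Section ReducedSquare.
Variable K : fieldType.
Hypothesis K0 : forall n, n.+1%:R != 0 :> K.
Local Notation sg n := ((-1) ^ (n) : K).
Local Notation V := (gshift (GG_red K)).
Implicit Types (x y z : homog V) (u v : GG_red K) (w : seq (homog V)).

Local Notation T := (@tred K).

Lemma hval_tred w : hval (thom T w) = T w.
Proof. by apply: hval_thom; [exact: (tred_compat K0)|exact: (tred_deg K0)]. Qed.

Lemma sg_thom1 x : sg (hdeg (thom T [:: x])) = - sg (hdeg x).
Proof. by rewrite hdeg_thom wdeg_cons wdeg_nil addr0 sgD expr1z mulrN1. Qed.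

Lemma sg_thom2 x y : sg (hdeg (thom T [:: x; y])) = - (sg (hdeg x) * sg (hdeg y)).
Proof. by rewrite hdeg_thom !wdeg_cons wdeg_nil addr0 !sgD expr1z mulrN1. Qed.

Lemma rdDV a b c e a' b' c' e' : (rd a b c e : V) + rd a' b' c' e'
  = (rd (a + a') (b + b') (c + c') (e + e') : V).
Proof. exact: (rdD K0). Qed.

Lemma rd_comb2 (s : K) (A B C : V) a b c e a' b' c' e' a'' b'' c'' e'' :
  A = (rd a b c e : V) -> B = (rd a' b' c' e' : V) -> C = (rd a'' b'' c'' e'' : V) ->
  a + a' + s *: a'' = 0 -> b + b' + s *: b'' = 0 ->
  c + c' + s *: c'' = 0 -> e + e' + s *: e'' = 0 -> A + B + s *: C = 0.
Proof.
move=> -> -> -> pa pb pc pe.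
rewrite (rdZ K0) (rdDV a b c e) rdDV pa pb pc pe.
exact: rd0.
Qed.

Lemma rd_comb3 (r s : K) (A B C : V) a b c e a' b' c' e' a'' b'' c'' e'' :
  A = (rd a b c e : V) -> B = (rd a' b' c' e' : V) -> C = (rd a'' b'' c'' e'' : V) ->
  a + r *: a' + s *: a'' = 0 -> b + r *: b' + s *: b'' = 0 ->
  c + r *: c' + s *: c'' = 0 -> e + r *: e' + s *: e'' = 0 ->
  A + r *: B + s *: C = 0.
Proof.
move=> AE BE CE; apply: rd_comb2 AE _ CE; rewrite BE; exact: (rdZ K0).
Qed.

Lemma red2_even x y a c f h :
  hval x = rd a 0 c 0 :> GG_red K -> hval y = rd f 0 h 0 :> GG_red K ->
  red2 x y = (rd 0 0 0 0 : V).
Proof.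
move=> ex ey; apply: etrans (red2_rd K0 ex ey) _; apply: rd_eq;
  by rewrite ?deriv0 ?(mulr0, mul0r, addr0, oppr0, scaler0).
Qed.

Lemma red2_even_odd x y a c g k : sg (hdeg x) = 1 ->
  hval x = rd a 0 c 0 :> GG_red K -> hval y = rd 0 g 0 k :> GG_red K ->
  red2 x y = (rd (('X + 'X) * (a^`() * g)) 0
     (a^`() * k + a^`() * k + ('X + 'X) * g * c^`() - g * c) 0 : V).
Proof.
move=> sx ex ey; apply: etrans (red2_rd K0 ex ey) _; rewrite sx; apply: rd_eq;
  rewrite ?(scaleNr, scale1r, opprK, deriv0); ring.
Qed.

Lemma red2_odd_even x y b e f h : sg (hdeg x) = -1 ->
  hval x = rd 0 b 0 e :> GG_red K -> hval y = rd f 0 h 0 :> GG_red K ->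
  red2 x y = (rd (('X + 'X) * (f^`() * b)) 0
     (f^`() * e + f^`() * e + ('X + 'X) * b * h^`() - b * h) 0 : V).
Proof.
move=> sx ex ey; apply: etrans (red2_rd K0 ex ey) _; rewrite sx; apply: rd_eq;
  rewrite ?(scaleNr, scale1r, opprK, deriv0); ring.
Qed.

Lemma red2_odd x y b e g k : sg (hdeg x) = -1 ->
  hval x = rd 0 b 0 e :> GG_red K -> hval y = rd 0 g 0 k :> GG_red K ->
  red2 x y = (rd 0 (('X + 'X) * (b * g^`() - b^`() * g)) 0
     (- (b * k + b * k + b * k) - ('X + 'X) * b^`() * k + ('X + 'X) * b * k^`()
      + (g * e + g * e + g * e) + ('X + 'X) * g^`() * e - ('X + 'X) * g * e^`()) : V).
Proof.
move=> sx ex ey; apply: etrans (red2_rd K0 ex ey) _; rewrite sx; apply: rd_eq;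
  rewrite ?(scaleNr, scale1r, opprK, deriv0); ring.
Qed.

Ltac poly_ring := rewrite ?(scale1r, scaleN1r) ?(derivD, derivN, derivM, derivX, deriv0); ring.

(** In shifted form, δ is a derivation of the bracket. *)
Lemma tred_square2 x y :
  T [:: thom T [:: x; y]] + T [:: thom T [:: x]; y]
  + sg (hdeg x * hdeg y) *: T [:: thom T [:: y]; x] = 0.
Proof.
have s1 := sg_thom1 x; have s2 := sg_thom1 y; have er := sgM2 K (hdeg x) (hdeg y).
have hx x1 x2 v : red2 x1 x2 = v -> hval (thom T [:: x1; x2]) = v.
  by move=> <-; exact: hval_tred.
have h1 z v : red1 z = v -> hval (thom T [:: z]) = v.
  by move=> <-; exact: hval_tred.
have [a c sx ex|b e sx ex] := red_parityP K0 x; have [f h sy ey|g k sy ey] := red_parityP K0 y;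
  rewrite sx ?opprK in s1; rewrite sy ?opprK in s2;
  rewrite sx sy ?if11 ?(ifN1 K0) in er; rewrite er.
- apply: (rd_comb2 (red1_rd K0 (hx _ _ _ (red2_even ex ey)))
    (red2_odd_even s1 (h1 _ _ (red1_rd K0 ex)) ey) (red2_odd_even s2 (h1 _ _ (red1_rd K0 ey)) ex)).
  1-4: poly_ring.
- apply: (rd_comb2 (red1_rd K0 (hx _ _ _ (red2_even_odd sx ex ey)))
    (red2_odd s1 (h1 _ _ (red1_rd K0 ex)) ey) (red2_even (h1 _ _ (red1_rd K0 ey)) ex)).
  1-4: poly_ring.
- apply: (rd_comb2 (red1_rd K0 (hx _ _ _ (red2_odd_even sx ex ey)))
    (red2_even (h1 _ _ (red1_rd K0 ex)) ey) (red2_odd s2 (h1 _ _ (red1_rd K0 ey)) ex)).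
  1-4: poly_ring.
apply: (rd_comb2 (red1_rd K0 (hx _ _ _ (red2_odd sx ex ey)))
  (red2_even_odd s1 (h1 _ _ (red1_rd K0 ex)) ey) (red2_even_odd s2 (h1 _ _ (red1_rd K0 ey)) ex)).
1-4: poly_ring.
Qed.

(** The graded Jacobi identity in shifted form, checked for the eight parity patterns. *)
Lemma tred_square3 x y z :
  T [:: thom T [:: x; y]; z]
  + sg (hdeg y * hdeg z) *: T [:: thom T [:: x; z]; y]
  + sg (hdeg x * (hdeg y + hdeg z)) *: T [:: thom T [:: y; z]; x] = 0.
Proof.
have s12 := sg_thom2 x y; have s13 := sg_thom2 x z; have s23 := sg_thom2 y z.
have er := sgM2 K (hdeg y) (hdeg z); have es := sgM2 K (hdeg x) (hdeg y + hdeg z).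
rewrite sgD in es.
have hx x1 x2 v : red2 x1 x2 = v -> hval (thom T [:: x1; x2]) = v.
  by move=> <-; exact: hval_tred.
have [a c sx ex|b e sx ex] := red_parityP K0 x; have [f h sy ey|g k sy ey] := red_parityP K0 y;
  have [f' h' sz ez|g' k' sz ez] := red_parityP K0 z;
  rewrite sx sy ?(mulr1, mulrN1, mul1r, opprK) in s12;
  rewrite sx sz ?(mulr1, mulrN1, mul1r, opprK) in s13;
  rewrite sy sz ?(mulr1, mulrN1, mul1r, opprK) in s23;
  rewrite sy sz ?if11 ?(ifN1 K0) in er;
  rewrite sx sy sz ?if11 ?(ifN1 K0) ?(mulr1, mulrN1, mul1r, opprK) in es;
  rewrite er es.
- apply: (rd_comb3 (red2_odd_even s12 (hx _ _ _ (red2_even ex ey)) ez)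
    (red2_odd_even s13 (hx _ _ _ (red2_even ex ez)) ey)
    (red2_odd_even s23 (hx _ _ _ (red2_even ey ez)) ex)).
  1-4: poly_ring.
- apply: (rd_comb3 (red2_odd s12 (hx _ _ _ (red2_even ex ey)) ez)
    (red2_even (hx _ _ _ (red2_even_odd sx ex ez)) ey)
    (red2_even (hx _ _ _ (red2_even_odd sy ey ez)) ex)).
  1-4: poly_ring.
- apply: (rd_comb3 (red2_even (hx _ _ _ (red2_even_odd sx ex ey)) ez)
    (red2_odd s13 (hx _ _ _ (red2_even ex ez)) ey)
    (red2_even (hx _ _ _ (red2_odd_even sy ey ez)) ex)).
  1-4: poly_ring.
- apply: (rd_comb3 (red2_even_odd s12 (hx _ _ _ (red2_even_odd sx ex ey)) ez)
    (red2_even_odd s13 (hx _ _ _ (red2_even_odd sx ex ez)) ey)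
    (red2_odd_even s23 (hx _ _ _ (red2_odd sy ey ez)) ex)).
  1-4: poly_ring.
- apply: (rd_comb3 (red2_even (hx _ _ _ (red2_odd_even sx ex ey)) ez)
    (red2_even (hx _ _ _ (red2_odd_even sx ex ez)) ey)
    (red2_odd s23 (hx _ _ _ (red2_even ey ez)) ex)).
  1-4: poly_ring.
- apply: (rd_comb3 (red2_even_odd s12 (hx _ _ _ (red2_odd_even sx ex ey)) ez)
    (red2_odd_even s13 (hx _ _ _ (red2_odd sx ex ez)) ey)
    (red2_even_odd s23 (hx _ _ _ (red2_even_odd sy ey ez)) ex)).
  1-4: poly_ring.
- apply: (rd_comb3 (red2_odd_even s12 (hx _ _ _ (red2_odd sx ex ey)) ez)
    (red2_even_odd s13 (hx _ _ _ (red2_odd_even sx ex ez)) ey)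
    (red2_even_odd s23 (hx _ _ _ (red2_odd_even sy ey ez)) ex)).
  1-4: poly_ring.
apply: (rd_comb3 (red2_odd s12 (hx _ _ _ (red2_odd sx ex ey)) ez)
    (red2_odd s13 (hx _ _ _ (red2_odd sx ex ez)) ey)
    (red2_odd s23 (hx _ _ _ (red2_odd sy ey ez)) ex)).
1-4: poly_ring.
Qed.

Lemma tred_square w : shsum w (fun u v : seq (homog V) => T (thom T u :: v)) = 0.
Proof.
have d0 : schouten_red (0 : GG_red K) = fun=> 0.
  by apply: funext => v; exact: (linear0f (schouten_red_linearl K0 v)).
have r1 x : T [:: x] = red1 x by [].
have r2 x y : T [:: x; y] = red2 x y by [].
have r3 x y z w' : T [:: x, y, z & w'] = 0 by [].
have n1 (u : seq (homog V)) : T u = 0 -> T [:: thom T u] = 0.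
  by move=> u0; rewrite r1 /red1 hval_tred u0; exact: (linear0f (delta_red_linear K0)).
have n2 (u : seq (homog V)) x : T u = 0 -> T [:: thom T u; x] = 0.
  by move=> u0; rewrite r2 /red2 hval_tred u0 d0; exact: scaler0.
case: w => [|x [|y [|z [|t w]]]].
- by rewrite shsum_nil n1.
- rewrite shsum1 n2 // addr0 r1 /red1 hval_tred r1 /red1 -(rcK K0 (hval x)).
  by rewrite !(delta_red_rd K0); exact: rd0.
- by rewrite shsum2 r3 addr0; exact: tred_square2.
- rewrite shsum3 !r3 n1 // !scaler0 !(add0r, addr0) ?addrA.
  exact: tred_square3.
(* Two coefficients of arity at most 2 compose to arity at most 3. *)
rewrite -[RHS](shsum0 _ [:: x, y, z, t & w]); apply: eq_shsum => u v _ s.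
case: v s => [|? [|? ?]] s; last exact: r3.
  by apply: n1; case: u s => [|? [|? [|? ?]]].
by apply: n2; case: u s => [|? [|? [|? ?]]].
Qed.

Lemma tred_Linfty : dgla_Linfty (@delta_red K) (@schouten_red K) (tcoder T).
Proof.
have tc := tred_compat K0; have td := tred_deg K0; split.
  by apply: tcoder_Linfty => //; exact: tred_square.
by move=> w; rewrite (taylor_tcoder tc td) shift_map_red.
Qed.

End ReducedSquare.

(** * The characteristic cocycle *)

Section CharacteristicClass.
Variable K : fieldType.
Hypothesis K0 : forall n, n.+1%:R != 0 :> K.
Local Notation sg n := ((-1) ^ (n) : K).
Local Notation c0 := (hc0 K0).
Local Notation c1 := (hc1 K0).

Definition harm (y : HH K) : GG K := rdel (c0 y) 0 0 (c1 y).
Definition harm2 (y y' : HH K) : GG K :=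
  rdel 0 (((c0 y)^`() * c1 y' - c1 y * (c0 y')^`()) *+ 2) 0 0.

Lemma coh_single (y : homog (HH K)) :
  [\/ c0 (hval y) = 0 /\ c1 (hval y) = 0, hdeg y = -1 /\ c1 (hval y) = 0
   | hdeg y = 2 /\ c0 (hval y) = 0].
Proof.
have h : gpr (hdeg y) (hval y) = hval y := homogP y.
have := congr1 c0 h; have := congr1 c1 h.
rewrite -{1 3}(hcK K0 (hval y)) (gpr_hh K0) !hcE => e1 e0.
have [d1|d1] := eqVneq (hdeg y) (-1).
  by apply: Or32; split=> //; rewrite -e1 d1.
have [d2|d2] := eqVneq (hdeg y) 2.
  by apply: Or33; split=> //; rewrite -e0 d2.
by apply: Or31; rewrite -e0 -e1 (negbTE d1) (negbTE d2).
Qed.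

Lemma coh_odd (y : homog (HH K)) :
  (sg (hdeg y) = -1 /\ c1 (hval y) = 0) \/ (sg (hdeg y) = 1 /\ c0 (hval y) = 0).
Proof.
case: (coh_single y) => [[z0 z1]|[-> z]|[-> z]].
- by case: (sg_cases K (hdeg y)); [right|left].
- by left; rewrite sg_odd.
by right; split=> //; rewrite -[2]/(1 + 1) sgD mulrNN mulr1.
Qed.

Lemma rdel0 : rdel 0 0 0 0 = 0 :> GG K.
Proof. by rewrite /rdel Cq0 !mul0r mk8_0. Qed.

Lemma rdelD a b c e a' b' c' e' : (rdel a b c e : GG K) + rdel a' b' c' e'
  = rdel (a + a') (b + b') (c + c') (e + e') :> GG K.
Proof. by have := rdel_linear 1 a b c e a' b' c' e'; rewrite !scale1r => ->. Qed.

Lemma rdel_linear1 s b b' :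
  rdel 0 (s *: b + b') 0 0 = s *: (rdel 0 b 0 0 : GG K) + rdel 0 b' 0 0 :> GG K.
Proof. by have := rdel_linear s 0 b 0 0 0 b' 0 0; rewrite !scaler0 !addr0. Qed.

Lemma rdelZ1 s b : s *: (rdel 0 b 0 0 : GG K) = rdel 0 (s *: b) 0 0 :> GG K.
Proof. by have := rdel_linear1 s b 0; rewrite rdel0 !addr0. Qed.

Lemma gpr_rdel1 i b :
  gpr i (rdel 0 b 0 0 : GG K) = rdel 0 (if i == 0 then b else 0) 0 0 :> GG K.
Proof.
apply: etrans (form_part_rdel _ _ _ _ _) _; rewrite !if_same.
by rewrite -(inj_eq (addIr 1) i 0) add0r eq_sym.
Qed.

Lemma harm_linear : linear harm.
Proof.
have [l0 l1] := hc_linear K0; move=> s x y.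
have := rdel_linear s (c0 x) 0 0 (c1 x) (c0 y) 0 0 (c1 y).
by rewrite !scaler0 !addr0 /harm l0 l1.
Qed.

Lemma gpr_harm (y : homog (HH K)) : gpr (hdeg y) (harm (hval y)) = harm (hval y).
Proof.
have h : gpr (hdeg y) (hval y) = hval y := homogP y.
have := congr1 c0 h; have := congr1 c1 h.
rewrite -{1 3}(hcK K0 (hval y)) (gpr_hh K0) !hcE => e1 e0.
apply: etrans (form_part_rdel (hdeg y + 1) _ _ _ _) _; rewrite !if_same.
have t (m : int) : (m + 1 == hdeg y + 1) = (hdeg y == m) by rewrite (inj_eq (addIr _)) eq_sym.
by rewrite -(t (-1)) in e0; rewrite -(t 2) in e1; congr rdel.
Qed.

Lemma harm2_linear : (forall y, linear (harm2^~ y)) /\ (forall y, linear (harm2 y)).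
Proof.
have [l0 l1] := hc_linear K0.
by split=> y s x x'; apply: etrans (rdel_linear1 _ _ _); rewrite /harm2 l0 l1 derivD derivZ;
  move: (c0 x) (c0 x') (c0 y) (c1 x) (c1 x') (c1 y) => *; congr rdel; rewrite -!mul_polyC; ring.
Qed.

Lemma gpr_harm2 (y y' : homog (HH K)) :
  gpr (hdeg y + hdeg y' - 1) (harm2 (hval y) (hval y')) = harm2 (hval y) (hval y').
Proof.
rewrite /harm2; set b := _ *+ 2; rewrite gpr_rdel1.
have [->|->] : b = 0 \/ hdeg y + hdeg y' - 1 = 0; rewrite ?if_same // /b.
case: (coh_single y) => [[-> ->]|[-> ->]|[-> ->]]; case: (coh_single y') => [[-> ->]|[-> ->]|[-> ->]];
  by rewrite ?deriv0 ?(mul0r, mulr0, subr0, mul0rn); auto.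
Qed.

Lemma harm2_anti (y y' : homog (HH K)) :
  harm2 (hval y) (hval y') = - (sg (hdeg y * hdeg y') *: harm2 (hval y') (hval y)).
Proof.
rewrite sgM2 /harm2 -scaleNr rdelZ1; congr rdel.
case: (coh_odd y) => [] [-> ->]; case: (coh_odd y') => [] [-> ->];
  rewrite ?if11 ?(ifN1 K0) ?opprK ?(scale1r, scaleN1r) ?deriv0; ring.
Qed.

Lemma harm_bracket y y' : delta_g (harm2 y y') + schouten (harm y) (harm y') = 0 :> GG K.
Proof.
rewrite /harm2 /harm (delta_rdel K0); set t := schouten _ _.
have -> : t = _ := schouten_rdel K0 _ _ _ _ _ _ _ _.
rewrite rdelD -rdel0; congr rdel; rewrite ?deriv0 -?mul_polyC; ring.
Qed.

Lemma harm_char_data : char_data (@schouten K) harm harm2.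
Proof.
split.
- split; first exact: harm_linear.
  by move=> y; split; [exact: gpr_harm|exact: delta_harm|exact: hcK].
- exact: harm2_linear.
- exact: gpr_harm2.
- exact: harm2_anti.
move=> y y'; rewrite (cohom_br0 K0) (linear0f harm_linear) subr0.
exact: harm_bracket.
Qed.

End CharacteristicClass.

Section CharacteristicCocycle.
Variable K : fieldType.
Hypothesis K0 : forall n, n.+1%:R != 0 :> K.
Local Notation sg n := ((-1) ^ (n) : K).
Local Notation V := (gshift (HH K)).
Local Notation c0 := (hc0 K0).
Local Notation c1 := (hc1 K0).
Implicit Types (x y z : homog V).

(* The ternary operation on the classes of f_i 1 + g_i Omega: its components are
   - 8 q f1' f2' g and - 8 q f' (g h' - g' h), up to permutation. *)
Definition cubic0 (f1 g1 f2 g2 f3 g3 : {poly K}) : {poly K} :=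
  'X * (f1^`() * f2^`() * g3 + f1^`() * g2 * f3^`() + g1 * f2^`() * f3^`()).
Definition cubic1 (f1 g1 f2 g2 f3 g3 : {poly K}) : {poly K} :=
  'X * (f1^`() * (g2 * g3^`() - g2^`() * g3) + f2^`() * (g1 * g3^`() - g1^`() * g3)
    + f3^`() * (g1 * g2^`() - g1^`() * g2)).

Definition cubic x y z : V :=
  hh (-8 *: cubic0 (c0 (hval x)) (c1 (hval x)) (c0 (hval y)) (c1 (hval y)) (c0 (hval z)) (c1 (hval z)))
     (-8 *: cubic1 (c0 (hval x)) (c1 (hval x)) (c0 (hval y)) (c1 (hval y)) (c0 (hval z)) (c1 (hval z))).

Definition tcoh : seq (homog V) -> V := word3 cubic.

Lemma hhZ s p r : s *: hh p r = hh (s *: p) (s *: r) :> HH K.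
Proof. by have := hh_linear K0 s p r 0 0; rewrite (hh0 K0) !addr0. Qed.

Lemma harm2_0 (y : HH K) : harm2 K0 0 y = 0 /\ harm2 K0 y 0 = 0.
Proof.
have [l l'] := harm2_linear K0.
by split; [exact: (linear0f (l y))|exact: (linear0f (l' y))].
Qed.

Lemma harm_harm2 (y y2 y3 : HH K) (b : {poly K} := ((c0 y2)^`() * c1 y3 - c1 y2 * (c0 y3)^`()) *+ 2) :
  schouten (harm K0 y) (harm2 K0 y2 y3) =
  rdel (-2 *: 'X * ((c0 y)^`() * b)) 0 0
    (b * c1 y *+ 3 - -2 *: 'X * (b^`() * c1 y - b * (c1 y)^`())) :> GG K.
Proof.
apply: etrans (schouten_rdel K0 _ _ _ _ _ _ _ _) _; rewrite -/b.
by congr rdel; rewrite ?deriv0; ring.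
Qed.

Lemma rdelZ s a e : s *: (rdel a 0 0 e : GG K) = rdel (s *: a) 0 0 (s *: e) :> GG K.
Proof. by have := rdel_linear s a 0 0 e 0 0 0 0; rewrite rdel0 !scaler0 !addr0. Qed.

Lemma rdel_comb3 (s1 s2 s3 : K) (A B C : GG K) a e a' e' a'' e'' :
  A = rdel a 0 0 e -> B = rdel a' 0 0 e' -> C = rdel a'' 0 0 e'' ->
  s1 *: A - s2 *: B + s3 *: C
  = rdel (s1 *: a - s2 *: a' + s3 *: a'') 0 0 (s1 *: e - s2 *: e' + s3 *: e'').
Proof.
move=> -> -> ->; rewrite -!scaleNr (rdelZ s1) (rdelZ (- s2)) (rdelZ s3).
by rewrite (rdelD (s1 *: a)) rdelD !addr0.
Qed.

Lemma drop3 (W : lmodType K) (A B C D E F : W) (s t : K) : D = 0 -> E = 0 -> F = 0 ->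
  A - B + C - D + s *: E - t *: F = A - B + C.
Proof. by move=> -> -> ->; rewrite !scaler0 !subr0 addr0. Qed.

(** [w0] and [w1] are the coefficients of 1 and Ω in [w3]. The three Koszul signs are parameters, so
    that they can be evaluated by parity before the polynomials are compared. *)
Definition w0 (s1 s2 s3 : K) (f1 g1 f2 g2 f3 g3 : {poly K}) : {poly K} :=
  s1 *: (-2 *: 'X * (f1^`() * ((f2^`() * g3 - g2 * f3^`()) *+ 2)))
  - s2 *: (-2 *: 'X * (f2^`() * ((f1^`() * g3 - g1 * f3^`()) *+ 2)))
  + s3 *: (-2 *: 'X * (f3^`() * ((f1^`() * g2 - g1 * f2^`()) *+ 2))).

Definition w1_term (g1 b : {poly K}) : {poly K} :=
  b * g1 *+ 3 - -2 *: 'X * (b^`() * g1 - b * g1^`()).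
Definition w1 (s1 s2 s3 : K) (f1 g1 f2 g2 f3 g3 : {poly K}) : {poly K} :=
  s1 *: w1_term g1 ((f2^`() * g3 - g2 * f3^`()) *+ 2)
  - s2 *: w1_term g2 ((f1^`() * g3 - g1 * f3^`()) *+ 2)
  + s3 *: w1_term g3 ((f1^`() * g2 - g1 * f2^`()) *+ 2).

Lemma w3_harm (x y z : homog (HH K)) :
  w3 (@schouten K) (harm K0) (harm2 K0) x y z =
  rdel (w0 (sg (hdeg x)) (sg (hdeg y + hdeg x * hdeg y)) (sg (hdeg z + hdeg z * (hdeg x + hdeg y)))
          (c0 (hval x)) (c1 (hval x)) (c0 (hval y)) (c1 (hval y)) (c0 (hval z)) (c1 (hval z))) 0 0
       (w1 (sg (hdeg x)) (sg (hdeg y + hdeg x * hdeg y)) (sg (hdeg z + hdeg z * (hdeg x + hdeg y)))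
          (c0 (hval x)) (c1 (hval x)) (c0 (hval y)) (c1 (hval y)) (c0 (hval z)) (c1 (hval z))) :> GG K.
Proof.
have br0 (u v t : HH K) : harm2 K0 (cohom_br (@schouten K) u v) t = 0.
  by rewrite (cohom_br0 K0); case: (harm2_0 t).
apply: etrans (drop3 _ _ _ _ _ (br0 _ _ _) (br0 _ _ _) (br0 _ _ _)) _.
exact: rdel_comb3 (harm_harm2 _ _ _) (harm_harm2 _ _ _) (harm_harm2 _ _ _).
Qed.

Lemma z3_cubic x y z :
  shift_map (z3 (@schouten K) (harm K0) (harm2 K0)) [:: x; y; z] = cubic x y z.
Proof.
pose X := susp x; pose Y := susp y; pose Z := susp z.
(* Each letter contributes its degree once for every letter after it, so the exponent is 2 |X| +
   |Y|. *)
have sE : sg (shift_sign [:: X; Y; Z]) = sg (hdeg Y).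
  have -> : shift_sign [:: X; Y; Z] = hdeg X + hdeg X + hdeg Y.
    by rewrite /=; move: (hdeg X) (hdeg Y) (hdeg Z) => a b c; ring.
  move: (hdeg X) (hdeg Y) => a b; rewrite !sgD.
  by case: (sg_cases K a) => ->; rewrite ?mulrNN !mul1r.
transitivity (sg (hdeg Y) *: hcls (w3 (@schouten K) (harm K0) (harm2 K0) X Y Z)).
  by rewrite -sE.
rewrite w3_harm (hcls_rdel K0) hhZ /cubic.
rewrite -[hval x]/(hval X) -[hval y]/(hval Y) -[hval z]/(hval Z).
move: (coh_odd K0 X) (coh_odd K0 Y) (coh_odd K0 Z).
move: (hdeg X) (hdeg Y) (hdeg Z) (c0 (hval X)) (c0 (hval Y)) (c0 (hval Z))
  (c1 (hval X)) (c1 (hval Y)) (c1 (hval Z)) => {X Y Z sE} n1 n2 n3 f1 f2 f3 g1 g2 g3.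
rewrite !sgD !sgM2 !sgD.
move=> [] [-> ->] [] [-> ->] [] [-> ->];
  rewrite ?(mulr1, mulrN1, mul1r, opprK) ?if11 ?(ifN1 K0); congr hh;
  rewrite /w0 /cubic0 /w1 /w1_term /cubic1.
all: rewrite ?(scale1r, scaleN1r, deriv0, scaler0, mulr0, mul0r, mul0rn, subrr, oppr0, addr0, add0r, sub0r).
all: rewrite ?(derivMn, derivN, derivM) -?mul_polyC; ring.
Qed.

End CharacteristicCocycle.

Section CohomologyStructure.
Variable K : fieldType.
Hypothesis K0 : forall n, n.+1%:R != 0 :> K.
Local Notation sg n := ((-1) ^ (n) : K).
Local Notation V := (gshift (HH K)).
Local Notation c0 := (hc0 K0).
Local Notation c1 := (hc1 K0).
Implicit Types (x y z : homog V) (w : seq (homog V)).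
Local Notation T := (tcoh K0).

Lemma coh_sign x :
  (sg (hdeg x) = 1 /\ c1 (hval x) = 0) \/ (sg (hdeg x) = -1 /\ c0 (hval x) = 0).
Proof.
have [p s h|p s h] := coh_parityP K0 x; [left|right]; split=> //.
  by have := congr1 c1 h; rewrite hcE.
by have := congr1 c0 h; rewrite hcE.
Qed.

Lemma coh_degree x :
  [\/ c0 (hval x) = 0 /\ c1 (hval x) = 0, hdeg x = -2 /\ c1 (hval x) = 0
   | hdeg x = 1 /\ c0 (hval x) = 0].
Proof.
have [[z0|d0] [z1|d1]] := coh_homog K0 x.
- exact: Or31.
- exact: Or33.
- exact: Or32.
by rewrite d0 in d1.
Qed.

Lemma tcoh_compat : sym_compat T.
Proof.
have [l0 l1] := hc_linear K0.
apply: word3_compat.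
- move=> y z s x x' x'' _ _ e; apply: etrans (hh_linear K0 _ _ _ _ _).
  rewrite /cubic e l0 l1; congr hh; rewrite /cubic0 /cubic1 !(derivD, derivZ) -!mul_polyC; ring.
- move=> x y z; apply: etrans (esym (hhZ K0 _ _ _)); rewrite sgM2 /cubic; move: (coh_sign x) (coh_sign y).
  move: (c0 (hval x)) (c1 (hval x)) (c0 (hval y)) (c1 (hval y)) (c0 (hval z)) (c1 (hval z)).
  move: (hdeg x) (hdeg y) => n1 n2 f1 g1 f2 g2 f3 g3.
  by move=> [] [-> ->] [] [-> ->]; rewrite ?if11 ?(ifN1 K0); congr hh;
    rewrite /cubic0 /cubic1 ?deriv0 ?(scale1r, scaleN1r) -?scalerN; congr (_ *: _); ring.
move=> x y z; apply: etrans (esym (hhZ K0 _ _ _)); rewrite sgM2 /cubic; move: (coh_sign y) (coh_sign z).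
move: (c0 (hval x)) (c1 (hval x)) (c0 (hval y)) (c1 (hval y)) (c0 (hval z)) (c1 (hval z)).
move: (hdeg y) (hdeg z) => n1 n2 f1 g1 f2 g2 f3 g3.
by move=> [] [-> ->] [] [-> ->]; rewrite ?if11 ?(ifN1 K0); congr hh;
  rewrite /cubic0 /cubic1 ?deriv0 ?(scale1r, scaleN1r) -?scalerN; congr (_ *: _); ring.
Qed.

Definition degree_cond (n : int) (f g : {poly K}) :=
  [\/ f = 0 /\ g = 0, n = -2 /\ g = 0 | n = 1 /\ f = 0].

Lemma cubic_degree n1 n2 n3 f1 g1 f2 g2 f3 g3 :
  degree_cond n1 f1 g1 -> degree_cond n2 f2 g2 -> degree_cond n3 f3 g3 ->
  (if n1 + n2 + n3 + 1 + 1 == -1 then -8 *: cubic0 f1 g1 f2 g2 f3 g3 else 0)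
    = -8 *: cubic0 f1 g1 f2 g2 f3 g3 /\
  (if n1 + n2 + n3 + 1 + 1 == 2 then -8 *: cubic1 f1 g1 f2 g2 f3 g3 else 0)
    = -8 *: cubic1 f1 g1 f2 g2 f3 g3.
Proof.
move=> [] [-> ->] [] [-> ->] [] [-> ->]; split;
  by rewrite /cubic0 /cubic1 ?deriv0 ?(mul0r, mulr0, subr0, addr0, oppr0, scaler0) ?if_same.
Qed.

Lemma tcoh_deg w : gpr (wdeg w + 1) (T w) = T w.
Proof.
have g0 i : @gpr K V i 0 = 0 := linear0f (@gpr_linear K V i).
case: w => [|x [|y [|z [|t w]]]]; try exact: g0.
have [e0 e1] := cubic_degree (coh_degree x) (coh_degree y) (coh_degree z).
apply: etrans (gpr_hh K0 _ _ _) _; apply: f_equal2.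
  by rewrite -[RHS]e0 !wdeg_cons wdeg_nil addr0 addrA.
by rewrite -[RHS]e1 !wdeg_cons wdeg_nil addr0 addrA.
Qed.

Lemma shift_map_coh w : shift_map (z3 (@schouten K) (harm K0) (harm2 K0)) w = T w.
Proof.
case: w => [|x [|y [|z [|t w]]]]; try exact: scaler0.
exact: z3_cubic.
Qed.

Lemma taylor_coh w : taylor (tcoder T) w = T w.
Proof. exact: (taylor_tcoder tcoh_compat tcoh_deg). Qed.

End CohomologyStructure.

Section MoreShort.
Variables (K : fieldType) (V : gspace K) (W : lmodType K).
Local Notation sg n := ((-1) ^ (n) : K).
Implicit Types (x y z : homog V).

Lemma shsum3_mid x y z (T : seq (homog V) -> seq (homog V) -> W) :
  (forall u v, size u = 0%N -> T u v = 0) -> (forall u v, size v = 0%N -> T u v = 0) ->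
  shsum [:: x; y; z] T = T [:: x; y] [:: z]
  + sg (hdeg y * hdeg z) *: T [:: x; z] [:: y]
  + T [:: x] [:: y; z] + sg (hdeg x * (hdeg y + hdeg z)) *: T [:: y; z] [:: x]
  + sg (hdeg x * hdeg y) *: T [:: y] [:: x; z]
  + sg (hdeg y * hdeg z) *: (sg (hdeg x * hdeg z) *: T [:: z] [:: x; y]).
Proof. by move=> T0 T0'; rewrite shsum3 (T0 [::]) // (T0' _ [::]) // add0r addr0. Qed.

Lemma shsum3_all x y z (T : seq (homog V) -> seq (homog V) -> W) :
  (forall u v, size u != 3 -> T u v = 0) ->
  shsum [:: x; y; z] T = T [:: x; y; z] [::].
Proof.
move=> T0; rewrite shsum3.
by rewrite !(T0 [:: _; _], T0 [:: _], T0 [::]) // !(scaler0, addr0).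
Qed.

Lemma shsum2_mid x y (T : seq (homog V) -> seq (homog V) -> W) :
  (forall u v, size u = 0%N -> T u v = 0) -> (forall u v, size v = 0%N -> T u v = 0) ->
  shsum [:: x; y] T = T [:: x] [:: y] + sg (hdeg x * hdeg y) *: T [:: y] [:: x].
Proof. by move=> T0 T0'; rewrite shsum2 (T0 [::]) // (T0' _ [::]) // add0r addr0. Qed.
End MoreShort.

(** * The morphism with Taylor coefficients φ_1 and φ_2 *)

Section Morphism.
Variable K : fieldType.
Hypothesis K0 : forall n, n.+1%:R != 0 :> K.
Local Notation VH := (gshift (HH K)).
Local Notation VR := (gshift (GG_red K)).
Local Notation c0 := (hc0 K0).
Local Notation c1 := (hc1 K0).
Local Notation T := (tcoh K0).
Local Notation TR := (@tred K).
Implicit Types (x y z : homog VH) (u v w : seq (homog VH)).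

Definition mor1 x : VR := rd (c0 (hval x)) 0 0 (c1 (hval x)).
(** The factor -2 makes the differential of φ_2 cancel the bracket of the φ_1. The summands have
    equal signs, unlike in [harm2], because the shift turns antisymmetry into graded symmetry. *)
Definition mor2 x y : VR :=
  rd 0 (-2 *: ((c0 (hval x))^`() * c1 (hval y) + c1 (hval x) * (c0 (hval y))^`())) 0 0.
Definition tphi : seq (homog VH) -> VR := word12 mor1 mor2.

Lemma tphi_compat : sym_compat tphi.
Proof.
have [l0 l1] := hc_linear K0.
have lin := rd_linear K0.
apply: word12_compat.
- move=> s x x' x'' _ _ e; rewrite /mor1 e l0 l1.
  by apply: etrans (lin _ _ _ _ _ _ _ _ _); rewrite !scaler0 !addr0.
- move=> y s x x' x'' _ _ e; have lin1 s' (b b' : {poly K}) :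
      rd 0 (s' *: b + b') 0 0 = s' *: (rd 0 b 0 0 : VR) + rd 0 b' 0 0.
    by apply: etrans (lin _ _ _ _ _ _ _ _ _); rewrite !scaler0 !addr0.
  apply: etrans (lin1 _ _ _); rewrite /mor2 e l0 l1; apply: rd_eq => //.
  by rewrite derivD derivZ -!mul_polyC; ring.
move=> x y; apply: etrans (esym (rdZ K0 _ _ _ _ _)).
rewrite sgM2 /mor2; move: (coh_sign K0 x) (coh_sign K0 y).
move: (c0 (hval x)) (c1 (hval x)) (c0 (hval y)) (c1 (hval y)).
move: (hdeg x) (hdeg y) => n1 n2 f1 g1 f2 g2.
by move=> [] [-> ->] [] [-> ->]; rewrite ?if11 ?(ifN1 K0); apply: rd_eq;
  rewrite ?deriv0 ?(mulr0, mul0r, addr0, add0r, scaler0, oppr0, scale1r) // mulrC.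
Qed.

Lemma mor_degree n1 n2 f1 g1 f2 g2 : degree_cond n1 f1 g1 -> degree_cond n2 f2 g2 ->
  [/\ (if n1 + 1 == -1 then f1 else 0) = f1, (if n1 + 1 == 2 then g1 else 0) = g1
    & (if n1 + n2 + 1 == 0 then -2 *: (f1^`() * g2 + g1 * f2^`()) else 0)
      = -2 *: (f1^`() * g2 + g1 * f2^`()) :> {poly K}].
Proof.
move=> [] [-> ->] [] [-> ->]; split;
  by rewrite ?deriv0 ?(mul0r, mulr0, subr0, addr0, oppr0, scaler0) ?if_same.
Qed.

Lemma tphi_deg w : gpr (wdeg w) (tphi w) = tphi w.
Proof.
have g0 i : @gpr K VR i 0 = 0 := linear0f (@gpr_linear K VR i).
case: w => [|x [|y [|z w]]]; try exact: g0.
  have [e0 e1 _] := mor_degree (coh_degree K0 x) (coh_degree K0 x).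
  apply: etrans (gpr_rd K0 _ _ _ _ _) _; rewrite wdeg_cons wdeg_nil addr0.
  by apply: rd_eq; rewrite ?if_same.
have [_ _ e] := mor_degree (coh_degree K0 x) (coh_degree K0 y).
apply: etrans (gpr_rd K0 _ _ _ _ _) _; rewrite !wdeg_cons wdeg_nil addr0.
by apply: rd_eq; rewrite ?if_same.
Qed.

Definition phom w : homog VR :=
  exist (fun p : int * VR => gpr p.1 p.2 == p.2) (wdeg w, tphi w) (introT eqP (tphi_deg w)).

Definition phi : Sym VH -> VR := pelim tphi.
Lemma phi_sprod w : phi (sprod w) = tphi w.
Proof. exact: (sym_elimE tphi_compat). Qed.
Lemma phi_linear : linear phi. Proof. exact: (sym_elim_linear tphi_compat). Qed.
Lemma phi_deg w : gpr (wdeg w) (phi (sprod w)) = phi (sprod w).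
Proof. rewrite phi_sprod; exact: tphi_deg. Qed.

Definition mor : Sym VH -> Sym VR := coexp phi.
Lemma mor_linear : linear mor. Proof. exact: (coexp_linear phi_linear). Qed.
Lemma mor_coalg : coalg_morphism mor.
Proof. by apply: (coexp_coalg K0 phi_linear phi_deg); rewrite phi_sprod. Qed.
Lemma taylor_mor w : taylor mor w = tphi w.
Proof.
rewrite -[RHS]phi_sprod; apply: (taylor_coexp K0 phi_linear phi_deg).
by rewrite phi_sprod.
Qed.

Lemma taylor_mor_coder w :
  spr (mor (tcoder T (sprod w))) = shsum w (fun u v : seq (homog VH) => tphi (thom T u :: v)).
Proof.
have tc := tcoh_compat K0; have td := tcoh_deg K0.
rewrite (comp_tcoder tc td w (f := fun a => spr (mor a))); last first.
  by apply: linear_compf; [exact: spr_linear|exact: mor_linear].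
by apply: eq_shsum => u v _ _; exact: taylor_mor.
Qed.

Lemma spr_tred2 w1 w2 :
  spr (tcoder TR (lsm (tphi w1) (lsm (tphi w2) (sprod [::])))) = red2 (phom w1) (phom w2).
Proof.
rewrite -[tphi w1]/(hval (phom w1)) -[tphi w2]/(hval (phom w2)) !lsm_hval !smulE.
exact: (taylor_tcoder (tred_compat K0) (tred_deg K0)).
Qed.

Lemma taylor_coder_mor w :
  spr (tcoder TR (mor (sprod w))) = red1 (phom w)
    + 2^-1 *: shsum w (fun u v => red2 (phom u) (phom v)).
Proof.
have tc := tred_compat K0; have td := tred_deg K0.
rewrite (quadratic_coalg K0 (d := fun a => spr (tcoder TR a))).
- rewrite taylor_mor -[tphi w]/(hval (phom w)) lsm_hval smulE; congr (_ + _ *: _).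
    exact: (taylor_tcoder tc td).
  by apply: eq_shsum => u v _ _; rewrite !taylor_mor; exact: spr_tred2.
- by apply: linear_compf; [exact: spr_linear|exact: (tcoder_linear tc)].
- by case=> [|x [|y [|z u]]] // _ _; apply: etrans (taylor_tcoder tc td _) _.
- exact: mor_coalg.
exact: mor_linear.
Qed.

End Morphism.

(** * The quasi-isomorphism *)

Section Intertwining.
Variable K : fieldType.
Hypothesis K0 : forall n, n.+1%:R != 0 :> K.
Local Notation sg n := ((-1) ^ (n) : K).
Local Notation VH := (gshift (HH K)).
Local Notation VR := (gshift (GG_red K)).
Local Notation c0 := (hc0 K0).
Local Notation c1 := (hc1 K0).
Local Notation T := (tcoh K0).
Local Notation ph := (phom K0).
Implicit Types (x y z t : homog VH) (u v w : seq (homog VH)).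

Lemma rdDE (A B : VR) a b c e a' b' c' e' :
  A = (rd a b c e : VR) -> B = (rd a' b' c' e' : VR) ->
  A + B = (rd (a + a') (b + b') (c + c') (e + e') : VR).
Proof. by move=> -> ->; exact: (rdDV K0). Qed.

Lemma rdZE s (A : VR) a b c e : A = (rd a b c e : VR) ->
  s *: A = (rd (s *: a) (s *: b) (s *: c) (s *: e) : VR).
Proof. by move=> ->; exact: (rdZ K0). Qed.

Definition quad1 (f1 g1 f2 g2 : {poly K}) : {poly K} := -2 *: (f1^`() * g2 + g1 * f2^`()).

Lemma hval_ph1 x : hval (ph [:: x]) = rd (c0 (hval x)) 0 0 (c1 (hval x)) :> GG_red K.
Proof. by []. Qed.
Lemma hval_ph2 x y : hval (ph [:: x; y])
  = rd 0 (quad1 (c0 (hval x)) (c1 (hval x)) (c0 (hval y)) (c1 (hval y))) 0 0 :> GG_red K.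
Proof. by []. Qed.
Lemma hdeg_ph w : hdeg (ph w) = wdeg w. Proof. by []. Qed.
Lemma sg_ph1 x : sg (hdeg (ph [:: x])) = sg (hdeg x).
Proof. by rewrite hdeg_ph wdeg_cons wdeg_nil addr0. Qed.
Lemma sg_ph2 x y : sg (hdeg (ph [:: x; y])) = sg (hdeg x) * sg (hdeg y).
Proof. by rewrite hdeg_ph !wdeg_cons wdeg_nil addr0 sgD. Qed.

Local Notation P := ('X + 'X).

Lemma red2_11 x y f1 g1 f2 g2 (X := ph [:: x]) (Y := ph [:: y]) :
  c0 (hval x) = f1 -> c1 (hval x) = g1 -> c0 (hval y) = f2 -> c1 (hval y) = g2 ->
  red2 X Y = (rd 0 0 (- sg (hdeg x) *: (f2^`() * g1 + f2^`() * g1 - (f1^`() * g2 + f1^`() * g2))) 0 : VR).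
Proof.
move=> <- <- <- <-; apply: etrans (red2_rd K0 (hval_ph1 x) (hval_ph1 y)) _; rewrite sg_ph1.
by apply: rd_eq; rewrite ?(deriv0, mul0r, mulr0, subr0, oppr0, addr0, scaler0).
Qed.

Lemma red2_12 x y z f g b : c0 (hval x) = f -> c1 (hval x) = g ->
  quad1 (c0 (hval y)) (c1 (hval y)) (c0 (hval z)) (c1 (hval z)) = b ->
  red2 (ph [:: x]) (ph [:: y; z]) = (rd (sg (hdeg x) *: (P * (f^`() * b))) 0 0
   (- sg (hdeg x) *: (b * g + b * g + b * g + P * b^`() * g - P * b * g^`())) : VR).
Proof.
move=> <- <- <-; apply: etrans (red2_rd K0 (hval_ph1 x) (hval_ph2 y z)) _; rewrite sg_ph1.
by apply: rd_eq; rewrite ?(deriv0, mul0r, mulr0, subr0, sub0r, oppr0, add0r, addr0, scaler0) //;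
  rewrite ?scaleNr -?scalerN; congr (_ *: _); ring.
Qed.

Lemma red2_21 x y z f g b : c0 (hval z) = f -> c1 (hval z) = g ->
  quad1 (c0 (hval x)) (c1 (hval x)) (c0 (hval y)) (c1 (hval y)) = b ->
  red2 (ph [:: x; y]) (ph [:: z]) = (rd (- (sg (hdeg x) * sg (hdeg y)) *: (P * (b * f^`()))) 0 0
   (sg (hdeg x) * sg (hdeg y) *: (b * g + b * g + b * g + P * b^`() * g - P * b * g^`())) : VR).
Proof.
move=> <- <- <-; apply: etrans (red2_rd K0 (hval_ph2 x y) (hval_ph1 z)) _; rewrite sg_ph2.
apply: rd_eq; rewrite ?(deriv0, mul0r, mulr0, subr0, sub0r, oppr0, add0r, addr0, scaler0) //.
  by rewrite mulrNN.
by rewrite scaleNr -scalerN; congr (_ *: _); ring.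
Qed.

Lemma red2_22 x y z t b g :
  quad1 (c0 (hval x)) (c1 (hval x)) (c0 (hval y)) (c1 (hval y)) = b ->
  quad1 (c0 (hval z)) (c1 (hval z)) (c0 (hval t)) (c1 (hval t)) = g ->
  red2 (ph [:: x; y]) (ph [:: z; t])
   = (rd 0 (sg (hdeg x) * sg (hdeg y) *: (P * (b^`() * g - b * g^`()))) 0 0 : VR).
Proof.
move=> <- <-; apply: etrans (red2_rd K0 (hval_ph2 x y) (hval_ph2 z t)) _; rewrite sg_ph2.
by apply: rd_eq; rewrite ?(deriv0, mul0r, mulr0, subr0, sub0r, oppr0, add0r, addr0, scaler0) //;
  rewrite ?scaleNr -?scalerN; congr (_ *: _); ring.
Qed.

Lemma hval_thomT w : hval (thom T w) = T w.
Proof. exact: (hval_thom (tcoh_compat K0) (tcoh_deg K0)). Qed.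

Lemma mor_thom1 x y z : tphi K0 [:: thom T [:: x; y; z]]
  = (rd (-8 *: cubic0 (c0 (hval x)) (c1 (hval x)) (c0 (hval y)) (c1 (hval y)) (c0 (hval z)) (c1 (hval z))) 0 0
     (-8 *: cubic1 (c0 (hval x)) (c1 (hval x)) (c0 (hval y)) (c1 (hval y)) (c0 (hval z)) (c1 (hval z))) : VR).
Proof.
rewrite /tphi /= /mor1 hval_thomT /T /=.
by rewrite /cubic !(hcE K0).
Qed.

Lemma mor_thom2 x y z t : tphi K0 [:: thom T [:: x; y; z]; t]
  = (rd 0 (quad1 (-8 *: cubic0 (c0 (hval x)) (c1 (hval x)) (c0 (hval y)) (c1 (hval y)) (c0 (hval z)) (c1 (hval z)))
     (-8 *: cubic1 (c0 (hval x)) (c1 (hval x)) (c0 (hval y)) (c1 (hval y)) (c0 (hval z)) (c1 (hval z)))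
     (c0 (hval t)) (c1 (hval t))) 0 0 : VR).
Proof.
rewrite /tphi /= /mor2 hval_thomT /T /=.
by rewrite /cubic !(hcE K0).
Qed.

Lemma mor_thom0 u v : size u != 3 -> tphi K0 (thom T u :: v) = 0.
Proof.
move=> u3; have T0 : T u = 0 by case: u u3 => [|? [|? [|? [|? ?]]]].
have e := hval_thomT u; rewrite T0 in e.
have z0 : c0 (hval (thom T u)) = 0 by rewrite e; exact: (linear0f (proj1 (hc_linear K0))).
have z1 : c1 (hval (thom T u)) = 0 by rewrite e; exact: (linear0f (proj2 (hc_linear K0))).
case: v => [|y [|? ?]] //; rewrite /tphi /=.
  by rewrite /mor1 z0 z1; exact: (rd0 K0).
by rewrite /mor2 z0 z1 deriv0 !mul0r addr0 scaler0; exact: (rd0 K0).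
Qed.

End Intertwining.

Section IntertwiningWords.
Variable K : fieldType.
Hypothesis K0 : forall n, n.+1%:R != 0 :> K.
Local Notation sg n := ((-1) ^ (n) : K).
Local Notation VH := (gshift (HH K)).
Local Notation VR := (gshift (GG_red K)).
Local Notation c0 := (hc0 K0).
Local Notation c1 := (hc1 K0).
Local Notation T := (tcoh K0).
Local Notation TR := (@tred K).
Local Notation ph := (phom K0).
Implicit Types (x y z t : homog VH) (u v w : seq (homog VH)).

Lemma half_eq (p q : {poly K}) : p = q + q -> 2^-1 *: p = q.
Proof. by move=> ->; rewrite -mulr2n -scaler_nat scalerA mulVf ?scale1r ?(K0 1). Qed.

Lemma red2_0l u v : tphi K0 u = 0 -> red2 (ph u) (ph v) = 0.
Proof.
move=> e; have h : hval (ph u) = (0 : GG_red K) := e.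
by rewrite /red2 h (linear0f (schouten_red_linearl K0 _)); exact: scaler0.
Qed.

Lemma red2_0r u v : tphi K0 v = 0 -> red2 (ph u) (ph v) = 0.
Proof.
move=> e; have h : hval (ph v) = (0 : GG_red K) := e.
by rewrite /red2 h (linear0f (schouten_red_linearr K0 _)); exact: scaler0.
Qed.

Lemma red1_0 u : tphi K0 u = 0 -> red1 (ph u) = 0.
Proof.
move=> e; have h : hval (ph u) = (0 : GG_red K) := e.
by rewrite /red1 h; exact: (linear0f (delta_red_linear K0)).
Qed.

Lemma red2_nill u v : size u = 0%N -> red2 (ph u) (ph v) = 0.
Proof. by move/size0nil ->; apply: red2_0l. Qed.
Lemma red2_nilr u v : size v = 0%N -> red2 (ph u) (ph v) = 0.
Proof. by move/size0nil ->; apply: red2_0r. Qed.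

(** In order two, φ_2 corrects the failure of φ_1 to preserve brackets; the source has no binary
    coefficient. *)
Lemma intertwine2 x y : red1 (ph [:: x; y])
  + 2^-1 *: shsum [:: x; y] (fun u v => red2 (ph u) (ph v)) = 0.
Proof.
rewrite (shsum2_mid _ _ red2_nill red2_nilr).
have e1 := red1_rd K0 (hval_ph2 K0 x y).
have e2 := red2_11 (erefl (c0 (hval x))) (erefl (c1 (hval x))) (erefl (c0 (hval y))) (erefl (c1 (hval y))).
have e3 := red2_11 (erefl (c0 (hval y))) (erefl (c1 (hval y))) (erefl (c0 (hval x))) (erefl (c1 (hval x))).
apply: etrans (rdDE K0 e1 (rdZE K0 2^-1 (rdDE K0 e2 (rdZE K0 (sg (hdeg x * hdeg y)) e3)))) _.
rewrite sgM2; move: (coh_sign K0 x) (coh_sign K0 y).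
move: (c0 (hval x)) (c1 (hval x)) (c0 (hval y)) (c1 (hval y)).
move: (hdeg x) (hdeg y) => {e1 e2 e3} n1 n2 f1 g1 f2 g2 h1 h2.
apply: etrans (rd0 K0); apply: rd_eq; rewrite ?(scaler0, addr0) //.
rewrite /quad1; apply/eqP; rewrite addrC addr_eq0; apply/eqP; apply: half_eq.
by case: h1 => [] [-> ->]; case: h2 => [] [-> ->];
  rewrite ?if11 ?(ifN1 K0) ?(scale1r, scaleN1r, opprK, deriv0) -?mul_polyC; ring.
Qed.

(** In order three the brackets of φ_1 with φ_2 have no component along E or π, so they are harmonic
    and can be matched exactly by φ_1 ∘ d_3, with φ_3 = 0. *)
Lemma intertwine3 x y z : 2^-1 *: shsum [:: x; y; z] (fun u v => red2 (ph u) (ph v))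
  = tphi K0 [:: thom T [:: x; y; z]].
Proof.
rewrite (shsum3_mid _ _ _ red2_nill red2_nilr).
pose f1 := c0 (hval x); pose g1 := c1 (hval x); pose f2 := c0 (hval y); pose g2 := c1 (hval y).
pose f3 := c0 (hval z); pose g3 := c1 (hval z).
have q1 x' y' z' := @red2_12 K K0 x' y' z' _ _ _ erefl erefl erefl.
have q2 x' y' z' := @red2_21 K K0 x' y' z' _ _ _ erefl erefl erefl.
apply: etrans (rdZE K0 _ (rdDE K0 (rdDE K0 (rdDE K0 (rdDE K0 (rdDE K0 (q2 _ _ _)
  (rdZE K0 _ (q2 _ _ _))) (q1 _ _ _)) (rdZE K0 _ (q2 _ _ _)))
   (rdZE K0 _ (q1 _ _ _))) (rdZE K0 _ (rdZE K0 _ (q1 _ _ _))))) _.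
apply: etrans (esym (mor_thom1 K0 x y z)).
rewrite !sgM2 !sgD; move: (coh_sign K0 x) (coh_sign K0 y) (coh_sign K0 z).
move: (c0 (hval x)) (c1 (hval x)) (c0 (hval y)) (c1 (hval y)) (c0 (hval z)) (c1 (hval z)).
move: (hdeg x) (hdeg y) (hdeg z) => {q1 q2 f1 g1 f2 g2 f3 g3} n1 n2 n3 f1 g1 f2 g2 f3 g3 h1 h2 h3.
apply: rd_eq; rewrite ?(scaler0, addr0) //.
all: apply: half_eq; rewrite /quad1 /cubic0 /cubic1.
all: case: h1 => [] [-> ->]; case: h2 => [] [-> ->]; case: h3 => [] [-> ->];
  rewrite ?if11 ?(ifN1 K0) ?(mulrNN, mulrN1, mul1r, mulr1, opprK) ?if11 ?(ifN1 K0) ?(scale1r, scaleN1r, opprK, deriv0, mul0r, mulr0, addr0, add0r, oppr0, scaler0) //.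
all: rewrite ?(derivZ, derivM) -?mul_polyC; ring.
Qed.

Let qee (f f' : {poly K}) : quad1 f 0 f' 0 = 0.
Proof. by rewrite /quad1 mulr0 mul0r addr0 scaler0. Qed.
Let qoo (g g' : {poly K}) : quad1 0 g 0 g' = 0.
Proof. by rewrite /quad1 deriv0 mulr0 mul0r addr0 scaler0. Qed.
Let qeo (f g : {poly K}) : quad1 f 0 0 g = -2 *: (f^`() * g).
Proof. by rewrite /quad1 mul0r addr0. Qed.
Let qoe (f g : {poly K}) : quad1 0 g f 0 = -2 *: (g * f^`()).
Proof. by rewrite /quad1 mulr0 add0r. Qed.

(** In order four the brackets of φ_2 with φ_2 meet φ_2 ∘ d_3. Both sides are multiples of E,
    compared for each of the sixteen parity patterns. *)
Lemma intertwine4 x y z t :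
  2^-1 *: shsum [:: x; y; z; t] (fun u v => red2 (ph u) (ph v))
  = shsum [:: x; y; z; t] (fun u v => tphi K0 (thom T u :: v)).
Proof.
rewrite (shsum4_31 _ _ _ _ (@mor_thom0 K K0)).
(* Only splittings into two and two letters survive, since φ vanishes on the empty word and on more
   than two letters. *)
rewrite (@eq_shsum _ _ _ _ _ (fun u v => if size u == 2 then red2 (ph u) (ph v) else 0)); last first.
  move=> u v _; case: u => [|? [|? [|? u]]] //=; try by rewrite red2_0l.
  by case: v => [|? [|? [|? [|? v]]]] // _; rewrite red2_0r.
rewrite shsum4_22 => [/=|u v /negbTE ->] //.
have q x' y' z' t' := @red2_22 K K0 x' y' z' t' _ _ erefl erefl.
have m := mor_thom2 K0.
apply: etrans (rdZE K0 _ (rdDE K0 (rdDE K0 (rdDE K0 (rdDE K0 (rdDE K0 (q _ _ _ _)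
  (rdZE K0 _ (q _ _ _ _))) (rdZE K0 _ (rdZE K0 _ (q _ _ _ _)))) (rdZE K0 _ (q _ _ _ _)))
  (rdZE K0 _ (rdZE K0 _ (q _ _ _ _)))) (rdZE K0 _ (rdZE K0 _ (q _ _ _ _))))) _.
apply: esym; apply: etrans (rdDE K0 (rdDE K0 (rdDE K0 (m _ _ _ _) (rdZE K0 _ (m _ _ _ _)))
  (rdZE K0 _ (m _ _ _ _))) (rdZE K0 _ (m _ _ _ _))) _; apply: esym.
move: (coh_sign K0 x) (coh_sign K0 y) (coh_sign K0 z) (coh_sign K0 t).
move: (c0 (hval x)) (c1 (hval x)) (c0 (hval y)) (c1 (hval y)) (c0 (hval z)) (c1 (hval z)) (c0 (hval t)) (c1 (hval t)).
move: (hdeg x) (hdeg y) (hdeg z) (hdeg t) => {q m} n1 n2 n3 n4 f1 g1 f2 g2 f3 g3 f4 g4 h1 h2 h3 h4.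
apply: rd_eq; rewrite ?(scaler0, addr0) //.
rewrite !sgM2 !sgD; apply: half_eq.
case: h1 => [] [-> ->]; case: h2 => [] [-> ->]; case: h3 => [] [-> ->];
  case: h4 => [] [-> ->].
all: rewrite ?(mulrNN, mulrN1, mul1r, mulr1, opprK) ?if11 ?(ifN1 K0) ?(mulrNN, mulrN1, mul1r, mulr1, opprK) ?if11 ?(ifN1 K0).
all: rewrite ?(scale1r, scaleN1r) ?qee ?qoo ?qeo ?qoe.
all: rewrite /quad1 /cubic0 /cubic1 ?deriv0 ?mulr0 ?mul0r.
all: rewrite ?oppr0 ?addr0 ?add0r ?mulr0 ?scaler0 ?deriv0 ?mulr0 ?mul0r.
all: rewrite ?(derivZ, derivM, derivD, derivX, derivN, deriv0).
all: rewrite -?mul_polyC; ring.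
Qed.

(** From length five on both sides vanish: one side combines d_3 with at most one further letter,
    the other brackets two values of φ on at most two letters each. *)
Lemma taylor_intertwine w :
  spr (mor K0 (tcoder T (sprod w))) = spr (tcoder TR (mor K0 (sprod w))).
Proof.
rewrite taylor_mor_coder taylor_coder_mor.
have lhs0 w' : (size w' < 3)%N -> shsum w' (fun u v => tphi K0 (thom T u :: v)) = 0.
  move=> w3; rewrite -[RHS](shsum0 _ w'); apply: eq_shsum => u v _ s; apply: mor_thom0.
  by apply: contraTneq w3 => u3; rewrite -s u3 -leqNgt leq_addr.
case: w => [|x [|y [|z [|t [|s w]]]]].
- by rewrite lhs0 // shsum_nil red1_0 // red2_0l // scaler0 addr0.
- rewrite lhs0 // shsum1 red2_nilr // red2_nill // addr0 scaler0 addr0.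
  by apply: esym; apply: etrans (red1_rd K0 (hval_ph1 K0 x)) _; exact: rd0.
- by rewrite lhs0 // intertwine2.
- rewrite shsum3_all; last exact: mor_thom0.
  by rewrite -intertwine3 red1_0 // add0r.
- by rewrite -intertwine4 red1_0 // add0r.
rewrite red1_0 // add0r; apply: etrans (_ : 0 = _).
  rewrite -[RHS](shsum0 _ [:: x, y, z, t, s & w]); apply: eq_shsum => u v _ e.
  have [u3|] := eqVneq (size u) 3; last exact: mor_thom0.
  by move: e; rewrite u3; case: v => [|? [|? v]].
apply: esym; apply: etrans (_ : _ *: 0 = _); last exact: scaler0.
congr (_ *: _); rewrite -[RHS](shsum0 _ [:: x, y, z, t, s & w]).
apply: eq_shsum => u v _; case: u => [|? [|? [|? u]]] /=; try by move=> _; rewrite red2_0l.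
  by case: v => [|? [|? [|? v]]] // _; rewrite red2_0r.
by case: v => [|? [|? [|? v]]] // _; rewrite red2_0r.
Qed.

(** Established before the square of [tcoder T] is known to vanish, and then used to prove this in
    [tcoh_Linfty]. *)
Lemma mor_intertwine a : mor K0 (tcoder T a) = tcoder TR (mor K0 a).
Proof.
have tc := tcoh_compat K0; have td := tcoh_deg K0.
have tc' := tred_compat K0; have td' := tred_deg K0.
have [_] : Linfty_morphism (tcoder T) (tcoder TR) (mor K0); last by apply.
apply: (Linfty_morphism_words K0); [exact: tcoder_coderivation|exact: tcoder_linear
  |exact: tcoder_coderivation|exact: tcoder_linear|exact: mor_coalg|exact: mor_linear|].
exact: taylor_intertwine.
Qed.

(** Makes the injectivity on vectors explicit: both coordinates of v can be read off the value. *)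
Lemma mor_primitive (v : VH) : spr (mor K0 (lsm v (sprod [::]))) = rd (c0 v) 0 0 (c1 v) :> GG_red K.
Proof.
have [l0 l1] := hc_linear K0.
pose g (v : VH) : VR := rd (c0 v) 0 0 (c1 v).
have gl : linear g.
  move=> s a b; apply: etrans (rd_linear K0 _ _ _ _ _ _ _ _ _).
  by apply: rd_eq; rewrite ?(scaler0, addr0) // ?l0 ?l1.
have hl : linear (fun a => spr (mor K0 a)).
  by apply: linear_compf; [exact: spr_linear|exact: mor_linear].
rewrite -[RHS]/(g v) (_ : g v = g (\sum_(i <- gsupp v) gpr i v)); last first.
  by congr g; rewrite /gsupp; case: (cid2 _).
rewrite (linear_sum1 _ _ gl) (linear_sum1 _ _ hl); apply: eq_bigr => i _.
by rewrite smulE; exact: taylor_mor.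
Qed.

(* The square is not expanded on words of length 5: [mor K0] is injective on
   primitive elements and maps it to the square of [tcoder TR], which is 0. *)
Lemma tcoh_Linfty : Linfty_structure (tcoder T).
Proof.
have tc := tcoh_compat K0; have td := tcoh_deg K0.
split; [exact: tcoder_coderivation| |by apply: tcoder_unit].
have [_ sq _] := proj1 (tred_Linfty K0).
apply: (coderivation_sq_eq0 K0); [exact: tcoder_coderivation|exact: tcoder_linear|] => w v e.
have := mor_primitive v; rewrite -e !mor_intertwine sq (linear0f (@spr_linear _ _)).
rewrite -(rd0 K0) => /(rd_inj K0)[z0 _ _ z1].
by rewrite -[v](hcK K0) -z0 -z1; exact: hh0.
Qed.

End IntertwiningWords.

Definition mkhomog (K : fieldType) (V : gspace K) n (v : V) (e : gpr n v = v) : homog V :=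
  exist (fun p : int * V => gpr p.1 p.2 == p.2) (n, v) (introT eqP e).

Lemma gpr0 (K : fieldType) (V : gspace K) n : gpr n (0 : V) = 0.
Proof. exact: (linear0f (@gpr_linear K V n)). Qed.

Section QuasiIso.
Variable K : fieldType.
Hypothesis K0 : forall n, n.+1%:R != 0 :> K.
Local Notation VH := (gshift (HH K)).
Local Notation VR := (gshift (GG_red K)).
Local Notation c0 := (hc0 K0).
Local Notation c1 := (hc1 K0).
Local Notation T := (tcoh K0).
Local Notation TR := (@tred K).
Implicit Types (x y z : homog VH) (u v w : seq (homog VH)).

(** The source differential has no linear part. In the reduced complex the coboundaries are the c π,
    which are harmonic only if 0, and a cocycle a 1 + c π + e Ω differs from its harmonic part by
    the coboundary of c E. *)
Lemma mor_cohomology_iso : cohomology_iso (fun x => taylor (tcoder T) [:: x])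
  (fun y : homog VR => taylor (tcoder TR) [:: y]) (fun x => taylor (mor K0) [:: x]).
Proof.
have tR (w : seq (homog VR)) : taylor (tcoder TR) w = TR w := taylor_tcoder (tred_compat K0) (tred_deg K0) w.
split=> [x _ [y _]|y].
  rewrite tR taylor_mor /=; have v := rcK K0 (hval y).
  rewrite (red1_rd K0 (esym v)) => /(rd_inj K0)[z0 _ _ z1].
  have xz : hval x = 0 by apply: etrans (esym (hcK K0 _)) _; rewrite z0 z1; exact: (hh0 K0).
  exists (mkhomog (gpr0 VH (hdeg x - 1))); first by [].
  by apply: etrans xz _; exact: esym (taylor_coh K0 [:: _]).
rewrite tR; have v := rcK K0 (hval y).
move: (rc0 K0 (hval y)) (rc1 K0 (hval y)) (rc2 K0 (hval y)) (rc3 K0 (hval y)) v => a b c e v.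
move/esym: v => v; rewrite [TR _](red1_rd K0 v) -(rd0 K0) => /(rd_inj K0)[_ _ b0 _].
have : @gpr K (GG_red K) (hdeg y + 1) (hval y) = hval y by exact: homogP y.
rewrite v (gpr_rd K0) => /(rd_inj K0)[ea _ ec ee].
have hx : @gpr K VH (hdeg y) (hh a e) = hh a e.
  by apply: etrans (gpr_hh K0 _ _ _) _; rewrite ea ee.
exists (mkhomog hx); split=> //; first by rewrite taylor_coh.
have hy : @gpr K VR (hdeg y - 1) (rd 0 c 0 0) = rd 0 c 0 0.
  apply: etrans (gpr_rd K0 _ _ _ _ _) _; rewrite !if_same; apply: rd_eq => //.
  by rewrite subrK -(inj_eq (addIr 1)) add0r.
have fx : taylor (mor K0) [:: mkhomog hx] = (rd a 0 0 e : VR).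
  by rewrite taylor_mor /tphi /= /mor1 /hval /= !(hcE K0).
exists (mkhomog hy) => //; rewrite tR fx.
apply: etrans (esym (red1_rd K0 (erefl (hval (mkhomog hy))))).
apply: (@etrans _ _ (rd a 0 c e - rd a 0 0 e : GG_red K)).
  by rewrite -b0 -v.
by rewrite (rdN K0) (rdD K0) !subrr oppr0 !addr0.
Qed.

Lemma cubic_neq0 : hh (-8 *: 'X) 0 <> 0 :> HH K /\ hh 0 (-8 *: 'X) <> 0 :> HH K.
Proof.
have n : -8 *: 'X != 0 :> {poly K}.
  by rewrite scaleNr oppr_eq0 scaler_eq0 negb_or polyX_eq0 (K0 7).
by rewrite -(hh0 K0); split=> /(hh_inj K0)[e0 e1]; move: n; rewrite ?e0 ?e1 eqxx.
Qed.

Lemma hh_deg0 p : @gpr K VH (-2) (hh p 0) = hh p 0.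
Proof. by apply: etrans (gpr_hh K0 _ _ _) _. Qed.
Lemma hh_deg1 r : @gpr K VH 1 (hh 0 r) = hh 0 r.
Proof. by apply: etrans (gpr_hh K0 _ _ _) _. Qed.

Definition hom0 p : homog VH := mkhomog (hh_deg0 p).
Definition hom1 r : homog VH := mkhomog (hh_deg1 r).

Lemma hval_hom0 p : hval (hom0 p) = hh p 0. Proof. by []. Qed.
Lemma hval_hom1 r : hval (hom1 r) = hh 0 r. Proof. by []. Qed.

Lemma cubic_hom_neq0 p r p' r' p'' r'' x y z :
  hval x = hh p r :> HH K -> hval y = hh p' r' :> HH K -> hval z = hh p'' r'' :> HH K ->
  (cubic0 p r p' r' p'' r'' = 'X /\ cubic1 p r p' r' p'' r'' = 0)
  \/ (cubic0 p r p' r' p'' r'' = 0 /\ cubic1 p r p' r' p'' r'' = 'X) ->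
  taylor (tcoder T) [:: x; y; z] <> 0.
Proof.
have hc (u : homog VH) q s : hval u = hh q s :> HH K -> (c0 (hval u) = q) * (c1 (hval u) = s).
  by move=> ->; rewrite !(hcE K0).
move=> ex ey ez h t0; have : cubic K0 x y z = 0 := etrans (esym (taylor_coh K0 _)) t0.
rewrite /cubic !(hc _ _ _ ex) !(hc _ _ _ ey) !(hc _ _ _ ez).
have [ne0 ne1] := cubic_neq0.
by case: h => -[-> ->]; rewrite [-8 *: 0](scaler0 _ (-8)); [exact: ne0|exact: ne1].
Qed.

Lemma perm3_cases (n1 n2 n3 : int) s : perm_eq [:: n1; n2; n3] s ->
  {subset s <= [:: -2; 1]} ->
  [/\ n1 = -2 \/ n1 = 1, n2 = -2 \/ n2 = 1 & n3 = -2 \/ n3 = 1].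
Proof.
move=> /perm_mem m s2.
have h n : n \in [:: n1; n2; n3] -> n = -2 \/ n = 1.
  by rewrite m => /s2; rewrite !inE => /orP[]/eqP; [left|right].
by split; apply: h; rewrite !inE eqxx ?orbT.
Qed.

Lemma cubic_neq0_degrees x y z : cubic K0 x y z <> 0 ->
  perm_eq [:: hdeg x; hdeg y; hdeg z] [:: -2; -2; 1]
  \/ perm_eq [:: hdeg x; hdeg y; hdeg z] [:: -2; 1; 1].
Proof.
move=> ne; move: (coh_degree K0 x) (coh_degree K0 y) (coh_degree K0 z) ne.
rewrite /cubic.
move: (c0 (hval x)) (c1 (hval x)) (c0 (hval y)) (c1 (hval y)) (c0 (hval z)) (c1 (hval z)).
move: (hdeg x) (hdeg y) (hdeg z) => m1 m2 m3 f1 g1 f2 g2 f3 g3 d1 d2 d3 ne.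
have {}ne : ~ (cubic0 f1 g1 f2 g2 f3 g3 = 0 /\ cubic1 f1 g1 f2 g2 f3 g3 = 0).
  by case=> z0 z1; apply: ne; rewrite z0 z1 scaler0; exact: (hh0 K0).
case: d1 ne => [[-> ->]|[-> ->]|[-> ->]]; case: d2 => [[-> ->]|[-> ->]|[-> ->]];
case: d3 => [[-> ->]|[-> ->]|[-> ->]] ne;
try by (case: ne; split; rewrite /cubic0 /cubic1 ?deriv0 ?(mul0r, mulr0, subr0, addr0)).
all: by [left|right].
Qed.

Lemma cubic_degrees (n1 n2 n3 : int) :
  (exists x1 x2 x3 : homog VH,
     [/\ hdeg x1 = n1, hdeg x2 = n2, hdeg x3 = n3 & taylor (tcoder T) [:: x1; x2; x3] <> 0]) <->
  perm_eq [:: n1; n2; n3] [:: -2; -2; 1] \/ perm_eq [:: n1; n2; n3] [:: -2; 1; 1].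
Proof.
split=> [[x [y [z [<- <- <-]]]]|h].
  by rewrite taylor_coh; exact: cubic_neq0_degrees.
have {h} : [\/ [/\ n1 = -2, n2 = -2 & n3 = 1], [/\ n1 = -2, n2 = 1 & n3 = -2]
  | [/\ n1 = 1, n2 = -2 & n3 = -2]] \/ [\/ [/\ n1 = -2, n2 = 1 & n3 = 1],
   [/\ n1 = 1, n2 = -2 & n3 = 1] | [/\ n1 = 1, n2 = 1 & n3 = -2]].
  have [c1' c2' c3'] : [/\ n1 = -2 \/ n1 = 1, n2 = -2 \/ n2 = 1 & n3 = -2 \/ n3 = 1].
    by case: h => /perm3_cases; apply=> n; rewrite !inE; case: (n == -2); case: (n == 1).
  by move: h; case: c1' => ->; case: c2' => ->; case: c3' => -> -[] // _;
    [left; apply: Or31|left; apply: Or32|right; apply: Or31|left; apply: Or33|right; apply: Or32|right; apply: Or33].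
have dX := derivX K.
(* The witnesses are q, q, Ω for the first pattern and q, Ω, q Ω for the second; they make [cubic0],
   respectively [cubic1], equal to ['X]. *)
case=> -[] [-> -> ->].
- exists (hom0 'X), (hom0 'X), (hom1 1); split=> //.
  apply: (cubic_hom_neq0 (hval_hom0 'X) (hval_hom0 'X) (hval_hom1 1)); left.
  by split; rewrite /cubic0 /cubic1 dX ?derivC ?deriv0; ring.
- exists (hom0 'X), (hom1 1), (hom0 'X); split=> //.
  apply: (cubic_hom_neq0 (hval_hom0 'X) (hval_hom1 1) (hval_hom0 'X)); left.
  by split; rewrite /cubic0 /cubic1 dX ?derivC ?deriv0; ring.
- exists (hom1 1), (hom0 'X), (hom0 'X); split=> //.
  apply: (cubic_hom_neq0 (hval_hom1 1) (hval_hom0 'X) (hval_hom0 'X)); left.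
  by split; rewrite /cubic0 /cubic1 dX ?derivC ?deriv0; ring.
- exists (hom0 'X), (hom1 1), (hom1 'X); split=> //.
  apply: (cubic_hom_neq0 (hval_hom0 'X) (hval_hom1 1) (hval_hom1 'X)); right.
  by split; rewrite /cubic0 /cubic1 dX ?derivC ?deriv0; ring.
- exists (hom1 1), (hom0 'X), (hom1 'X); split=> //.
  apply: (cubic_hom_neq0 (hval_hom1 1) (hval_hom0 'X) (hval_hom1 'X)); right.
  by split; rewrite /cubic0 /cubic1 dX ?derivC ?deriv0; ring.
exists (hom1 1), (hom1 'X), (hom0 'X); split=> //.
apply: (cubic_hom_neq0 (hval_hom1 1) (hval_hom1 'X) (hval_hom0 'X)); right.
by split; rewrite /cubic0 /cubic1 dX ?derivC ?deriv0; ring.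
Qed.

End QuasiIso.

Section MinimalModel.
Variable K : fieldType.
Hypothesis K0 : forall n, n.+1%:R != 0 :> K.
Local Notation VH := (gshift (HH K)).
Local Notation VR := (gshift (GG_red K)).
Local Notation c0 := (hc0 K0).
Local Notation c1 := (hc1 K0).
Local Notation T := (tcoh K0).
Local Notation TR := (@tred K).

Definition nat_inj (y : HH K) : GG_red K := rd (c0 y) 0 0 (c1 y).

Lemma nat_inj_linear : linear nat_inj.
Proof.
have [l0 l1] := hc_linear K0; move=> s x y.
apply: etrans (rd_linear K0 _ _ _ _ _ _ _ _ _).
by apply: rd_eq; rewrite ?(scaler0, addr0) // ?l0 ?l1.
Qed.

Lemma nat_injP : natural_injection nat_inj.
Proof.
move=> y; exists (c0 y), (c1 y); split; last by rewrite -[RHS](hcK K0) /hh (harmE K0).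
by apply: etrans (rd_val K0 _ _ _ _) _; exact: harmE.
Qed.

Lemma rdel_one f : rdel f 0 0 0 = smulf (Cq f) (CE_one K).
Proof. by rewrite one_mk8 smulf_mk8 /rdel Cq0 !mul0r mulr1 mulr0. Qed.

Lemma rdel_Euler f : rdel 0 f 0 0 = smulf (Cq f) (Euler K).
Proof. by rewrite Euler_mk8 smulf_mk8 /rdel Cq0 !mul0r mulr0. Qed.

Lemma rdel_Omega f : rdel 0 0 0 f = smulf (Cq f) (Omega K).
Proof. by rewrite (Omega_mk8 K0) smulf_mk8 /rdel Cq0 !mul0r mulr0. Qed.

Lemma hcls_one f : hcls (smulf (Cq f) (CE_one K)) = hh f 0.
Proof. by rewrite /hh rdel_one. Qed.

Lemma hcls_Omega g : hcls (smulf (Cq g) (Omega K)) = hh 0 g.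
Proof. by rewrite /hh rdel_Omega. Qed.

Lemma tphi_explicit (f g : {poly K}) (x y : homog VH) :
  hval x = hcls (smulf (Cq f) (CE_one K)) -> hval y = hcls (smulf (Cq g) (Omega K)) ->
  gsub_val (tphi K0 [:: x; y] : GG_red K) = (-2) *: (smulf (Cq (f^`() * g)) (Euler K) : GG K).
Proof.
rewrite hcls_one hcls_Omega => ex ey.
have e : tphi K0 [:: x; y] = rd 0 (-2 *: (f^`() * g)) 0 0.
  rewrite /tphi /= /mor2 ex ey !(hcE K0); apply: rd_eq => //.
  by rewrite deriv0 mulr0 addr0.
rewrite e rd_val //; apply: etrans (esym (rdelZ1 _ _)) _; congr (_ *: _).
exact: rdel_Euler.
Qed.

Lemma tphi_equal_degree (x y : homog VH) : hdeg x = hdeg y -> tphi K0 [:: x; y] = 0.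
Proof.
move=> e; apply: etrans (rd0 K0); apply: rd_eq => //.
case: (coh_degree K0 x) => [[-> ->]|[d ->]|[d ->]]; case: (coh_degree K0 y) => [[-> ->]|[d' ->]|[d' ->]];
  rewrite ?deriv0 ?(mulr0, mul0r, addr0, scaler0) //.
- by rewrite d d' in e.
by rewrite d d' in e.
Qed.

End MinimalModel.

(** * Non-formality *)

Section FlatMorphism.
Variables (K : fieldType) (U V : gspace K) (b : V -> V) (br : V -> V -> V).
Hypothesis K0 : forall n, n.+1%:R != 0 :> K.
Local Notation sg n := ((-1) ^ (n) : K).
Variables (DV : Sym (gshift V) -> Sym (gshift V)) (F : Sym U -> Sym (gshift V)).
Hypothesis DVl : linear DV.
Hypothesis Fl : linear F.
Hypothesis Fc : coalg_morphism F.
Hypothesis DVt : forall w, taylor DV w = shift_map (dgla_map b br) w.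
Hypothesis DF : forall w, DV (F (sprod w)) = 0.

Lemma taylor_coalg_deg w : gpr (wdeg w) (taylor F w) = taylor F w.
Proof. by case: Fc => d _ _ _; exact: spr_deg (d w). Qed.

Let fh w : homog (gshift V) := mkhomog (taylor_coalg_deg w).

Lemma taylor_dgla1 (x : homog (gshift V)) : taylor DV [:: x] = b (hval x).
Proof. by rewrite DVt /shift_map /= mul0r addr0 expr0z scale1r. Qed.

Let DV2 (x y : homog (gshift V)) : taylor DV [:: x; y] = (- sg (hdeg x) *: br (hval x) (hval y) : V).
Proof.
rewrite DVt /shift_map /= mul1r mul0r !addr0; congr (_ *: _).
by rewrite /hdeg /= sgD expr1z mulrN1.
Qed.

(** The equations of a morphism from a zero differential. [quadratic_coalg] applies because a
    differential graded Lie algebra has Taylor coefficients of orders one and two only. *)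
Lemma flat_morphism w : b (taylor F w)
  + 2^-1 *: shsum w (fun u v => - sg (wdeg u) *: (br (taylor F u) (taylor F v) : V)) = 0.
Proof.
have z : spr (DV (F (sprod w))) = 0 by rewrite DF (linear0f (@spr_linear _ _)).
apply: etrans z; apply: esym.
apply: etrans (quadratic_coalg K0 (d := fun a => spr (DV a)) w _ _ Fc Fl) _.
- by apply: linear_compf; [exact: spr_linear|exact: DVl].
- move=> u u1 u2; apply: etrans (DVt u) _.
  by case: u u1 u2 => [|x [|y [|t u]]] // _ _; exact: scaler0.
apply: f_equal2.
  by rewrite -[taylor F w]/(hval (fh w)) lsm_hval smulE; exact: taylor_dgla1.
congr (_ *: _); apply: eq_shsum => u v _ _.
rewrite -[taylor F u]/(hval (fh u)) -[taylor F v]/(hval (fh v)) !lsm_hval !smulE.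
exact: DV2.
Qed.

End FlatMorphism.

Section NonFormality.
Variable K : fieldType.
Hypothesis K0 : forall n, n.+1%:R != 0 :> K.
Local Notation sg n := ((-1) ^ (n) : K).

Lemma form_part_homog (y : homog (gshift (GG K))) :
  form_part (hdeg y + 1 + 1) (hval y) = hval y.
Proof. exact: homogP y. Qed.

Lemma lmod_sub_eq (W : lmodType K) (a b c : W) : a - b = c -> c = 0 -> a = b.
Proof. by move=> <-; exact: subr0_eq. Qed.

Lemma lmod_sub_swap (W : lmodType K) (a b c d : W) : a - b = c -> c = d -> b = a - d.
Proof. by move=> <- <-; rewrite subKr. Qed.

Lemma add_half2 (W : lmodType K) (d A B : W) (s1 s2 s3 : K) : s1 = 1 -> s2 = 1 -> s3 = -1 ->
  d + 2^-1 *: (- s1 *: A + s2 *: (- s3 *: B)) = 0 -> d + 2^-1 *: (B - A) = 0.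
Proof. by move=> -> -> ->; rewrite opprK !scale1r scaleN1r [- A + B]addrC. Qed.

(** The shape of the equation at (x_1, x_1, x_2): A and B are the brackets of F(x_1, x_2) with
    F(x_1) in both orders, C and E those of F(x_1, x_1) with F(x_2). *)
Lemma add_half3 (W : lmodType K) (d A B C E : W) (r1 r2 r3 s1 s2 t1 t2 t3 t4 : K) :
  d = 0 -> C = 0 -> E = 0 -> r1 = 1 -> r2 = 1 -> r3 = 1 -> s1 = -1 -> s2 = 1 ->
  d + 2^-1 *: (t1 *: C + r1 *: (- s1 *: A) + - s2 *: B + r2 *: (- s1 *: A) + r3 *: (- s2 *: B)
    + t2 *: (t3 *: (t4 *: E))) = 0 -> A - B = 0.
Proof.
move=> -> -> -> -> -> -> -> ->; rewrite !scaler0 opprK !scale1r add0r addr0 add0r scaleN1r.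
rewrite -addrA => /eqP; rewrite scaler_eq0 invr_eq0 (negbTE (K0 1)) /= -mulr2n -scaler_nat.
by rewrite scaler_eq0 (negbTE (K0 1)) => /eqP.
Qed.

Theorem not_formal : ~ formal (@delta_g K) (@schouten K).
Proof.
case=> DH [DV [F [[[DHc _ DH1] DHt] [[DVc _ _] DVt] [[Fc FD] [_ Fsurj]]]]].
have lin (A B : lmodType K) (f : {linear A -> B}) : linear f by move=> s u v; exact: linearP.
(* The bracket on the cohomology is 0, so all Taylor coefficients of the source structure vanish. *)
have DH0 w : DH (sprod w) = 0.
  apply: (coderivation_eq0 K0 DHc (lin _ _ DH)) => w'; rewrite DHt.
  case: w' => [|x [|y [|z w']]]; rewrite /shift_map /=; try exact: scaler0.
  by rewrite (cohom_br0 K0); exact: scaler0.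
have DF w : DV (F (sprod w)) = 0 by rewrite -FD DH0; exact: (linear0f (lin _ _ F)).
have flat := flat_morphism K0 (lin _ _ DV) (lin _ _ F) Fc DVt DF.
have Fdeg := taylor_coalg_deg Fc.
have F0 : taylor F [::] = 0.
  by rewrite /taylor; case: Fc => _ _ _ ->; rewrite sprE.
have DV1 := taylor_dgla1 DVt.
have gq : @gpr K (gshift (GG K)) (-2) (rdel 'X 0 0 0) = rdel 'X 0 0 0.
  by apply: etrans (form_part_rdel _ _ _ _ _) _.
have [|x1 [/= d1 _ [y1 e1 f1]]] := Fsurj (mkhomog gq).
  by apply: etrans (DV1 _) _; exact: delta_harm.
have gO : @gpr K (gshift (GG K)) 1 (rdel 0 0 0 1) = rdel 0 0 0 1.
  by apply: etrans (form_part_rdel _ _ _ _ _) _.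
have [|x2 [/= d2 _ [y2 e2 f2]]] := Fsurj (mkhomog gO).
  by apply: etrans (DV1 _) _; exact: delta_harm.
have {}f1 : taylor F [:: x1] = rdel 'X 0 0 0.
  (* The correction has degree -3, that is form degree -1, so F(x_1) is q itself. *)
  have y0 : hval y1 = 0 by rewrite -(form_part_homog y1) e1; apply: form_part_neg.
  have d0 : taylor DV [:: y1] = 0.
    by apply: etrans (DV1 _) _; rewrite y0; exact: (linear0f (delta_linear K0)).
  have e3 := @lmod_sub_eq (gshift (GG K)) _ _ _ f1 d0.
  exact: esym e3.
have {}f2 : taylor F [:: x2] = (rdel 0 0 0 1 : GG K) - delta_g (hval y2).
  have d0 : taylor DV [:: y2] = delta_g (hval y2) by exact: DV1.
  exact: (@lmod_sub_swap (gshift (GG K)) _ _ _ _ f2 d0).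
have gW : form_part 2 (hval y2) = hval y2.
  by rewrite -{2}(form_part_homog y2) e2.
have wd w : form_part (wdeg w + 1 + 1) (taylor F w) = taylor F w := Fdeg w.
have wneg w : wdeg w + 1 + 1 < 0 -> taylor F w = 0.
  by move=> w0; rewrite -(wd w); exact: form_part_neg.
(* Adding 2 to the total degrees -4 and -3 gives the form degrees -2 and -1. *)
have w11 : taylor F [:: x1; x1] = 0 by apply: wneg; rewrite !wdeg_cons wdeg_nil d1.
have w112 : taylor F [:: x1; x1; x2] = 0 by apply: wneg; rewrite !wdeg_cons wdeg_nil d1 d2.
have gV : form_part 1 (taylor F [:: x1; x2]) = taylor F [:: x1; x2].
  by rewrite -{2}(wd [:: x1; x2]) !wdeg_cons wdeg_nil d1 d2.
have [[[sN1 s1] sN2] _] := sg_odd K.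
have {}d1 : hdeg x1 = -2 := d1.
have {}d2 : hdeg x2 = 1 := d2.
have e12 : wdeg [:: x1; x2] = -1 by rewrite !wdeg_cons wdeg_nil d1 d2.
have br0l u v : size u = 0%N -> - sg (wdeg u) *: (schouten (taylor F u : GG K) (taylor F v) : GG K) = 0.
  by move/size0nil ->; rewrite F0 schouten0l scaler0.
have br0r u v : size v = 0%N -> - sg (wdeg u) *: (schouten (taylor F u : GG K) (taylor F v) : GG K) = 0.
  by move/size0nil ->; rewrite F0 schouten0r scaler0.
apply: (no_extension K0 gV gW).
  rewrite -f2 -f1; have := flat [:: x1; x2]; rewrite (shsum2_mid _ _ br0l br0r).
  by apply: add_half2; rewrite ?wdeg_cons ?wdeg_nil ?d1 ?d2.
rewrite -f1; have := flat [:: x1; x1; x2]; rewrite (shsum3_mid _ _ _ br0l br0r).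
apply: add_half3; rewrite ?w11 ?w112 ?schouten0r ?schouten0l ?e12 ?wdeg_cons ?wdeg_nil ?d1 ?d2 //.
exact: (linear0f (delta_linear K0)).
all: by rewrite sgM2 sN2 if11.
Qed.

End NonFormality.

Theorem theorem3p7 (R : realType) :
  let K : fieldType := R[i] in
  ~ formal (@delta_g K) (@schouten K) /\
  exists (phi1 : HH K -> GG K) (phi2 : HH K -> HH K -> GG K)
         (d : {linear Sym (gshift (HH K)) -> Sym (gshift (HH K))}),
    [/\ char_data (@schouten K) phi1 phi2,
        Linfty_structure d,
        forall w, taylor d w = shift_map (z3 (@schouten K) phi1 phi2) w,
        forall n1 n2 n3 : int,
          (exists x1 x2 x3 : homog (gshift (HH K)),
             [/\ hdeg x1 = n1, hdeg x2 = n2, hdeg x3 = n3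
               & taylor d [:: x1; x2; x3] <> 0]) <->
          perm_eq [:: n1; n2; n3] [:: -2; -2; 1] \/
          perm_eq [:: n1; n2; n3] [:: -2; 1; 1]
      & exists (i : {linear HH K -> GG_red K})
          (dred : {linear Sym (gshift (GG_red K)) -> Sym (gshift (GG_red K))})
          (F : {linear Sym (gshift (HH K)) -> Sym (gshift (GG_red K))}),
          [/\ natural_injection i,
              dgla_Linfty (@delta_red K) (@schouten_red K) dred,
              Linfty_quasi_iso d dred F,
              (forall w, size w <> 1%N -> size w <> 2%N -> taylor F w = 0) /\
              (forall x, taylor F [:: x] = i (hval x))
            & (forall (f g : {poly K}) (x y : homog (gshift (HH K))),
                 hval x = hcls (smulf (Cq f) (CE_one K)) ->
                 hval y = hcls (smulf (Cq g) (Omega K)) ->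
                 gsub_val (taylor F [:: x; y])
                   = (-2) *: (smulf (Cq (f^`() * g)) (Euler K) : GG K)) /\
              (forall x y : homog (gshift (HH K)),
                 hdeg x = hdeg y -> taylor F [:: x; y] = 0)]].
Proof.
move=> K; have K0 n : n.+1%:R != 0 :> K by rewrite Num.Theory.pnatr_eq0.
(* From here on only characteristic 0 of the field is remembered. *)
clearbody K; split; first exact: not_formal.
pose d : {linear Sym (gshift (HH K)) -> Sym (gshift (HH K))} :=
  HB.pack (tcoder (tcoh K0)) (GRing.isLinear.Build K _ _ _ (tcoder (tcoh K0)) (tcoder_linear (tcoh_compat K0))).
pose i : {linear HH K -> GG_red K} :=
  HB.pack (nat_inj K0) (GRing.isLinear.Build K _ _ _ (nat_inj K0) (nat_inj_linear K0)).
pose dred : {linear Sym (gshift (GG_red K)) -> Sym (gshift (GG_red K))} :=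
  HB.pack (tcoder (@tred K)) (GRing.isLinear.Build K _ _ _ (tcoder (@tred K)) (tcoder_linear (tred_compat K0))).
pose F : {linear Sym (gshift (HH K)) -> Sym (gshift (GG_red K))} :=
  HB.pack (mor K0) (GRing.isLinear.Build K _ _ _ (mor K0) (mor_linear K0)).
exists (harm K0), (harm2 K0), d; split.
- exact: harm_char_data.
- exact: tcoh_Linfty.
- move=> w; exact: etrans (taylor_coh K0 w) (esym (shift_map_coh K0 w)).
- exact: cubic_degrees.
exists i, dred, F; split.
- exact: nat_injP.
- exact: tred_Linfty.
- split; last exact: mor_cohomology_iso.
  split; [exact: mor_coalg|exact: mor_intertwine].
- split=> [[|x [|y [|z w]]] // _ _|x]; exact: taylor_mor.
split=> [f g x y ex ey|x y e].
  by rewrite -(tphi_explicit K0 ex ey); congr gsub_val; exact: taylor_mor.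
exact: etrans (taylor_mor K0 _) (tphi_equal_degree K0 e).
Qed.
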